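(* Suppose that $M_\infty=0$ and that for each initial value $x\in\mathcal{X}$ (so $X_0=x$): (1) $l(X)=(l(X_t))_{t\ge0}$ and $u(X)=(u(X_t))_{t\ge0}$ belong to $\mathcal{H}^2_{\alpha,\infty}$ for some $\alpha>-r$; (2) $\mathbb{E}[\sup_{t\ge0}(L_t\vee U_t)]<\infty$, and $L_\infty=\lim_{t\uparrow\infty}L_t$ and $U_\infty=\lim_{t\uparrow\infty}U_t$ both exist a.s. Then: (a) the Dynkin game under the common Poisson constraint has a value $v^C(x)$ for every $x\in\mathcal{X}$, with saddle point $(\eta^C_{A^C},\eta^C_{B^C})$, where $A^C=\{x:v^C(x)<l(x)\}\cup\{x:v^C(x)\ge l(x)>u(x)\}$ and $B^C=\{x:v^C(x)>u(x)\}$; (b) for every $x\in\mathcal{X}$ and every $\gamma\in\mathcal{R}^C(\lambda)$, $e^{-r\gamma}\mathbb{E}^{X^x_\gamma}[M_\infty\mathbf{1}_{\{\eta^C_{A^C}\wedge\eta^C_{B^C}=\infty\}}]=\mathbb{E}^x[M_\infty\mathbf{1}_{\{\eta^C_{A^C}\wedge\eta^C_{B^C}=\infty\}}|\mathcal{F}_\gamma]$; (c) for every $x\in\mathcal{X}$, $$v^C(x)=\mathbb{E}^x\Big[e^{-rT_1^C}\max\big\{l(X_{T_1^C}),\min(v^C(X_{T_1^C}),u(X_{T_1^C}))\big\}\Big].$$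
   Context: Setting. On a probability space $(\Omega,\mathcal{F},\mathbb{P})$, $X$ is a regular linear (time-homogeneous) diffusion driven by a one-dimensional Brownian motion $W$, with state space an open interval $\mathcal{X}\subset\mathbb{R}$; $X$ does not die inside $\mathcal{X}$ and the endpoints of $\mathcal{X}$ are not exit points. $\mathbb{P}^x,\mathbb{E}^x$ denote probability and expectation conditional on $X_0=x$, and $X^x$ is the diffusion started at $x$. Fix $r>0$, $\lambda>0$ and non-negative functions $l,u$ on $\mathcal{X}$; set $L_t=e^{-rt}l(X_t)$, $U_t=e^{-rt}u(X_t)$. $M_\infty$ denotes the payoff if neither player stops. The payoff is $$R(\tau,\sigma)=L_\tau\mathbf{1}_{\{\tau\le\sigma<\infty\}\cup\{\tau<\sigma=\infty\}}+U_\sigma\mathbf{1}_{\{\sigma<\tau\}}+M_\infty\mathbf{1}_{\{\tau=\sigma=\infty\}},$$ so that on simultaneous stopping the payoff is $L$. $J^x(\tau,\sigma)=\mathbb{E}^x[R(\tau,\sigma)]$. The \textsc{sup} player chooses $\tau$ to maximise and the \textsc{inf} player chooses $\sigma$ to minimise $J^x$. Common Poisson constraint. $(T^C_n)_{1\le n\le\infty}$, $T^C_\infty=\infty$, are the jump times of a Poisson process of rate $\lambda$ independent of $X$. The filtration $\mathbb{F}=(\mathcal{F}_t)$ is the augmentation (to satisfy the usual conditions) of the smallest filtration containing the natural filtrations of $X$ and of the Poisson process. $\mathcal{R}^C(\lambda)$ is the set of stopping times $\gamma$ with $\gamma(\omega)=T^C_n(\omega)$ for some $n\in\{1,\dots,\infty\}$.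 Both $\tau,\sigma$ are chosen in $\mathcal{R}^C(\lambda)$. The game has value $v^C(x)$ if $\inf_\sigma\sup_\tau J^x(\tau,\sigma)=\sup_\tau\inf_\sigma J^x(\tau,\sigma)=v^C(x)$ over $\tau,\sigma\in\mathcal{R}^C(\lambda)$. A saddle point is a pair $(\tau^*,\sigma^* )$ in $\mathcal{R}^C(\lambda)\times\mathcal{R}^C(\lambda)$ with $J^x(\tau,\sigma^* )\le J^x(\tau^*,\sigma^* )\le J^x(\tau^*,\sigma)$ for all $\tau,\sigma\in\mathcal{R}^C(\lambda)$ (for every initial value $x$). For Borel $D\subset\mathcal{X}$, $\eta^C_D=\inf\{T^C_n:n\ge1,\ X_{T^C_n}\in D\}$. Function space: $\mathcal{H}^2_{a,\infty}$ is the set of $\mathbb{F}$-progressively measurable processes $Z$ with $\mathbb{E}[\int_0^\infty e^{2at}Z_t^2\,dt]<\infty$. *)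

(* Defs.v *)
From HB Require Import structures.
From mathcomp Require Import all_boot all_order all_algebra.
From mathcomp Require Import all_classical all_reals all_analysis.
From mathcomp Require Import measurable_realfun.

Set Implicit Arguments.
Unset Strict Implicit.
Unset Printing Implicit Defensive.

Import Order.TTheory GRing.Theory Num.Theory.
Import numFieldNormedType.Exports.

Local Open Scope classical_set_scope.
Local Open Scope ring_scope.

(* A continuous-time process is a function
   [Z : R -> Omega -> T]; only its values at times [t >= 0] are used. *)

Section processes.
Context {R : realType} {d : measure_display} {Omega : measurableType d}.
Variable P : probability Omega R.
Implicit Types (Fl Gl : R -> set (set Omega)) (G H : set (set Omega)).

Definition sigma_process {d'} {T : measurableType d'} (J : set R)
    (Z : R -> Omega -> T) : set (set Omega) :=
  <<s \bigcup_(t in J) g_sigma_algebra_preimage (Z t) >>.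

Definition natural_filtration {d'} {T : measurableType d'}
    (Z : R -> Omega -> T) : R -> set (set Omega) :=
  fun t => sigma_process `[0, t] Z.

Definition join_filtration Fl Gl : R -> set (set Omega) :=
  fun t => <<s Fl t `|` Gl t >>.

(* Usual augmentation: adjoin the P-null sets, then take right limits. *)
Definition augmentation Fl : R -> set (set Omega) :=
  fun t => \bigcap_(s in `]t, +oo[) <<s Fl s `|` P.-negligible >>.

Definition independent_sigma G H : Prop :=
  forall A B, G A -> H B -> P (A `&` B) = (P A * P B)%E.

Definition adapted Fl (Z : R -> Omega -> R) : Prop :=
  forall t : R, 0 <= t -> forall B : set R, measurable B -> Fl t (Z t @^-1` B).

Definition stopping_time Fl (tau : Omega -> \bar R) : Prop :=
  (forall w, (0 <= tau w)%E) /\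
  (forall t : R, 0 <= t -> Fl t [set w | (tau w <= t%:E)%E]).

Definition stopped_sigma Fl (tau : Omega -> \bar R) : set (set Omega) :=
  [set A | <<s \bigcup_(t in `[0, +oo[) Fl t >> A /\
           forall t : R, 0 <= t -> Fl t (A `&` [set w | (tau w <= t%:E)%E])].

Definition progressively_measurable Fl (Z : R -> Omega -> R) : Prop :=
  forall t : R, 0 <= t ->
    measurable_fun
      ([set` `[0, t]] `*` setT : set (R * g_sigma_algebraType (Fl t)))
      (fun p => Z p.1 p.2).

(* H^2_{a, infty}. *)
Definition H2 Fl (a : R) : set (R -> Omega -> R) :=
  [set Z | progressively_measurable Fl Z /\
    (\int[P]_w \int[lebesgue_measure]_(t in `[0%R, +oo[)
       (expR (2 * a * t) * Z t w ^+ 2)%:E < +oo)%E].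

(* [Z] is a version of the conditional expectation E[Y | G]. *)
Definition is_cond_expectation G (Y : Omega -> R) (Z : Omega -> \bar R) : Prop :=
  [/\ P.-integrable setT (EFin \o Y),
      P.-integrable setT Z,
      measurable_fun [set: g_sigma_algebraType G] Z &
      forall A, G A -> (\int[P]_(w in A) Z w = \int[P]_(w in A) (Y w)%:E)%E].

Definition cvg_in_probability (Z : nat -> Omega -> \bar R) : Prop :=
  forall e, 0 < e -> P [set w | (e%:E <= Z n w)%E] @[n --> \oo] --> 0%E.

Definition brownian_motion Fl (W : R -> Omega -> R) : Prop :=
  [/\ adapted Fl W,
      forall w, W 0 w = 0,
      forall w, {within `[0, +oo[, continuous (fun t => W t w)},
      forall s t : R, 0 <= s < t -> forall B : set R, measurable B ->
        P [set w | B (W t w - W s w)] = normal_prob 0 (Num.sqrt (t - s)) B &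
      forall s t : R, 0 <= s < t ->
        independent_sigma
          (g_sigma_algebra_preimage (fun w => W t w - W s w)) (Fl s)].

Record simple_process Fl := SimpleProcess {
  sp_size : nat ;
  sp_time : nat -> R ;
  sp_coef : nat -> Omega -> R ;
  sp_time_ge0 : forall i, 0 <= sp_time i ;
  sp_time_nd : forall i, sp_time i <= sp_time i.+1 ;
  sp_coef_adapted : forall i (B : set R), measurable B ->
    Fl (sp_time i) (sp_coef i @^-1` B) ;
  sp_coef_bounded : forall i, exists c, forall w, `|sp_coef i w| <= c }.

Definition sp_eval Fl (S : simple_process Fl) (t : R) (w : Omega) : R :=
  \sum_(i < sp_size S)
    sp_coef S i w * \1_(`]sp_time S i, sp_time S i.+1]%classic) t.

Definition sp_integral Fl (S : simple_process Fl) (W : R -> Omega -> R)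
    (t : R) (w : Omega) : R :=
  \sum_(i < sp_size S) sp_coef S i w *
    (W (Num.min (sp_time S i.+1) t) w - W (Num.min (sp_time S i) t) w).

(* [Y] is the Ito integral process of [H] with respect to [W], obtained as the
   limit in probability of the integrals of simple processes converging to [H]
   in L^2([0, t]) in probability, for every [t]. *)
Definition is_ito_integral Fl (W H Y : R -> Omega -> R) : Prop :=
  exists S : nat -> simple_process Fl, forall t : R, 0 <= t ->
    cvg_in_probability (fun n w =>
      \int[lebesgue_measure]_(s in `[0%R, t])
        ((sp_eval (S n) s w - H s w) ^+ 2)%:E)%E /\
    cvg_in_probability (fun n w => `|sp_integral (S n) W t w - Y t w|%:E).

(* [X x] is the diffusion started at [x], and P^x, E^x are the law and the
   expectation of [X x] under P. The paths live in the open interval [I] at all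
   times: there is no killing and no exit through the endpoints. *)

(* dX = b(X) dt + a(X) dW; [W] is a Brownian motion for the filtration
   generated by [X x] and [W]. *)
Definition driven_by (W : R -> Omega -> R) (I : set R)
    (X : R -> R -> Omega -> R) : Prop :=
  exists b a : R -> R,
    [/\ measurable_fun I b, measurable_fun I a &
    forall x, I x ->
      let Gl := join_filtration (natural_filtration (X x))
                                (natural_filtration W) in
      [/\ brownian_motion Gl W,
          {ae P, forall w, forall t : R, (0 <= t)%R ->
            (\int[lebesgue_measure]_(s in `[0%R, t])
               `|b (X x s w)|%:E < +oo)%E} &
          is_ito_integral Gl W (fun t w => a (X x t w))
            (fun t w => X x t w - x -
               \int[lebesgue_measure]_(s in `[0, t]) b (X x s w))]].

(* P^x (E, S < oo, X_{S+s} in B) = E^x [P^{X_S} (X_s in B); E, S < oo] for every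
   stopping time S of the augmented filtration of X and every E in F_S. *)
Definition strong_markov (I : set R) (X : R -> R -> Omega -> R) : Prop :=
  forall x, I x ->
  let Fl := augmentation (natural_filtration (X x)) in
  forall S, stopping_time Fl S ->
  forall E, stopped_sigma Fl S E ->
  forall (s : R) (B : set R), 0 <= s -> measurable B ->
    P (E `&` [set w | (S w < +oo)%E /\ B (X x (fine (S w) + s) w)]) =
    (\int[P]_(w in E `&` [set w | S w < +oo])
       P (X (X x (fine (S w)) w) s @^-1` B))%E.

Record regular_diffusion (W : R -> Omega -> R) (I : set R)
    (X : R -> R -> Omega -> R) : Prop := RegularDiffusion {
  rd_open : open I ;
  rd_interval : is_interval I ;
  rd_nonempty : I !=set0 ;
  rd_measurable : forall x t : R, I x -> 0 <= t -> measurable_fun setT (X x t) ;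
  rd_start : forall x w, I x -> X x 0 w = x ;
  rd_state : forall (x t : R) w, I x -> 0 <= t -> I (X x t w) ;
  rd_continuous : forall x w, I x ->
    {within `[0, +oo[, continuous (fun t => X x t w)} ;
  rd_transition : forall (t : R) (B : set R), 0 <= t -> measurable B ->
    measurable_fun I (fun x : R => P (X x t @^-1` B)) ;
  rd_strong_markov : strong_markov I X ;
  rd_regular : forall x y, I x -> I y ->
    (0 < P [set w | (exists2 t : R, 0 <= t & X x t w = y)%R])%E ;
  rd_driven : driven_by W I X }.

Record poisson_process (lambda : R) (N : R -> Omega -> nat) : Prop :=
  PoissonProcess {
  pp_measurable : forall t : R, 0 <= t -> measurable_fun setT (N t) ;
  pp_start : forall w, N 0 w = 0%N ;
  pp_nondecreasing : forall w (s t : R), 0 <= s <= t -> (N s w <= N t w)%N ;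
  pp_right_continuous : forall w (t : R), 0 <= t ->
    \forall s \near t^'+, N s w = N t w ;
  pp_increments : forall (s t : R) k, 0 <= s < t ->
    P [set w | (N t w - N s w)%N = k] =
      (poisson_pmf (lambda * (t - s)) k)%:E ;
  pp_independent : forall s t : R, 0 <= s < t ->
    independent_sigma
      (g_sigma_algebra_preimage (fun w => (N t w - N s w)%N))
      (natural_filtration N s) }.

(* The n-th jump time T^C_n, for n >= 1. *)
Definition jump_time (N : R -> Omega -> nat) (n : nat) (w : Omega) : \bar R :=
  ereal_inf [set t%:E | t in [set t : R | 0 <= t /\ (n <= N t w)%N]].

Definition common_filtration (Z : R -> Omega -> R) (N : R -> Omega -> nat) :
    R -> set (set Omega) :=
  augmentation (join_filtration (natural_filtration Z) (natural_filtration N)).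

(* The set R^C(lambda) for the diffusion path [Z]. *)
Definition poisson_stopping (Z : R -> Omega -> R) (N : R -> Omega -> nat) :
    set (Omega -> \bar R) :=
  [set gamma | stopping_time (common_filtration Z N) gamma /\
    forall w, gamma w = +oo%E \/
      exists2 n, (1 <= n)%N & gamma w = jump_time N n w].

(* eta^C_D; [Z] has no value at time +oo, so only finite T^C_n are considered
   (the infinite ones do not affect the infimum). *)
Definition poisson_hitting (Z : R -> Omega -> R) (N : R -> Omega -> nat)
    (D : set R) (w : Omega) : \bar R :=
  ereal_inf [set jump_time N n w | n in
    [set n : nat | [/\ (1 <= n)%N, (jump_time N n w < +oo)%E &
                       D (Z (fine (jump_time N n w)) w)]]].

(* e^{-rt}, equal to 0 for t = +oo. *)
Definition discount (r : R) (t : \bar R) : R :=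
  if (t < +oo)%E then expR (- r * fine t) else 0.

Section game.
Variables (r : R) (l u : R -> R).

Definition payoff (Z : R -> Omega -> R) (Minf : Omega -> R)
    (tau sigma : Omega -> \bar R) (w : Omega) : R :=
  if ((tau w <= sigma w) && (sigma w < +oo))%E
     || ((tau w < sigma w) && (sigma w == +oo))%E
  then discount r (tau w) * l (Z (fine (tau w)) w)
  else if (sigma w < tau w)%E
  then discount r (sigma w) * u (Z (fine (sigma w)) w)
  else Minf w.

Variables (X : R -> R -> Omega -> R) (N : R -> Omega -> nat)
  (M : R -> Omega -> R).

(* J^x; [M x] is the terminal payoff M_oo under P^x. *)
Definition expected_payoff (x : R) (tau sigma : Omega -> \bar R) : \bar R :=
  'E_P[payoff (X x) (M x) tau sigma].

Definition game_value (x v : R) : Prop :=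
  let RC := poisson_stopping (X x) N in
  ereal_inf [set ereal_sup [set expected_payoff x tau sigma | tau in RC]
            | sigma in RC] = v%:E /\
  ereal_sup [set ereal_inf [set expected_payoff x tau sigma | sigma in RC]
            | tau in RC] = v%:E.

Definition saddle_point (x : R) (tau' sigma' : Omega -> \bar R) : Prop :=
  let RC := poisson_stopping (X x) N in
  [/\ RC tau', RC sigma',
      forall tau, RC tau ->
        (expected_payoff x tau sigma' <= expected_payoff x tau' sigma')%E &
      forall sigma, RC sigma ->
        (expected_payoff x tau' sigma' <= expected_payoff x tau' sigma)%E].

End game.

End processes.

(* Main.v *)
Require Import Defs.
From HB Require Import structures.
From mathcomp Require Import all_boot all_order all_algebra.
From mathcomp Require Import all_classical all_reals all_analysis.
From mathcomp Require Import measurable_realfun.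
From mathcomp Require Import ring lra.
Import Order.TTheory GRing.Theory Num.Theory.
Import numFieldNormedType.Exports.
Local Open Scope classical_set_scope.
Local Open Scope ring_scope.

(** Write [Q f y] for the expectation, from the state [y], of the reward [f]
discounted and collected at the first Poisson time. The value of the game is
the increasing limit [v] of [v_0 = 0], [v_(k+1) = Q (max l (min v_k u))]. The
integrability of the supremum of the discounted payoffs keeps [v] finite, and
monotone convergence makes it a fixed point of this recursion, which is the
dynamic programming equation; see [valueE_fix] and [valueE_lty].

The saddle point rests on a strong Markov property of the pair formed by the
diffusion and the clock ([jump_identity]): on an event of the past of the
[n]-th jump time [T_n], the reward [f] at [T_(n+1)] and the reward [Q f] at
[T_n] have the same discounted expectation. At a fixed time [t] and for an
event of the completed past of [t], the analogous identity for the next jump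
after [t] follows from the Markov property of [X] and the independence of the
clock ([next_jump_integral]). To reach [T_n], time is cut into cells of length
[h], and on each cell [T_n] is replaced by the right end of the cell.
- Two jumps in one cell have a probability of order [h ^ 2].
- [G_t = exp (- r t) Q f (X_t)] is not known to have regular paths, but its
  mean square increments are controlled by those of the second moment of
  [G_t], up to a multiple of the elapsed time ([mean_square_increment]). These
  bounds telescope over the grid, and since [T_n] is independent of [X] each of
  them is multiplied by the probability, of order [h], that [T_n] falls into
  the cell.
On a bounded time interval the total error can thus be made arbitrarily small,
so the identity is exact.

Let now [S] be the minimum of two strategies and [psi = max l (min v u)]. The
identity and the fixed point equation show that the discounted value carried
to [T_n] by the paths with [T_n < S], plus the expected discounted [psi (X_S)]
on the other paths, is monotone in [n] when [psi] and [v] are ordered at the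
jumps before [S]. The limit compares [v] with the expected discounted
[psi (X_S)]: [stopped_le_value] and [value_le_stopped]. The second comparison
needs what is carried to [T_n] to vanish, which holds because a discounted
payoff that converges and satisfies the weighted square integrability
condition must tend to [0] ([square_integrable_limit0]). Before the hitting
time of [B] one has [v <= u], hence [v <= psi], and at it the payoff [u] is at
most [psi]; before the hitting time of [A] one has [l <= v] and [l <= u],
hence [psi <= v], and at it [psi] is at most the payoff [l]. This makes the two
hitting times optimal responses. The formula for the conditional expectation of
the terminal payoff holds because both sides vanish almost surely. *)

(** * Measure-theoretic preliminaries *)

Section induction.
Import HBNNSimple.

(** A nonnegative measurable function is an increasing limit of finite sums of
scaled indicators, so identities that are stable under these operations need
only be checked on indicators. *)
Lemma ge0_measurable_ind {d} {T : measurableType d} {R : realType}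
    (Pr : (T -> \bar R) -> Prop) :
  (forall A, measurable A -> Pr (fun x => (\1_A x)%:E)) ->
  (forall f g, measurable_fun setT f -> measurable_fun setT g ->
     (forall x, 0 <= f x)%E -> (forall x, 0 <= g x)%E ->
     Pr f -> Pr g -> Pr (fun x => f x + g x)%E) ->
  (forall (c : R) f, 0 <= c -> measurable_fun setT f -> (forall x, 0 <= f x)%E ->
     Pr f -> Pr (fun x => c%:E * f x)%E) ->
  (forall f_ : nat -> T -> \bar R, (forall n, measurable_fun setT (f_ n)) ->
     (forall n x, 0 <= f_ n x)%E ->
     (forall x, nondecreasing_seq (fun n => f_ n x)) ->
     (forall n, Pr (f_ n)) -> Pr (fun x => limn (fun n => f_ n x))) ->
  forall f, measurable_fun setT f -> (forall x, 0 <= f x)%E -> Pr f.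
Proof.
move=> Pind Padd Pscale Plim f mf f0.
have Pr0 : Pr (fun=> 0%E).
  rewrite (_ : (fun=> 0%E) = (fun x => (\1_set0 x)%:E)); first exact: Pind.
  by apply/funext => x; rewrite indic0.
pose g n := nnsfun_approx measurableT mf n.
have -> : f = (fun x => limn (fun n => (g n x)%:E)).
  apply/funext => x; apply/esym/cvg_lim => //.
  by apply: (@cvg_nnsfun_approx _ _ _ _ measurableT _ mf) => //.
apply: Plim.
- by move=> n; apply/measurable_EFinP.
- by move=> n x; rewrite lee_fin.
- by move=> x m n mn; rewrite lee_fin; exact/lefP/nd_nnsfun_approx.
move=> n; rewrite (_ : (fun x => _) = fun x =>
    (\sum_(y <- finmap.enum_fset (fset_set (range (g n))))
       (`|y|%:E * (\1_(g n @^-1` [set y]) x)%:E))%E).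
  elim: (finmap.enum_fset _) => [|y s IH].
    by under eq_fun do rewrite big_nil.
  under eq_fun do rewrite big_cons.
  have my z : measurable (g n @^-1` [set z]).
    by rewrite -[X in measurable X]setTI; exact: measurable_funP.
  have m1 z : measurable_fun setT (fun x => (`|z|%:E * (\1_(g n @^-1` [set z]) x)%:E)%E).
    apply: measurable_funeM; apply/measurable_EFinP.
    exact: measurable_indic.
  have p1 z x : (0 <= `|z|%:E * (\1_(g n @^-1` [set z]) x)%:E)%E.
    by rewrite -EFinM lee_fin mulr_ge0.
  apply: Padd => //.
  - exact: emeasurable_sum.
  - by move=> x; rewrite sume_ge0.
  - apply: Pscale => //.
    + by apply/measurable_EFinP; exact: measurable_indic.
    + exact: Pind.
apply/funext => x; rewrite fimfunE fsbig_finite//= -sumEFin.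
rewrite big_seq [RHS]big_seq; apply: eq_bigr => y.
rewrite in_fset_set// inE => -[z _ <-].
by rewrite ger0_norm// EFinM.
Qed.

End induction.

Definition seq_continuous_ge0 {R : realType} (f : R -> R) :=
  forall (s : nat -> R) (t : R), (forall n, 0 <= s n) -> 0 <= t ->
    s n @[n --> \oo] --> t -> f (s n) @[n --> \oo] --> f t.

Lemma within_seq_continuous {R : realType} (f : R -> R) :
  {within `[0, +oo[, continuous f} -> seq_continuous_ge0 f.
Proof.
move=> /subspace_continuousP cf s t s0 t0 st.
have {}cf : f x @[x --> within `[0, +oo[ (nbhs t)] --> f t.
  by apply: cf; rewrite /= in_itv/= t0.
apply: cvg_comp cf => U /= HU.
have sU : \forall n \near \oo, `[0, +oo[%classic (s n) -> U (s n) := st _ HU.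
change (\forall n \near \oo, U (s n)).
by apply: filterS sU => n; apply; rewrite /= in_itv/= s0.
Qed.

(** [F] is the pointwise limit of the functions that read the time off a grid
of mesh [1 / (m + 1)], each of which glues countably many measurable maps. *)
Lemma measurable_fun_caratheodory {d} {T : measurableType d} {R : realType}
    (F : R -> T -> R) :
  (forall t, 0 <= t -> measurable_fun setT (F t)) ->
  (forall w, seq_continuous_ge0 (F ^~ w)) ->
  measurable_fun setT (fun p : R * T => F (Num.max 0 p.1) p.2).
Proof.
move=> mF cF.
pose s (m : nat) (t : R) := (Num.truncn (Num.max 0 t * m.+1%:R))%:R / m.+1%:R : R.
have s0 m t : 0 <= s m t by rewrite divr_ge0.
have max0 (t : R) : 0 <= Num.max 0 t :> R by rewrite le_max lexx.
apply: (@measurable_fun_cvg _ _ _ _ (fun m (p : R * T) => F (s m p.1) p.2)).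
- move=> m _ B mB; rewrite setTI.
  rewrite (_ : _ @^-1` _ = \bigcup_k
     ([set t : R | Num.truncn (Num.max 0 t * m.+1%:R) = k] `*`
      (F (k%:R / m.+1%:R) @^-1` B))); last first.
    apply/seteqP; split => [[t w]/= H|[t w] [k _ [/= <-]]//].
    by exists (Num.truncn (Num.max 0 t * m.+1%:R)).
  apply: bigcupT_measurable => k; apply: measurableX.
    rewrite (_ : [set t | _] = (fun t : R => Num.max 0 t * m.+1%:R) @^-1`
       [set u | k%:R <= Num.max 0 u < k.+1%:R]).
      rewrite -[X in measurable X]setTI.
      have mm : measurable_fun setT (fun t : R => Num.max 0 t * m.+1%:R).
        by apply: measurable_funM => //; apply: measurable_maxr.
      apply: mm => //.
      rewrite (_ : [set u | _] = (fun u : R => Num.max 0 u) @^-1` `[k%:R, k.+1%:R[).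
        by rewrite -[X in measurable X]setTI; apply: measurable_maxr.
      by apply/seteqP; split => u/=; rewrite in_itv.
    have maxM (t : R) : Num.max 0 (Num.max 0 t * m.+1%:R) = Num.max 0 t * m.+1%:R.
      by apply: max_r; rewrite mulr_ge0.
    apply/seteqP; split => t /=; rewrite maxM.
      by move=> <-; rewrite truncn_le ?mulr_ge0//= truncnS_gt.
    by move=> /truncn_def.
  by rewrite -[X in measurable X]setTI; apply: mF => //; rewrite divr_ge0.
- move=> [t w] _ /=; apply: cF => //.
  have h : (Num.max 0 t - m.+1%:R^-1) @[m --> \oo] --> Num.max 0 t.
    rewrite -[X in _ --> X]subr0; apply: cvgB; first exact: cvg_cst.
    exact: cvg_harmonic.
  apply: (squeeze_cvgr _ h (cvg_cst _)); apply: nearW => m; rewrite /s.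
  rewrite ler_pdivrMr// ler_pdivlMr// mulrBl mulVf// truncn_le ?mulr_ge0// andbT.
  by rewrite lerBlDr natr1 ltW// truncnS_gt.
Qed.

Lemma integral_cst_prob {R : realType} {d} {T : measurableType d}
    (P : probability T R) (c : \bar R) : (\int[P]_w c)%E = c.
Proof.
have PT : (P : {measure set T -> \bar R}) setT = 1%E := probability_setT P.
by rewrite integral_cst// PT mule1.
Qed.

Section independent_integral.
Context {R : realType} {d : measure_display} {Omega : measurableType d}.
Variable P : probability Omega R.
Variables G H : set (set Omega).
Hypotheses (sG : sigma_algebra setT G) (sH : sigma_algebra setT H).
Hypotheses (mG : G `<=` measurable) (mH : H `<=` measurable).
Hypothesis indep : independent_sigma P G H.

Let TG := g_sigma_algebraType G.
Let TH := g_sigma_algebraType H.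
Let iG (w : Omega) : TG := w.
Let iH (w : Omega) : TH := w.
Let miG : measurable_fun setT iG.
Proof. by move=> _ B; rewrite setTI measurable_g_measurableTypeE// => /mG. Qed.
Let miH : measurable_fun setT iH.
Proof. by move=> _ B; rewrite setTI measurable_g_measurableTypeE// => /mH. Qed.
Let iHG (w : Omega) : (TH * TG)%type := (iH w, iG w).
Let miHG : measurable_fun setT iHG.
Proof. exact/measurable_fun_pairP. Qed.
HB.instance Definition _ := isMeasurableFun.Build _ _ _ _ iG miG.
HB.instance Definition _ := isMeasurableFun.Build _ _ _ _ iH miH.
HB.instance Definition _ := isMeasurableFun.Build _ _ _ _ iHG miHG.

(** By independence the diagonal map into the product of [Omega] with itself,
the factors carrying [H] and [G], has a product law, to which the theorem of
Tonelli applies. *)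
Lemma independent_integral (Phi : TH * TG -> \bar R) :
  measurable_fun setT Phi -> (forall p, 0 <= Phi p)%E ->
  (\int[P]_w Phi (w, w) = \int[P]_w' \int[P]_w Phi (w', w))%E.
Proof.
move=> mPhi Phi0.
rewrite -[LHS](@ge0_integral_distribution _ _ _ _ _ P iHG)//.
pose m1 := distribution P iH; pose m2 := distribution P iG.
have e : forall X, measurable X -> (m1 \x m2)%E X = distribution P iHG X.
  apply: product_measure_unique => A B.
  rewrite measurable_g_measurableTypeE// => HA.
  rewrite measurable_g_measurableTypeE// => GB.
  by rewrite /distribution/= /pushforward muleC -indep// setIC.
transitivity (\int[(m1 \x m2)%E]_z Phi z)%E.
  by apply: eq_measure_integral => A mA _; exact/esym/e.
rewrite fubini_tonelli1// /fubini_F ge0_integral_distribution//; last 2 first.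
  exact: measurable_fun_fubini_tonelli_F.
  by move=> x; exact: integral_ge0.
apply: eq_integral => w _ /=.
rewrite ge0_integral_distribution//.
exact: measurable_fun_pair2.
Qed.

Lemma measurable_independent_inner (Phi : TH * TG -> \bar R) :
  measurable_fun setT Phi -> (forall p, 0 <= Phi p)%E ->
  measurable_fun [set: Omega] (fun w' => \int[P]_w Phi (w', w))%E.
Proof.
move=> mPhi Phi0.
have m : measurable_fun setT (fun p : Omega * Omega => Phi (iH p.1, iG p.2)).
  apply: (measurableT_comp (g := fun p : Omega * Omega => (iH p.1, iG p.2)) mPhi).
  apply: measurable_fun_pair.
    exact: measurableT_comp miH measurable_fst.
  exact: measurableT_comp miG measurable_snd.
exact: (measurable_fun_fubini_tonelli_F (m2 := P) _ m (fun p => Phi0 _)).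
Qed.

End independent_integral.

Section dynkin_arguments.
Context {R : realType} {d : measure_display} {Omega : measurableType d}.
Variable P : probability Omega R.
Local Open Scope ereal_scope.

(** The finiteness of the total integral allows one to pass to complements, so
the events on which the two integrals agree form a Dynkin system. *)
Lemma eq_integral_pi_lambda (G : set (set Omega)) (f g : Omega -> \bar R) :
  setI_closed G -> G `<=` measurable -> G setT ->
  measurable_fun setT f -> measurable_fun setT g ->
  (forall w, 0 <= f w) -> (forall w, 0 <= g w) ->
  \int[P]_w f w < +oo ->
  (forall E, G E -> \int[P]_(w in E) f w = \int[P]_(w in E) g w) ->
  forall E, <<s G >> E -> \int[P]_(w in E) f w = \int[P]_(w in E) g w.
Proof.
move=> GI mG GT mf mg f0 g0 foo fg E.
rewrite -setI_closed_g_dynkin_g_sigma_algebra//.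
suff H : <<d G >> `<=` [set A | measurable A /\
    \int[P]_(w in A) f w = \int[P]_(w in A) g w] by move=> /H[].
have mfA (A : set Omega) : measurable_fun A f by exact: measurable_funTS.
have mgA (A : set Omega) : measurable_fun A g by exact: measurable_funTS.
apply: smallest_sub; last by move=> A GA; split; [exact: mG|exact: fg].
split.
- by split => //; exact: fg.
- move=> A [mA eA]; have mCA := measurableC mA; split => //.
  have spl h : measurable_fun setT h -> (forall w, 0 <= h w) ->
      \int[P]_w h w = \int[P]_(w in A) h w + \int[P]_(w in ~` A) h w.
    move=> mh h0; rewrite -ge0_integral_setU// ?setUv//.
    by rewrite disj_set2E setICr.
  have := fg _ GT; rewrite (spl f)// (spl g)// eA => H.
  have fin : \int[P]_(w in A) g w \is a fin_num.
    rewrite -eA ge0_fin_numE; last exact: integral_ge0.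
    by apply: le_lt_trans foo; exact: ge0_subset_integral.
  have : \int[P]_(w in A) g w + \int[P]_(w in ~` A) f w - \int[P]_(w in A) g w =
      \int[P]_(w in A) g w + \int[P]_(w in ~` A) g w - \int[P]_(w in A) g w by rewrite H.
  by rewrite !(addeC (\int[P]_(w in A) g w)) !addeK.
- move=> F tF QF; split; first by apply: bigcup_measurable => k _; exact: (QF k).1.
  have mF k : measurable (F k) by exact: (QF k).1.
  rewrite !ge0_integral_bigcup//; apply: eq_eseriesr => k _.
  exact: (QF k).2.
Qed.

(** Conditionally on [E], the variable [S] has the law of [T], the rays being
an intersection-stable generator of the Borel sets. *)
Lemma integral_comp_law (E : set Omega) (S T : Omega -> \bar R)
    (phi : \bar R -> \bar R) :
  measurable E -> measurable_fun setT S -> measurable_fun setT T ->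
  (forall r : R, P (E `&` [set w | r%:E < S w]) = P E * P [set w | r%:E < T w]) ->
  measurable_fun setT phi -> (forall t, 0 <= phi t) ->
  \int[P]_(w in E) phi (S w) = P E * \int[P]_w phi (T w).
Proof.
move=> mE mS mT law mphi phi0.
have mSA A : measurable A -> measurable (S @^-1` A).
  by move=> mA; rewrite -[X in measurable X]setTI; exact: mS.
have mTA A : measurable A -> measurable (T @^-1` A).
  by move=> mA; rewrite -[X in measurable X]setTI; exact: mT.
have lawA B : measurable B -> P (E `&` S @^-1` B) = P E * P (T @^-1` B).
  move=> mB; have {mB} : <<s @ErealGenOInfty.G R >> B.
    by rewrite -[<<s _ >>]/(@ErealGenOInfty.G R).-sigma.-measurable -ErealGenOInfty.measurableE.
  rewrite -setI_closed_g_dynkin_g_sigma_algebra; last first.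
    move=> _ _ [r ->] [s ->]; exists (Num.max r s).
    apply/seteqP; split => x /=; rewrite !in_itv/= !andbT EFin_max gt_max.
      by move=> [-> ->].
    by move=> /andP[].
  suff H : <<d @ErealGenOInfty.G R >> `<=` [set A | measurable A /\
    P (E `&` S @^-1` A) = P E * P (T @^-1` A)] by move=> /H[].
  apply: smallest_sub; last first.
    move=> _ [r ->]; split; first exact: emeasurable_itv.
    have e (U : Omega -> \bar R) : U @^-1` `]r%:E, +oo[ = [set w | r%:E < U w].
      by apply/seteqP; split => w/=; rewrite in_itv/= andbT.
    by rewrite !e.
  split.
  - by split => //; rewrite !preimage_setT setIT probability_setT mule1.
  - move=> A [mA eA]; split; first exact: measurableC.
    have -> : E `&` (S @^-1` (~` A)) = E `\` (S @^-1` A) by rewrite setDE.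
    have -> : T @^-1` (~` A) = ~` (T @^-1` A) by [].
    have -> : P (E `\` S @^-1` A) = P E - P (E `&` S @^-1` A).
      by rewrite measureD//; [exact: mSA|rewrite ltey_eq fin_num_measure].
    rewrite probability_setC; last exact: mTA.
    by rewrite eA muleBr ?mule1// ?fin_num_measure// fin_num_adde_defr//.
  - move=> F tF QF; split; first by apply: bigcupT_measurable => k; exact: (QF k).1.
    rewrite !preimage_bigcup setI_bigcupr.
    have mF k : measurable (F k) := (QF k).1.
    have tp (U : Omega -> \bar R) : trivIset setT (fun k => U @^-1` F k).
      apply/trivIsetP => i j _ _ ij; rewrite -preimage_setI.
      by move/trivIsetP : tF => ->//; rewrite preimage_set0.
    have -> : P (\bigcup_k (E `&` S @^-1` F k)) = \sum_(k <oo) P (E `&` S @^-1` F k).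
      have mES k : measurable (E `&` S @^-1` F k) by apply: measurableI => //; exact: mSA.
      apply: measure_semi_bigcup => //; last exact: bigcup_measurable.
      apply/trivIsetP => i j _ _ ij; rewrite setIACA.
      by move/trivIsetP : (tp S) => ->//; rewrite setI0.
    have -> : P (\bigcup_k (T @^-1` F k)) = \sum_(k <oo) P (T @^-1` F k).
      apply: measure_semi_bigcup => //; first by move=> k; exact: mTA.
      by apply: bigcup_measurable => k _; exact: mTA.
    rewrite -[P E in RHS]fineK ?fin_num_measure// -nneseriesZl//.
    by apply: eq_eseriesr => k _; rewrite (QF k).2 fineK// fin_num_measure.
apply: (@ge0_measurable_ind _ _ _ (fun phi => \int[P]_(w in E) phi (S w) =
    P E * \int[P]_w phi (T w))) => //.
- move=> A mA; rewrite -[LHS]/(\int[P]_(w in E) (\1_(S @^-1` A) w)%:E).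
  rewrite -[X in _ * X]/(\int[P]_w (\1_(T @^-1` A) w)%:E).
  rewrite integral_indic//; last exact: mSA.
  rewrite integral_indic//; last exact: mTA.
  by rewrite setIT setIC; exact: lawA.
- move=> f g mf mg f0 g0 ef eg.
  have mU (h : \bar R -> \bar R) (U : Omega -> \bar R) : measurable_fun setT h -> measurable_fun setT U ->
    measurable_fun setT (h \o U) by exact: measurableT_comp.
  have mS' (h : \bar R -> \bar R) : measurable_fun setT h -> measurable_fun E (h \o S).
    by move=> mh; apply: measurable_funTS; exact: mU.
  have -> : \int[P]_(w in E) (f (S w) + g (S w)) =
      \int[P]_(w in E) f (S w) + \int[P]_(w in E) g (S w).
    by apply: ge0_integralD => //; [exact: (mS' f)|exact: (mS' g)].
  have -> : \int[P]_w (f (T w) + g (T w)) = \int[P]_w f (T w) + \int[P]_w g (T w).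
    by apply: ge0_integralD => //; [exact: (mU f)|exact: (mU g)].
  by rewrite ef eg [RHS]ge0_muleDr//; exact: integral_ge0.
- move=> c f c0 mf f0 ef.
  rewrite !ge0_integralZl_EFin//.
  + by rewrite ef muleCA.
  + exact: measurableT_comp mf mT.
  + by apply: measurable_funTS; exact: measurableT_comp mf mS.
- move=> f_ mf f0 nd ef.
  have mT' n : measurable_fun setT (fun w => f_ n (T w)).
    exact: measurableT_comp (mf n) mT.
  have mS' n : measurable_fun E (fun w => f_ n (S w)).
    by apply: measurable_funTS; exact: measurableT_comp (mf n) mS.
  have -> : \int[P]_(w in E) limn (fun n => f_ n (S w)) =
      limn (fun n => \int[P]_(w in E) f_ n (S w)).
    by apply: monotone_convergence => // w _ m n mn; exact: nd.
  have -> : \int[P]_w limn (fun n => f_ n (T w)) = limn (fun n => \int[P]_w f_ n (T w)).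
    by apply: monotone_convergence => // w _ m n mn; exact: nd.
  under eq_fun do rewrite ef.
  rewrite limeMl//; first exact: fin_num_measure.
  apply: ereal_nondecreasing_is_cvgn => m n mn; apply: ge0_le_integral => //.
  by move=> w _; exact: nd.
Qed.
End dynkin_arguments.

Lemma integral_indicE {R : realType} {d} {T : measurableType d}
    (mu : {measure set T -> \bar R}) (D : set T) (f : T -> \bar R) :
  (\int[mu]_(x in D) f x = \int[mu]_x ((\1_D x)%:E * f x))%E.
Proof.
rewrite integral_mkcond; apply: eq_integral => x _; rewrite patchE indicE.
by case: (x \in D); rewrite ?mul1e ?mul0e.
Qed.

Lemma measurable_fine_comp {R : realType} {d} {T : measurableType d} (f : T -> \bar R) :
  measurable_fun setT f -> measurable_fun setT (fun w => fine (f w)).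
Proof. by move=> mf; apply: measurableT_comp mf; exact: fine_measurable. Qed.

Lemma bounded_integrable {R : realType} {d} {T : measurableType d}
    (P : probability T R) (D : set T) (u : T -> R) (c : R) :
  measurable D -> measurable_fun setT u -> (forall w, `|u w| <= c) ->
  P.-integrable D (EFin \o u).
Proof.
move=> mD mu uc; apply: measurable_bounded_integrable => //.
- by rewrite ltey_eq fin_num_measure.
- exact: measurable_funTS.
- by exists c; split; [exact: num_real|move=> M cM w _ /=; exact: le_trans (ltW cM)].
Qed.

(** The integral of a nonnegative function is a supremum over the simple
functions below it, hence is monotone even on non-measurable functions. This
is how the supremum of the discounted payoffs over uncountably many times is
used as a bound. *)
Lemma le_integral_lower {R : realType} {d} {T : measurableType d}
    (mu : {measure set T -> \bar R}) (f g : T -> \bar R) :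
  (forall x, 0 <= f x)%E -> (forall x, f x <= g x)%E ->
  (\int[mu]_x f x <= \int[mu]_x g x)%E.
Proof.
move=> f0 fg; have g0 x : (0 <= g x)%E := le_trans (f0 x) (fg x).
rewrite !ge0_integralTE//; apply: ereal_sup_le => _ [h hf <-].
by exists h => // x; exact: le_trans (hf x) (fg x).
Qed.

Lemma smallest_sigma_algebra0 {T} (G : set (set T)) : <<s G >> set0.
Proof. by have [] := smallest_sigma_algebra setT G. Qed.

Lemma smallest_sigma_algebraT {T} (G : set (set T)) : <<s G >> setT.
Proof.
have [s0 sC _] := smallest_sigma_algebra setT G.
by have := sC _ s0; rewrite setD0.
Qed.

Lemma measurable_limn {R : realType} (f_ : nat -> R -> \bar R) : (forall n, measurable_fun setT (f_ n)) ->
  (forall y, nondecreasing_seq (fun n => f_ n y)) ->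
  measurable_fun setT (fun y => limn (fun n => f_ n y)).
Proof.
move=> mf nd; apply: (emeasurable_fun_cvg f_) => // y _.
by apply: ereal_nondecreasing_is_cvgn; exact: nd.
Qed.

Lemma limn_ge0 {R : realType} (u_ : nat -> \bar R) : (forall n, 0 <= u_ n)%E -> nondecreasing_seq u_ ->
  (0 <= limn u_)%E.
Proof.
move=> u0 nd; apply: lime_ge; first exact: ereal_nondecreasing_is_cvgn.
exact: nearW.
Qed.

Section null_functions.
Context {R : realType} {d : measure_display} {Omega : measurableType d}.
Variable P : probability Omega R.
Hypothesis P_complete : measure_is_complete P.

Lemma ae0_measurable (g : Omega -> \bar R) : {ae P, forall w, g w = 0%E} ->
  measurable_fun setT g.
Proof.
move=> g0; apply: (ae_measurable_fun P_complete (f := cst 0%E)); last exact: measurable_cst.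
by apply: filterS g0 => w -> _.
Qed.

Lemma ae0_integral (g : Omega -> \bar R) : {ae P, forall w, g w = 0%E} ->
  (\int[P]_w g w = 0)%E.
Proof.
move=> g0; rewrite -(integral0 P setT); apply: ae_eq_integral => //.
  exact: ae0_measurable.
by apply: filterS g0 => w -> _.
Qed.

End null_functions.

(** * Poisson clocks *)

Section sigma_process_lemmas.
Context {R : realType} {d d' : measure_display} {Omega : measurableType d}
  {T : measurableType d'}.
Implicit Types (Z : R -> Omega -> T) (J : set R).

Lemma sigma_process_preimage J Z t (B : set T) :
  J t -> measurable B -> sigma_process J Z (Z t @^-1` B).
Proof.
by move=> Jt mB; apply: sub_sigma_algebra; exists t => //; exists B; rewrite ?setTI.
Qed.

Lemma sigma_process_min J Z (G : set (set Omega)) : sigma_algebra setT G ->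
  (forall t B, J t -> measurable B -> G (Z t @^-1` B)) -> sigma_process J Z `<=` G.
Proof.
move=> sG H; apply: smallest_sub => // _ [t Jt [B mB <-]].
by rewrite setTI; exact: H.
Qed.

Lemma sigma_process_measurable J Z :
  (forall t, J t -> measurable_fun setT (Z t)) -> sigma_process J Z `<=` measurable.
Proof.
move=> mZ; apply: sigma_process_min; first exact: sigma_algebra_measurable.
by move=> t B Jt mB; rewrite -[X in measurable X]setTI; exact: mZ.
Qed.

Lemma sigma_process_sub J J' Z : J `<=` J' -> sigma_process J Z `<=` sigma_process J' Z.
Proof.
move=> JJ'; apply: sigma_process_min; first exact: smallest_sigma_algebra.
by move=> t B Jt mB; apply: sigma_process_preimage => //; exact: JJ'.
Qed.

End sigma_process_lemmas.

Lemma measurable_ge0_ereal {R : realType} {d} {T : measurableType d} (f : T -> \bar R) :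
  (forall x, 0 <= f x)%E ->
  (forall t : R, 0 <= t -> measurable [set x | (f x <= t%:E)%E]) ->
  measurable_fun setT f.
Proof.
move=> f0 mf; apply: (measurability _ (ErealGenOInfty.measurableE R)).
move=> _ [_ [r ->] <-]; rewrite setTI.
have [r0|r0] := leP 0 r.
  rewrite (_ : _ @^-1` _ = ~` [set x | (f x <= r%:E)%E]); first exact/measurableC/mf.
  apply/seteqP; split => x /=; rewrite in_itv/= andbT.
    by rewrite ltNge => /negP.
  by rewrite ltNge => /negP.
rewrite (_ : _ @^-1` _ = setT)//; apply/seteqP; split => x //= _.
by rewrite in_itv/= andbT; apply: lt_le_trans (f0 x); rewrite lte_fin.
Qed.

Section jump_times.
Context {R : realType} {d : measure_display} {Omega : measurableType d}.
Variables (P : probability Omega R) (lambda : R) (N : R -> Omega -> nat).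
Hypothesis N_poisson : poisson_process P lambda N.
Hypothesis lambda_gt0 : 0 < lambda.

Lemma jump_time_ge0 n w : (0 <= jump_time N n w)%E.
Proof. by apply: le_ereal_inf_tmp => _ [t [t0 _] <-]; rewrite lee_fin. Qed.

(** Right-continuity of the counting process makes the infimum that defines a
jump time attained. *)
Lemma jump_time_le n w (t : R) : 0 <= t ->
  (jump_time N n w <= t%:E)%E = (n <= N t w)%N.
Proof.
move=> t0; apply/idP/idP; last first.
  by move=> nN; apply: ge_ereal_inf; exists t%:E => //; exists t.
apply: contraTT; rewrite -ltnNge -ltNge => Nn.
have := pp_right_continuous N_poisson w t0.
move=> [e /= e0 He].
apply: (@lt_le_trans _ _ (t + e / 2)%:E).
  by rewrite lte_fin ltrDl divr_gt0.
apply: le_ereal_inf_tmp => _ [s [s0 ns] <-]; rewrite lee_fin leNgt.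
apply/negP => sl; move: Nn; rewrite ltnNge => /negP; apply.
apply: (leq_trans ns); rewrite -(He (t + e / 2)).
- by apply: (pp_nondecreasing N_poisson); rewrite s0 ltW.
- rewrite /ball_/= opprD addrA subrr add0r normrN gtr0_norm ?divr_gt0//.
  by rewrite ltr_pdivrMr// ltr_pMr// ltr1n.
- by rewrite ltrDl divr_gt0.
Qed.

Lemma jump_time_gt n w (t : R) : 0 <= t ->
  (t%:E < jump_time N n w)%E = (N t w < n)%N.
Proof. by move=> t0; rewrite ltNge jump_time_le// ltnNge. Qed.

Lemma jump_time0 w : jump_time N 0 w = 0%E.
Proof. by apply/eqP; rewrite eq_le jump_time_ge0 jump_time_le. Qed.

Lemma jump_time_gt0 n w : (0 < n)%N -> (0 < jump_time N n w)%E.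
Proof. by move=> n0; rewrite jump_time_gt// (pp_start N_poisson). Qed.

Lemma jump_time_nondecreasing m n w : (m <= n)%N ->
  (jump_time N m w <= jump_time N n w)%E.
Proof.
move=> mn; apply: ereal_inf_le_tmp => _ [t [t0 nt] <-].
by exists t => //; split => //; exact: leq_trans nt.
Qed.

Definition next_jump (t : R) (w : Omega) : \bar R := jump_time N (N t w).+1 w.

Lemma next_jump_gt t w (s : R) : 0 <= t <= s ->
  (s%:E < next_jump t w)%E = (N s w == N t w)%N.
Proof.
move=> /andP[t0 ts]; rewrite jump_time_gt ?(le_trans t0)// ltnS eqn_leq.
have -> : (N t w <= N s w)%N by apply: (pp_nondecreasing N_poisson); rewrite t0.
by rewrite andbT.
Qed.

Lemma next_jump_gtt t w : 0 <= t -> (t%:E < next_jump t w)%E.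
Proof. by move=> t0; rewrite next_jump_gt ?t0/=. Qed.

Lemma measurable_pp t n : 0 <= t -> measurable [set w | (n <= N t w)%N].
Proof.
move=> t0; have mN := pp_measurable N_poisson t0.
rewrite (_ : [set w | _] = N t @^-1` [set k | (n <= k)%N])//.
by rewrite -[X in measurable X]setTI; exact: mN.
Qed.

Lemma natural_filtrationN_le s t n : 0 <= s <= t ->
  natural_filtration N t [set w | (n <= N s w)%N].
Proof.
move=> st; rewrite (_ : [set w | _] = N s @^-1` [set k | (n <= k)%N])//.
by apply: sigma_process_preimage => //; rewrite /= in_itv.
Qed.

Lemma natural_filtrationN_measurable t : natural_filtration N t `<=` measurable.
Proof.
apply: sigma_process_measurable => s /=; rewrite in_itv/= => /andP[s0 _].
exact: (pp_measurable N_poisson).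
Qed.

Lemma measurable_jump_time n : measurable_fun setT (jump_time N n).
Proof.
apply: measurable_ge0_ereal; first exact: jump_time_ge0.
move=> t t0; under eq_fun do rewrite jump_time_le//.
exact: measurable_pp.
Qed.

Lemma measurable_next_jump t : 0 <= t -> measurable_fun setT (next_jump t).
Proof.
move=> t0; apply: measurable_ge0_ereal; first by move=> w; exact: jump_time_ge0.
move=> s s0; rewrite (_ : [set w | _] =
    \bigcup_n ([set w | (N t w < n)%N] `&` [set w | (n <= N s w)%N])).
  apply: bigcup_measurable => n _; apply: measurableI; last exact: measurable_pp.
  rewrite (_ : [set w | _] = ~` [set w | (n <= N t w)%N]).
    exact/measurableC/measurable_pp.
  by apply/seteqP; split => w/=; rewrite ltnNge => /negP.
apply/seteqP; split => w /=; rewrite /next_jump jump_time_le//.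
  by move=> h; exists (N t w).+1 => //; split => /=.
by move=> [n _ [/= h1 h2]]; exact: leq_trans h2.
Qed.

Lemma measurable_increment (a b : R) k : 0 <= a -> 0 <= b ->
  measurable [set w | (N b w - N a w)%N = k].
Proof.
move=> a0 b0; rewrite (_ : [set w | _] = (fun w => (N b w, N a w)) @^-1`
    [set p : nat * nat | (p.1 - p.2)%N = k])//.
rewrite -[X in measurable X]setTI; apply: measurable_fun_pair => //.
- exact: (pp_measurable N_poisson).
- exact: (pp_measurable N_poisson).
rewrite (_ : [set p | _] = \bigcup_m ([set m + k]%N `*` [set m]) `|`
  \bigcup_m (if k == 0%N then ([set i | i <= m]%N `*` [set m]) else set0)).
  apply: measurableU; apply: bigcup_measurable => m _; first exact: measurableX.
  by case: ifP => // _; exact: measurableX.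
apply/seteqP; split => -[i j]/=.
  move=> <-; have [ij|ij] := leqP i j.
    by right; exists j => //; move: ij (ij); rewrite {1}/leq => /eqP ->.
  by left; exists j => //=; rewrite subnKC// ltnW.
case=> -[m _] /=; first by move=> [-> ->]; rewrite addKn.
by case: ifP => // /eqP -> /= [im ->]; apply/eqP.
Qed.

(** The waiting time after [t] is longer than [r - t] exactly when the increment of
the counting process over that interval is zero; such increments are stationary
and independent of the past. *)
Lemma next_jump_law (t r : R) E : 0 <= t -> natural_filtration N t E ->
  P (E `&` [set w | (r%:E < next_jump t w)%E]) =
  (P E * P [set w | (r%:E < t%:E + jump_time N 1 w)%E])%E.
Proof.
move=> t0 FE; have [rt|tr] := leP r t.
  have -> : [set w | (r%:E < next_jump t w)%E] = setT.
    apply/seteqP; split => // w _ /=.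
    by apply: le_lt_trans (next_jump_gtt t w t0); rewrite lee_fin.
  have -> : [set w | (r%:E < t%:E + jump_time N 1 w)%E] = setT.
    apply/seteqP; split => // w _ /=; rewrite -[r%:E]adde0.
    by rewrite lee_ltD// ?lee_fin// jump_time_gt0.
  by rewrite setIT probability_setT mule1.
have r0 := le_lt_trans t0 tr.
have -> : [set w | (r%:E < next_jump t w)%E] = [set w | (N r w - N t w)%N = 0%N].
  apply/seteqP; split => w /=; rewrite next_jump_gt ?t0 1?ltW//.
    by move=> /eqP ->; rewrite subnn.
  move=> /eqP; rewrite subn_eq0 eqn_leq => ->.
  by rewrite (pp_nondecreasing N_poisson)// t0 ltW.
have -> : [set w | (r%:E < t%:E + jump_time N 1 w)%E] =
    [set w | (N (r - t)%R w - N 0 w)%N = 0%N].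
  apply/seteqP; split => w /=; rewrite -lteBlDl// -EFinB jump_time_gt ?subr_ge0 1?ltW//.
    by rewrite (pp_start N_poisson) subn0 ltnS leqn0 => /eqP.
  by rewrite (pp_start N_poisson) subn0 => ->.
have := @pp_independent _ _ _ _ _ _ N_poisson t r.
rewrite t0 tr => /(_ isT) ind.
rewrite setIC ind//; last first.
  by exists [set 0%N] => //; rewrite setTI.
rewrite muleC (pp_increments N_poisson) ?t0//.
by rewrite (pp_increments N_poisson) ?subr0 ?lexx ?subr_gt0.
Qed.

Lemma poisson_ge1 (a b : R) : 0 <= a < b ->
  (P [set w | (1 <= N b w - N a w)%N] <= (lambda * (b - a))%:E)%E.
Proof.
move=> ab; have /andP[a0 ab'] := ab.
have x0 : 0 < lambda * (b - a) by rewrite mulr_gt0// subr_gt0.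
rewrite (_ : [set w | _] = ~` [set w | (N b w - N a w)%N = 0%N]); last first.
  by apply/seteqP; split => w /=; rewrite lt0n => /eqP.
rewrite probability_setC; last first.
  by apply: measurable_increment => //; rewrite (le_trans a0)// ltW.
rewrite (pp_increments N_poisson)// /poisson_pmf x0 expr0 mul1r fact0 invr1 mul1r.
by rewrite -EFinB lee_fin; have := expR_ge1Dx (- (lambda * (b - a))); lra.
Qed.

Lemma poisson_ge2 (a b : R) : 0 <= a < b ->
  (P [set w | (2 <= N b w - N a w)%N] <= ((lambda * (b - a)) ^+ 2)%:E)%E.
Proof.
move=> ab; have /andP[a0 ab'] := ab; have b0 := le_trans a0 (ltW ab').
set x := lambda * (b - a).
have x0 : 0 < x by rewrite mulr_gt0// subr_gt0.
rewrite (_ : [set w | _] = ~` ([set w | (N b w - N a w)%N = 0%N] `|`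
    [set w | (N b w - N a w)%N = 1%N])); last first.
  apply/seteqP; split => w /=; case: (N b w - N a w)%N => [|[|k]]//.
  - by move=> _ [].
  - by move=> h; exfalso; apply: h; left.
  - by move=> h; exfalso; apply: h; right.
have mI k := measurable_increment a b k a0 b0.
rewrite probability_setC; last exact: measurableU.
have -> : P ([set w | (N b w - N a w)%N = 0%N] `|` [set w | (N b w - N a w)%N = 1%N]) =
    (P [set w | (N b w - N a w)%N = 0%N] + P [set w | (N b w - N a w)%N = 1%N])%E.
  apply: measureU => //; apply/seteqP; split => w //= [-> //].
rewrite !(pp_increments N_poisson)// -/x /poisson_pmf x0.
rewrite expr0 expr1 fact0 invr1 !mul1r mulr1 -EFinD lee_fin.
(* The claim is (1 + x) exp (- x) >= 1 - x ^ 2 = (1 + x) (1 - x). *)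
have : 0 <= (1 + x) * (expR (- x) - (1 - x)).
  by rewrite mulr_ge0 ?subr_ge0 ?expR_ge1Dx// addr_ge0// ltW.
nra.
Qed.

End jump_times.

(** * The diffusion and its Markov property *)

Section families.
Context {R : realType} {d d' : measure_display} {Omega : measurableType d}
  {S : measurableType d'}.
Variable P : probability Omega R.
Variable Z : S -> Omega -> R.
Hypothesis mZ : forall z, measurable_fun setT (Z z).
Local Open Scope ereal_scope.

Let mZB z (B : set R) : measurable B -> measurable (Z z @^-1` B).
Proof. by move=> mB; rewrite -[X in measurable X]setTI; exact: mZ. Qed.

(** The rays are an intersection-stable generator of the Borel sets. *)
Lemma measurable_law_rays :
  (forall a : R, measurable_fun setT (fun z => P [set w | (a < Z z w)%R])) ->
  forall B, measurable B -> measurable_fun setT (fun z => P (Z z @^-1` B)).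
Proof.
move=> ray B.
have : <<s @RGenOInfty.G R >> `<=` [set B | measurable B /\
    measurable_fun setT (fun z => P (Z z @^-1` B))]; last first.
  move=> H mB; apply: (H B _).2.
  by rewrite -[<<s _ >>]/(@RGenOInfty.G R).-sigma.-measurable -RGenOInfty.measurableE.
rewrite -setI_closed_g_dynkin_g_sigma_algebra; last first.
  move=> _ _ [r ->] [s ->]; exists (Num.max r s).
  apply/seteqP; split => x /=; rewrite !in_itv/= !andbT gt_max.
    by move=> [-> ->].
  by move=> /andP[].
apply: smallest_sub; last first.
  move=> _ [a ->]; split => //.
  apply: eq_measurable_fun (ray a) => z _; congr (P _).
  by apply/seteqP; split => w/=; rewrite in_itv/= andbT.
split.
- split => //; apply: (eq_measurable_fun (fun=> 1)) => // z _.
  by rewrite preimage_setT probability_setT.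
- move=> A [mA hA]; split; first exact: measurableC.
  apply: (eq_measurable_fun (fun z => 1 - P (Z z @^-1` A))).
    by move=> z _; rewrite -probability_setC//; exact: mZB.
  exact: emeasurable_funB.
- move=> F tF QF; split; first by apply: bigcup_measurable => k _; exact: (QF k).1.
  have mF k : measurable (F k) := (QF k).1.
  apply: (eq_measurable_fun (fun z => \sum_(k <oo) P (Z z @^-1` F k))).
    move=> z _; rewrite preimage_bigcup; apply/esym/measure_semi_bigcup.
    + by move=> k; exact: mZB.
    + apply/trivIsetP => i j _ _ ij; rewrite -preimage_setI.
      by move/trivIsetP : tF => ->//; rewrite preimage_set0.
    + by apply: bigcup_measurable => k _; exact: mZB.
  by apply: ge0_emeasurable_sum => // k _; exact: (QF k).2.
Qed.

Lemma measurable_integral_family (h : R -> \bar R) :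
  (forall B, measurable B -> measurable_fun setT (fun z => P (Z z @^-1` B))) ->
  measurable_fun setT h -> (forall y, 0 <= h y) ->
  measurable_fun setT (fun z => \int[P]_w h (Z z w)).
Proof.
move=> mB; move: h.
have mhZ (h : R -> \bar R) z : measurable_fun setT h -> measurable_fun setT (fun w => h (Z z w)).
  by move=> mh; exact: measurableT_comp mh (mZ z).
apply: (@ge0_measurable_ind _ _ _ (fun h => measurable_fun setT (fun z => \int[P]_w h (Z z w)))).
- move=> A mA; apply: eq_measurable_fun (mB _ mA) => z _.
  by rewrite -[RHS]/(\int[P]_w (\1_(Z z @^-1` A) w)%:E) integral_indic ?setIT//; exact: mZB.
- move=> f g mf mg f0 g0 hf hg.
  apply: (eq_measurable_fun (fun z => \int[P]_w f (Z z w) + \int[P]_w g (Z z w))).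
    by move=> z _; rewrite ge0_integralD//; exact: mhZ.
  exact: emeasurable_funD.
- move=> c f c0 mf f0 hf.
  apply: (eq_measurable_fun (fun z => c%:E * \int[P]_w f (Z z w))).
    by move=> z _; rewrite ge0_integralZl_EFin//; exact: mhZ.
  exact: measurable_funeM.
- move=> f_ mf f0 nd hf.
  apply: (emeasurable_fun_cvg (fun n z => \int[P]_w f_ n (Z z w))) => //.
  move=> z _; apply: cvg_monotone_convergence => //.
  by move=> n; exact: mhZ.
Qed.

End families.

Section diffusion.
Context {R : realType} {d : measure_display} {Omega : measurableType d}.
Variable P : probability Omega R.
Variables (W : R -> Omega -> R) (I : set R) (X : R -> R -> Omega -> R).
Hypothesis X_diffusion : regular_diffusion P W I X.

Let x0 : R := sval (cid (rd_nonempty X_diffusion)).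
Let Ix0 : I x0. Proof. by rewrite /x0; case: cid. Qed.

(** The diffusion is only specified for starting points in [I] and for
nonnegative times. Moving other starting points to one fixed point of [I], and
negative times to [0], makes the functions built from it total. *)
Definition retract (y : R) : R := if y \in I then y else x0.

Lemma retract_in y : I (retract y).
Proof. by rewrite /retract; case: ifPn => // /set_mem. Qed.

Lemma retract_id y : I y -> retract y = y.
Proof. by move=> Iy; rewrite /retract mem_set. Qed.

Lemma measurable_interval : measurable I.
Proof. by apply: open_measurable; exact: (rd_open X_diffusion). Qed.

Lemma measurable_comp_retract {d'} {T : measurableType d'} (h : R -> T) :
  measurable_fun I h -> measurable_fun setT (h \o retract).
Proof.
move=> mh; have mI := measurable_interval.
have mr : measurable_fun setT retract.
  apply: measurable_fun_ifT => //.
  apply: (measurable_fun_bool true); rewrite setTI (_ : _ @^-1` _ = I)//.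
  by apply/seteqP; split => y /=; [move=> /set_mem|move=> /mem_set].
apply: (measurable_comp mI) => //.
by move=> _ [y _ <-]; exact: retract_in.
Qed.

Definition total_path (y t : R) : Omega -> R := X (retract y) (Num.max 0 t).

Lemma pathE y t : I y -> 0 <= t -> total_path y t = X y t.
Proof. by move=> Iy t0; rewrite /total_path retract_id// max_r. Qed.

Lemma path_in y t w : I (total_path y t w).
Proof.
by apply: (rd_state X_diffusion); [exact: retract_in|rewrite le_max lexx].
Qed.

Lemma X_seq_continuous y w : I y -> seq_continuous_ge0 (fun t => X y t w).
Proof. by move=> Iy; apply: within_seq_continuous; exact: (rd_continuous X_diffusion). Qed.

Lemma measurable_path y t : measurable_fun setT (total_path y t).
Proof.
by apply: (rd_measurable X_diffusion); [exact: retract_in|rewrite le_max lexx].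
Qed.

(** The map [pi] allows for another sigma-algebra on the sample space, such as
the one generated by the diffusion alone, which independence requires. *)
Lemma measurable_path_joint {d'} {T : measurableType d'} (pi : T -> Omega) y :
  (forall t, 0 <= t -> measurable_fun setT (fun w => X (retract y) t (pi w))) ->
  measurable_fun setT (fun p : R * T => total_path y p.1 (pi p.2)).
Proof.
move=> mX; apply: (measurable_fun_caratheodory (fun t w => X (retract y) t (pi w))) => //.
by move=> w; apply: X_seq_continuous; exact: retract_in.
Qed.

Local Open Scope ereal_scope.

(** Measurability in the state is given for each fixed time. The indicator of a
ray is an increasing limit of continuous functions, whose expectations are
continuous in time because the paths are; this gives joint measurability. *)
Let law_rays (a : R) : measurable_fun setT
  (fun p : R * R => P [set w | (a < total_path p.2 p.1 w)%R]).
Proof.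
pose h (k : nat) (z : R) : R := (Num.min 1 (k%:R * Num.max 0 (z - a)))%R.
have h0 k z : (0 <= h k z)%R by rewrite le_min ler01 mulr_ge0// le_max lexx.
have h1 k z : (h k z <= 1)%R by rewrite ge_min lexx.
have mh k : measurable_fun setT (h k).
  apply: measurable_minr => //; apply: measurable_funM => //.
  by apply: measurable_maxr => //; exact: measurable_funB.
have ch k : continuous (h k).
  move=> z.
  have c1 : {for z, continuous (fun z : R => Num.max 0 (z - a))%R}.
    apply: (@continuous_max _ _ (fun=> 0%R) (fun z => z - a)%R); first exact: cvg_cst.
    by apply: cvgB; [exact: cvg_id|exact: cvg_cst].
  apply: (@continuous_min _ _ (fun=> 1%R) (fun z => k%:R * Num.max 0 (z - a))%R).
    exact: cvg_cst.
  by apply: cvgM; [exact: cvg_cst|exact: c1].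
have mhX k y t : (0 <= t)%R -> I y -> measurable_fun setT (fun w => (h k (X y t w))%:E).
  move=> t0 Iy; apply/measurable_EFinP; apply: measurableT_comp => //.
  exact: (rd_measurable X_diffusion).
have hfin k y t : (0 <= t)%R -> I y -> \int[P]_w (h k (X y t w))%:E \is a fin_num.
  move=> t0 Iy; rewrite ge0_fin_numE; last by apply: integral_ge0 => w _; rewrite lee_fin.
  apply: (@le_lt_trans _ _ (\int[P]_w (cst 1 w))).
    apply: ge0_le_integral => //.
    - by move=> w _; rewrite lee_fin.
    - exact: mhX.
    - by move=> w _; rewrite lee_fin.
  by rewrite [X in (X < _)%E]integral_cst_prob ltry.
have mF k : measurable_fun setT
    (fun p : R * R => fine (\int[P]_w (h k (total_path p.2 p.1 w))%:E)).
  pose F (t y : R) := fine (\int[P]_w (h k (X (retract y) t w))%:E).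
  apply: (measurable_fun_caratheodory F).
    move=> t t0; apply: measurableT_comp => //.
    apply: (measurable_integral_family P (fun y => X (retract y) t) _ (EFin \o h k)) => //.
    - move=> y; apply: (rd_measurable X_diffusion) => //; exact: retract_in.
    - move=> B mB; apply: (measurable_comp_retract (fun y => P (X y t @^-1` B))).
      exact: (rd_transition X_diffusion).
    - exact/measurable_EFinP.
    - by move=> z; rewrite /= lee_fin.
  move=> y s t s0 t0 st; rewrite /F; have Ir := retract_in y.
  apply: fine_cvg; rewrite fineK; last exact: hfin.
  have [| | |_ _ +] := @dominated_convergence _ _ _ P setT measurableT
    (fun n w => (h k (X (retract y) (s n) w))%:E)
    (fun w => (h k (X (retract y) t w))%:E) (cst 1)
    (fun n => mhX k _ _ (s0 n) Ir) (mhX k _ _ t0 Ir).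
  - apply: aeW => w _; apply: cvg_EFin; first exact: nearW.
    apply: (@cvg_comp _ _ _ (fun n => X (retract y) (s n) w) (h k)); last exact: ch.
    exact: (X_seq_continuous _ w Ir _ _ s0 t0).
  - apply/integrableP; split => //.
    by rewrite (eq_integral (cst 1)) ?integral_cst_prob ?ltry// => w _; rewrite /= normr1.
  - by apply: aeW => w n _; rewrite /= lee_fin ger0_norm.
  - exact.
have mF' k : measurable_fun setT
    (fun p : R * R => \int[P]_w (h k (total_path p.2 p.1 w))%:E).
  apply: (eq_measurable_fun (EFin \o (fun p : R * R => fine (\int[P]_w (h k (total_path p.2 p.1 w))%:E)))).
    move=> [t y] _ /=; rewrite fineK// hfin//; [by rewrite le_max lexx|exact: retract_in].
  exact/measurable_EFinP.
apply: (emeasurable_fun_cvg (fun k (p : R * R) => \int[P]_w (h k (total_path p.2 p.1 w))%:E)) => //.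
move=> [t y] _ /=; set Z := total_path y t.
have mZ : measurable_fun setT Z by exact: measurable_path.
have mA : measurable [set w | (a < Z w)%R].
  rewrite (_ : [set w | _] = Z @^-1` `]a, +oo[).
    by rewrite -[X in measurable X]setTI; exact: mZ.
  by apply/seteqP; split => w /=; rewrite in_itv/= andbT.
have hlim w : (h k (Z w))%:E @[k --> \oo] --> (\1_[set w | (a < Z w)%R] w)%:E.
  apply: cvg_EFin; first exact: nearW.
  rewrite indicE; have [aZ|Za] := ltP a (Z w).
    rewrite mem_set//=; apply: cvg_near_cst.
    have Za0 : (0 < Z w - a)%R by rewrite subr_gt0.
    near=> k; rewrite /= /h; apply/min_idPl; rewrite max_r; last exact: ltW.
    rewrite -ler_pdivrMr// div1r; near: k; exact: nbhs_infty_ger.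
  rewrite memNset/=; last by rewrite /mkset ltNge Za.
  rewrite (_ : (fun k => _) = cst 0%R); first exact: cvg_cst.
  by apply/funext => k; rewrite /h max_l ?subr_le0// mulr0 min_r.
have -> : P [set w | (a < Z w)%R] = \int[P]_w limn (fun k => (h k (Z w))%:E).
  rewrite -[LHS](_ : \int[P]_w (\1_[set w | (a < Z w)%R] w)%:E = _).
    by apply: eq_integral => w _; apply/esym/cvg_lim => //; exact: hlim.
  by rewrite integral_indic// setIT.
apply: cvg_monotone_convergence => //.
- by move=> k; apply/measurable_EFinP; exact: measurableT_comp.
- by move=> k w _; rewrite lee_fin.
- move=> w _ m n mn; rewrite lee_fin /h le_min ge_min lexx/= ge_min; apply/orP; right.
  by apply: ler_wpM2r; [rewrite le_max lexx|rewrite ler_nat].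
Unshelve. all: by end_near. Qed.

Lemma measurable_transition (h : R -> \bar R) :
  measurable_fun setT h -> (forall y, 0 <= h y) ->
  measurable_fun setT (fun p : R * R => \int[P]_w h (total_path p.2 p.1 w)).
Proof.
move=> mh h0.
apply: (measurable_integral_family P (fun p : R * R => total_path p.2 p.1)) => //.
  by move=> p; exact: measurable_path.
apply: measurable_law_rays; first by move=> p; exact: measurable_path.
exact: law_rays.
Qed.

End diffusion.

Arguments retract {R d Omega P W I X} X_diffusion y.
Arguments total_path {R d Omega P W I X} X_diffusion y t _.

Section markov.
Context {R : realType} {d : measure_display} {Omega : measurableType d}.
Variable P : probability Omega R.
Variables (W : R -> Omega -> R) (I : set R) (X : R -> R -> Omega -> R).
Hypothesis X_diffusion : regular_diffusion P W I X.
Local Notation path := (total_path X_diffusion).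

Lemma natural_filtrationX_measurable x t : I x -> natural_filtration (X x) t `<=` measurable.
Proof.
move=> Ix; apply: sigma_process_measurable => s /=; rewrite in_itv/= => /andP[s0 _].
exact: (rd_measurable X_diffusion).
Qed.

Lemma measurable_X x t : I x -> 0 <= t -> measurable_fun setT (X x t).
Proof. exact: (rd_measurable X_diffusion). Qed.

(** A deterministic time is a stopping time of the augmented filtration, and an
event of the natural filtration at [t] belongs to its stopped sigma-algebra. *)
Lemma markov_set x t s E B : I x -> 0 <= t -> 0 <= s ->
  natural_filtration (X x) t E -> measurable B ->
  P (E `&` X x (t + s) @^-1` B) =
  (\int[P]_(w in E) P (path (X x t w) s @^-1` B))%E.
Proof.
move=> Ix t0 s0 FE mB.
set Fl := augmentation P (natural_filtration (X x)).
have Fl0 u : Fl u set0 by move=> v _; exact: smallest_sigma_algebra0.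
have FlT u : Fl u setT by move=> v _; exact: smallest_sigma_algebraT.
have FlE u : t <= u -> Fl u E.
  move=> tu v /=; rewrite in_itv/= andbT => uv; apply: sub_sigma_algebra; left.
  apply: sigma_process_sub FE => q /=; rewrite !in_itv/= => /andP[-> qt].
  by rewrite (le_trans qt)// (le_trans tu)// ltW.
have stS : stopping_time Fl (fun=> t%:E).
  split=> [w|u u0]; first by rewrite lee_fin.
  have [tu|ut] := leP t u.
    by rewrite (_ : [set _ | _] = setT)//; apply/seteqP; split => // w _ /=; rewrite lee_fin.
  rewrite (_ : [set _ | _] = set0)//; apply/seteqP; split => // w /=.
  by rewrite lee_fin leNgt ut.
have stE : stopped_sigma Fl (fun=> t%:E) E.
  split=> [|u u0].
    apply: sub_sigma_algebra; exists t; first by rewrite /= in_itv/= t0.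
    exact: FlE.
  have [tu|ut] := leP t u.
    rewrite (_ : [set _ | _] = setT) ?setIT; first exact: FlE.
    by apply/seteqP; split => // w _ /=; rewrite lee_fin.
  rewrite (_ : [set _ | _] = set0) ?setI0//; apply/seteqP; split => // w /=.
  by rewrite lee_fin leNgt ut.
have := rd_strong_markov X_diffusion Ix stS stE s0 mB.
rewrite (_ : E `&` [set w | (t%:E < +oo)%E /\ B (X x (t + s) w)] = E `&` X x (t + s) @^-1` B); last first.
  by apply/seteqP; split => w /= -[Ew]; [move=> []|move=> ?; rewrite ltry].
rewrite (_ : E `&` [set w | (t%:E < +oo)%E] = E); last first.
  by apply/seteqP; split => w /=; [case|move=> ?; rewrite ltry].
move=> ->; apply: eq_integral => w _.
by rewrite pathE//; exact: (rd_state X_diffusion).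
Qed.

Local Open Scope ereal_scope.

Lemma measurable_transition_X x t s (h : R -> \bar R) : I x -> (0 <= t)%R ->
  measurable_fun setT h -> (forall y, 0 <= h y) ->
  measurable_fun setT (fun w => \int[P]_w' h (path (X x t w) s w')).
Proof.
move=> Ix t0 mh h0; have mt := measurable_transition _ _ _ _ X_diffusion h mh h0.
apply: (measurableT_comp (f := fun p : R * R => \int[P]_w' h (path p.2 p.1 w')) (g := fun w => (s, X x t w))) => //.
by apply: measurable_fun_pair => //; exact: measurable_X.
Qed.

Lemma markov_integral x t s E (h : R -> \bar R) : I x -> (0 <= t)%R -> (0 <= s)%R ->
  natural_filtration (X x) t E -> measurable_fun setT h -> (forall y, 0 <= h y) ->
  \int[P]_(w in E) h (X x (t + s)%R w) =
  \int[P]_(w in E) \int[P]_w' h (path (X x t w) s w').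
Proof.
move=> Ix t0 s0 FE; move: h.
have mE : measurable E by exact: natural_filtrationX_measurable FE.
have mhX (h : R -> \bar R) : measurable_fun setT h ->
    measurable_fun E (fun w => h (X x (t + s)%R w)).
  move=> mh; apply: measurable_funTS; apply: measurableT_comp mh _.
  by apply: measurable_X => //; exact: addr_ge0.
have mhU (h : R -> \bar R) : measurable_fun setT h -> (forall y, 0 <= h y) ->
    measurable_fun E (fun w => \int[P]_w' h (path (X x t w) s w')).
  by move=> mh h0; apply: measurable_funTS; exact: measurable_transition_X.
have mhp (h : R -> \bar R) y : measurable_fun setT h ->
    measurable_fun setT (fun w => h (path y s w)).
  move=> mh; apply: measurableT_comp mh _; exact: measurable_path.
apply: (@ge0_measurable_ind _ _ _ (fun h => \int[P]_(w in E) h (X x (t + s)%R w) =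
  \int[P]_(w in E) \int[P]_w' h (path (X x t w) s w'))).
- move=> B mB.
  rewrite -[LHS]/(\int[P]_(w in E) (\1_(X x (t + s)%R @^-1` B) w)%:E).
  have mXB y u : I y -> (0 <= u)%R -> measurable (X y u @^-1` B).
    by move=> Iy u0; rewrite -[X in measurable X]setTI; exact: measurable_X.
  rewrite integral_indic//; last by apply: mXB => //; exact: addr_ge0.
  transitivity (P (E `&` X x (t + s)%R @^-1` B)); first by rewrite setIC.
  rewrite markov_set//; apply: eq_integral => w _.
  rewrite -[RHS]/(\int[P]_w' (\1_(path (X x t w) s @^-1` B) w')%:E).
  rewrite integral_indic ?setIT//.
  by rewrite -[X in measurable X]setTI; exact: (@measurable_path _ _ _ _ _ _ _ X_diffusion).
- move=> f g mf mg f0 g0 ef eg.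
  rewrite ge0_integralD//; [|exact: mhX|exact: mhX].
  rewrite ef eg -ge0_integralD//.
  + by apply: eq_integral => w _; rewrite ge0_integralD//; exact: mhp.
  + by move=> w _; exact: integral_ge0.
  + exact: mhU.
  + by move=> w _; exact: integral_ge0.
  + exact: mhU.
- move=> c f c0 mf f0 ef.
  rewrite ge0_integralZl_EFin//; last exact: mhX.
  rewrite ef -ge0_integralZl_EFin//.
  + by apply: eq_integral => w _; rewrite ge0_integralZl_EFin//; exact: mhp.
  + by move=> w _; exact: integral_ge0.
  + exact: mhU.
- move=> f_ mf f0 nd ef.
  have -> : \int[P]_(w in E) limn (fun n => f_ n (X x (t + s)%R w)) =
      limn (fun n => \int[P]_(w in E) f_ n (X x (t + s)%R w)).
    by apply: monotone_convergence => // n; exact: mhX.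
  have e y : \int[P]_w' limn (fun n => f_ n (path y s w')) =
      limn (fun n => \int[P]_w' f_ n (path y s w')).
    by apply: monotone_convergence => // n; exact: mhp.
  under [RHS]eq_integral do rewrite e.
  rewrite monotone_convergence//.
  + by congr (limn _); apply/funext => n; exact: ef.
  + by move=> n; exact: mhU.
  + by move=> n w _; exact: integral_ge0.
  + move=> w _ m n mn; apply: ge0_le_integral => //; [exact: mhp|exact: mhp|].
    by move=> w' _; exact: nd.
Qed.

End markov.

(** * The resolvent at the next Poisson time *)

Section discount.
Context {R : realType}.
Variable r : R.
Hypothesis r_gt0 : 0 < r.

Lemma discount_fin (t : R) : discount r t%:E = expR (- r * t).
Proof. by rewrite /discount ltry. Qed.

Lemma discounty : discount r +oo%E = 0.
Proof. by rewrite /discount ltxx. Qed.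

Lemma discount_ge0 t : 0 <= discount r t.
Proof. by rewrite /discount; case: ifP => // _; exact: expR_ge0. Qed.

Lemma discount_le1 t : (0 <= t)%E -> discount r t <= 1.
Proof.
move: t => [t| |]; rewrite ?discounty ?ler01// lee_fin => t0.
by rewrite discount_fin -expR0 ler_expR mulNr oppr_le0 mulr_ge0// ltW.
Qed.

Lemma measurable_discount : measurable_fun setT (discount r).
Proof.
apply: measurable_fun_ifT => //.
  by apply: measurable_fun_lte => //; exact: measurable_cst.
apply: measurableT_comp => //.
by apply: measurable_funM => //; exact: fine_measurable.
Qed.

Lemma measurable_discount_comp {d} {T : measurableType d} (f : T -> \bar R) :
  measurable_fun setT f -> measurable_fun setT (fun w => discount r (f w)).
Proof. exact: measurableT_comp measurable_discount. Qed.

Lemma discountD (t : R) (s : \bar R) : (0 <= s)%E ->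
  discount r (t%:E + s) = expR (- r * t) * discount r s.
Proof.
case: s => [s| |] // _; first by rewrite -EFinD !discount_fin mulrDr expRD.
by rewrite addey// !discounty mulr0.
Qed.

End discount.

Section next_jump_identity.
Context {R : realType} {d : measure_display} {Omega : measurableType d}.
Variable P : probability Omega R.
Variables (W : R -> Omega -> R) (I : set R) (X : R -> R -> Omega -> R).
Hypothesis X_diffusion : regular_diffusion P W I X.
Variables r lambda : R.
Variable N : R -> Omega -> nat.
Hypothesis N_poisson : poisson_process P lambda N.
Hypothesis N_indep : forall x, I x ->
  independent_sigma P (sigma_process `[0, +oo[ (X x)) (sigma_process `[0, +oo[ N).
Local Notation path := (total_path X_diffusion).
Local Notation T1 := (jump_time N 1).
Local Notation GX x := (sigma_process `[0, +oo[ (X x)).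
Local Notation GN := (sigma_process `[0, +oo[ N).

Local Open Scope ereal_scope.

(** This is [E^y(exp (- r T_1) f (X_(T_1)))], with the diffusion and the clock
integrated one after the other, a form whose measurability in [y] follows from
the theorem of Tonelli. *)
Definition resolvent (f : R -> \bar R) (y : R) : \bar R :=
  \int[P]_w' ((discount r (T1 w'))%:E * \int[P]_w f (path y (fine (T1 w')) w)).

Definition jump_payoff x (f : R -> \bar R) (tau : Omega -> \bar R) (w : Omega) :=
  (discount r (tau w))%:E * f (path x (fine (tau w)) w).

Lemma sigma_GX x : sigma_algebra setT (GX x).
Proof. exact: smallest_sigma_algebra. Qed.

Lemma sigma_GN : sigma_algebra setT GN.
Proof. exact: smallest_sigma_algebra. Qed.

Lemma GX_measurable x : I x -> GX x `<=` measurable.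
Proof.
move=> Ix; apply: sigma_process_measurable => s /=; rewrite in_itv/= andbT => s0.
exact: (rd_measurable X_diffusion).
Qed.

Lemma GN_measurable : GN `<=` measurable.
Proof.
apply: sigma_process_measurable => s /=; rewrite in_itv/= andbT => s0.
exact: (pp_measurable N_poisson).
Qed.

Lemma GN_le n t : (0 <= t)%R -> GN [set w | (n <= N t w)%N].
Proof.
move=> t0; rewrite (_ : [set w | _] = N t @^-1` [set k | (n <= k)%N])//.
by apply: sigma_process_preimage => //; rewrite /= in_itv/= t0.
Qed.

Lemma GN_next_jump t : (0 <= t)%R ->
  measurable_fun [set: g_sigma_algebraType GN] (next_jump N t).
Proof.
move=> t0; apply: measurable_ge0_ereal; first by move=> w; exact: jump_time_ge0.
move=> s s0; rewrite (_ : [set x | _] =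
    \bigcup_n ((~` [set w | (n <= N t w)%N]) `&` [set w | (n <= N s w)%N])).
  apply: bigcup_measurable => n _; apply: measurableI; [apply: measurableC|];
    by rewrite measurable_g_measurableTypeE; [exact: GN_le|exact: sigma_GN].
apply/seteqP; split => w /=; rewrite /next_jump (jump_time_le _ _ _ N_poisson)//.
  by move=> h; exists (N t w).+1 => //; split => //=; rewrite ltnn.
by move=> [n _ [/= /negP]]; rewrite -ltnNge => h1 h2; exact: leq_trans h2.
Qed.

Lemma measurable_GX_path x : I x -> measurable_fun setT
  (fun p : R * g_sigma_algebraType (GX x) => path x p.1 p.2).
Proof.
move=> Ix; apply: (@measurable_path_joint _ _ _ _ _ _ _ X_diffusion _
  (g_sigma_algebraType (GX x)) id) => t t0.
rewrite retract_id// => _ B mB; rewrite setTI measurable_g_measurableTypeE; last exact: sigma_GX.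
by apply: sigma_process_preimage => //; rewrite /= in_itv/= t0.
Qed.

Lemma measurable_path_at x (tau : Omega -> \bar R) : measurable_fun setT tau ->
  measurable_fun setT (fun w => path x (fine (tau w)) w).
Proof.
move=> mtau.
have mp : measurable_fun setT (fun p : R * Omega => path x p.1 p.2).
  apply: (@measurable_path_joint _ _ _ _ _ _ _ X_diffusion _ Omega id) => t t0.
  by apply: (rd_measurable X_diffusion) => //; exact: retract_in.
apply: (measurableT_comp (g := fun w => (fine (tau w), w)) mp).
by apply: measurable_fun_pair => //; exact: measurable_fine_comp.
Qed.

Lemma measurable_jump_payoff x f tau : measurable_fun setT f ->
  measurable_fun setT tau -> measurable_fun setT (jump_payoff x f tau).
Proof.
move=> mf mtau; apply: emeasurable_funM.
  by apply/measurable_EFinP; exact: measurable_discount_comp.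
exact: measurableT_comp mf (measurable_path_at x tau mtau).
Qed.

Lemma jump_payoff_ge0 x f tau w : (forall y, 0 <= f y) -> 0 <= jump_payoff x f tau w.
Proof. by move=> f0; rewrite mule_ge0// lee_fin discount_ge0. Qed.

Let measurable_T1 : measurable_fun setT T1.
Proof. exact: measurable_jump_time N_poisson _. Qed.

Lemma measurable_resolvent f : measurable_fun setT f -> (forall y, 0 <= f y) ->
  measurable_fun setT (resolvent f).
Proof.
move=> mf f0.
pose g (p : Omega * R) := (discount r (T1 p.1))%:E *
  \int[P]_w f (path p.2 (fine (T1 p.1)) w).
have mg : measurable_fun setT g.
  apply: emeasurable_funM.
    apply/measurable_EFinP; apply: measurable_discount_comp.
    exact: measurableT_comp measurable_T1 measurable_fst.
  apply: (measurableT_comp (g := fun p : Omega * R => (fine (T1 p.1), p.2))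
    (measurable_transition _ _ _ _ X_diffusion f mf f0)).
  apply: measurable_fun_pair => //.
  apply: measurable_fine_comp.
  exact: measurableT_comp measurable_T1 measurable_fst.
apply: (measurable_fun_fubini_tonelli_G (m1 := P) g mg) => p.
by rewrite mule_ge0 ?lee_fin ?discount_ge0//; exact: integral_ge0.
Qed.

Lemma resolvent_ge0 f y : (forall y, 0 <= f y) -> 0 <= resolvent f y.
Proof.
move=> f0; apply: integral_ge0 => w _; rewrite mule_ge0 ?lee_fin ?discount_ge0//.
exact: integral_ge0.
Qed.

(** By independence the diffusion can be integrated first, the clock being
frozen. The waiting time of the clock after [t] is then replaced by a fresh copy
of the first jump time, and for each value of that copy the Markov property at
[t] moves the expectation to the state [X_t]. *)
Lemma next_jump_integral_rect (x t : R) (f : R -> \bar R) E1 E2 : I x -> (0 <= t)%R ->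
  natural_filtration (X x) t E1 -> natural_filtration N t E2 ->
  measurable_fun setT f -> (forall y, 0 <= f y) ->
  \int[P]_(w in E1 `&` E2) jump_payoff x f (next_jump N t) w =
  \int[P]_(w in E1 `&` E2) ((expR (- r * t))%:E * resolvent f (X x t w)).
Proof.
move=> Ix t0 FE1 FE2 mf f0.
have sub0 : `[0%R, t]%classic `<=` `[0%R, +oo[%classic.
  by move=> s /=; rewrite !in_itv/= => /andP[->].
have GE1 : GX x E1 by apply: sigma_process_sub FE1.
have GE2 : GN E2 by apply: sigma_process_sub FE2.
have mE1 := GX_measurable _ Ix _ GE1; have mE2 := GN_measurable _ GE2.
pose TG := g_sigma_algebraType (GX x); pose TH := g_sigma_algebraType GN.
have mE1' : measurable (E1 : set TG) by rewrite measurable_g_measurableTypeE//; exact: sigma_GX.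
have mE2' : measurable (E2 : set TH) by rewrite measurable_g_measurableTypeE//; exact: sigma_GN.
have mnj := GN_next_jump t t0.
pose Phi (p : TH * TG) : \bar R :=
  ((\1_E2 p.1 * discount r (next_jump N t p.1))%:E *
  ((\1_E1 p.2)%:E * f (path x (fine (next_jump N t p.1)) p.2))).
have mPhi : measurable_fun setT Phi.
  apply: emeasurable_funM.
    apply/measurable_EFinP; apply: measurable_funM.
      by apply: measurableT_comp measurable_fst; exact: measurable_indic.
    apply: measurable_discount_comp.
    exact: measurableT_comp mnj measurable_fst.
  apply: emeasurable_funM.
    by apply/measurable_EFinP; apply: measurableT_comp measurable_snd; exact: measurable_indic.
  apply: measurableT_comp mf _.
  apply: (measurableT_comp (g := fun p : TH * TG => (fine (next_jump N t p.1), p.2))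
    (measurable_GX_path x Ix)).
  apply: measurable_fun_pair => //; apply: measurable_fine_comp.
  exact: measurableT_comp mnj measurable_fst.
pose phi (tau : \bar R) : \bar R :=
  (discount r tau)%:E * \int[P]_w ((\1_E1 w)%:E * f (path x (fine tau) w)).
have mpath (s : R) : measurable_fun setT (fun w => (\1_E1 w)%:E * f (path x s w)).
  apply: emeasurable_funM; first by apply/measurable_EFinP; exact: measurable_indic.
  by apply: measurableT_comp mf _; exact: measurable_path.
have path0 (s : R) w : 0 <= (\1_E1 w)%:E * f (path x s w).
  by rewrite mule_ge0// lee_fin.
have phi0 tau : 0 <= phi tau.
  by rewrite mule_ge0 ?lee_fin ?discount_ge0//; exact: integral_ge0.
transitivity (\int[P]_w Phi (w, w)).
  rewrite integral_indicE; apply: eq_integral => w _.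
  rewrite /Phi /jump_payoff/= indicI/= !muleA -!EFinM; congr (_%:E * _).
  by rewrite -mulrA mulrC.
rewrite (independent_integral P (GX x) GN (sigma_GX x) sigma_GN (GX_measurable x Ix)
  GN_measurable (N_indep x Ix) Phi mPhi); last first.
  by move=> p; rewrite /Phi mule_ge0// lee_fin mulr_ge0// discount_ge0.
transitivity (\int[P]_(w in E2) phi (next_jump N t w)).
  rewrite [RHS]integral_indicE; apply: eq_integral => w' _; rewrite /Phi/=.
  by rewrite ge0_integralZl_EFin ?mulr_ge0 ?discount_ge0// /phi EFinM muleA.
have mT1 := measurable_T1.
have mphi : measurable_fun setT phi.
  apply: emeasurable_funM.
    by apply/measurable_EFinP; exact: measurable_discount.
  pose g (p : R * Omega) := (\1_E1 p.2)%:E * f (path x p.1 p.2).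
  have mg : measurable_fun setT g.
    apply: emeasurable_funM.
      by apply/measurable_EFinP; apply: measurableT_comp measurable_snd; exact: measurable_indic.
    apply: measurableT_comp mf _.
    apply: (@measurable_path_joint _ _ _ _ _ _ _ X_diffusion _ Omega id) => s s0.
    by apply: (rd_measurable X_diffusion) => //; exact: retract_in.
  apply: (measurableT_comp (f := fun s => \int[P]_w g (s, w)) (g := fine)).
    by apply: (measurable_fun_fubini_tonelli_F (m2 := P) g mg) => p; exact: path0.
  exact: fine_measurable.
rewrite (integral_comp_law P E2 (next_jump N t) (fun w => t%:E + T1 w) phi) //; last 3 first.
- exact: measurable_next_jump N_poisson _ t0.
- by apply: emeasurable_funD.
- by move=> s; exact: (next_jump_law _ _ _ N_poisson).
pose U (p : Omega * Omega) : \bar R := (discount r (T1 p.1))%:E *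
  ((\1_E1 p.2)%:E * \int[P]_w f (path (X x t p.2) (fine (T1 p.1)) w)).
have tr0 s y : 0 <= \int[P]_w f (path y s w) by exact: integral_ge0.
have U0 p : 0 <= U p.
  by rewrite mule_ge0 ?lee_fin ?discount_ge0// mule_ge0 ?lee_fin.
have mU : measurable_fun setT U.
  apply: emeasurable_funM.
    apply/measurable_EFinP; apply: measurable_discount_comp.
    exact: measurableT_comp mT1 measurable_fst.
  apply: emeasurable_funM.
    by apply/measurable_EFinP; apply: measurableT_comp measurable_snd; exact: measurable_indic.
  apply: (measurableT_comp (g := fun p : Omega * Omega => (fine (T1 p.1), X x t p.2))
    (measurable_transition _ _ _ _ X_diffusion f mf f0)).
  apply: measurable_fun_pair => //.
    by apply: measurable_fine_comp; exact: measurableT_comp mT1 measurable_fst.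
  apply: measurableT_comp measurable_snd.
  exact: (rd_measurable X_diffusion).
have mtr (s : R) : measurable_fun setT (fun w =>
    (\1_E1 w)%:E * \int[P]_w0 f (path (X x t w) s w0)).
  apply: emeasurable_funM; first by apply/measurable_EFinP; exact: measurable_indic.
  exact: (measurable_transition_X _ _ _ _ X_diffusion).
have phiE w' : phi (t%:E + T1 w') = (expR (- r * t))%:E * \int[P]_w U (w', w).
  rewrite /phi /U discountD; last exact: jump_time_ge0.
  rewrite /=; case E : (T1 w') => [s| |].
  - have s0 : (0 <= s)%R by rewrite -lee_fin -E; exact: jump_time_ge0.
    rewrite EFinM -muleA; congr (_ * _).
    rewrite ge0_integralZl_EFin ?discount_ge0//; last first.
      by move=> w _; rewrite mule_ge0 ?lee_fin.
    congr (_ * _); rewrite -!integral_indicE -EFinD /=.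
    rewrite -(markov_integral _ _ _ _ X_diffusion)//.
    by apply: eq_integral => w _; rewrite pathE// addr_ge0.
  - rewrite discounty mulr0 mul0e integral0_eq ?mule0// => w _; exact: mul0e.
  - by have := jump_time_ge0 N 1 w'; rewrite E.
have -> : \int[P]_w' phi (t%:E + T1 w') =
    \int[P]_w ((\1_E1 w)%:E * ((expR (- r * t))%:E * resolvent f (X x t w))).
  transitivity ((expR (- r * t))%:E * \int[P]_w' \int[P]_w U (w', w)).
    rewrite -ge0_integralZl_EFin ?expR_ge0//.
    - by apply: eq_integral => w' _; rewrite phiE.
    - by move=> w' _; exact: integral_ge0.
    - exact: (measurable_fun_fubini_tonelli_F (m2 := P) U mU U0).
  have -> : \int[P]_w' \int[P]_w U (w', w) = \int[P]_w \int[P]_w' U (w', w).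
    exact: (@fubini_tonelli _ _ _ _ _ P P U mU U0).
  rewrite -ge0_integralZl_EFin ?expR_ge0//; last 2 first.
  - by move=> w _; exact: integral_ge0.
  - exact: (measurable_fun_fubini_tonelli_G (m1 := P) U mU U0).
  apply: eq_integral => w _; rewrite muleCA; congr (_ * _).
  rewrite /resolvent -ge0_integralZl_EFin//.
  - by apply: eq_integral => w' _; rewrite /U/= muleCA.
  - by move=> w' _; rewrite mule_ge0 ?lee_fin ?discount_ge0.
  - apply: emeasurable_funM; first by apply/measurable_EFinP; exact: measurable_discount_comp.
    apply: (measurableT_comp (g := fun w' => (fine (T1 w'), X x t w))
      (measurable_transition _ _ _ _ X_diffusion f mf f0)).
    by apply: measurable_fun_pair => //; exact: measurable_fine_comp.
pose V (y : R) := (expR (- r * t))%:E * resolvent f y.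
have V0 y : 0 <= V y by rewrite mule_ge0 ?lee_fin ?expR_ge0// resolvent_ge0.
have mV : measurable_fun setT V by apply: measurable_funeM; exact: measurable_resolvent.
have mXG : measurable_fun [set: TG] (X x t).
  move=> _ B mB; rewrite setTI measurable_g_measurableTypeE; last exact: sigma_GX.
  by apply: sigma_process_preimage => //; rewrite /= in_itv/= t0.
pose Psi (p : TH * TG) : \bar R := (\1_E2 p.1)%:E * ((\1_E1 p.2)%:E * V (X x t p.2)).
have mPsi : measurable_fun setT Psi.
  apply: emeasurable_funM.
    by apply/measurable_EFinP; apply: measurableT_comp measurable_fst; exact: measurable_indic.
  apply: emeasurable_funM.
    by apply/measurable_EFinP; apply: measurableT_comp measurable_snd; exact: measurable_indic.
  by apply: measurableT_comp mV _; exact: measurableT_comp mXG measurable_snd.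
have Psi0 p : 0 <= Psi p by rewrite mule_ge0 ?lee_fin// mule_ge0 ?lee_fin.
transitivity (\int[P]_w Psi (w, w)); last first.
  rewrite [RHS]integral_indicE; apply: eq_integral => w _.
  by rewrite /Psi indicI/= EFinM muleA (muleC (\1_E2 w)%:E).
rewrite (independent_integral P (GX x) GN (sigma_GX x) sigma_GN (GX_measurable x Ix)
  GN_measurable (N_indep x Ix) Psi mPsi Psi0).
have cst0 : 0 <= \int[P]_w ((\1_E1 w)%:E * V (X x t w)).
  by apply: integral_ge0 => w _; rewrite mule_ge0 ?lee_fin.
transitivity (\int[P]_w' ((\1_E2 w')%:E * \int[P]_w ((\1_E1 w)%:E * V (X x t w)))).
  rewrite ge0_integralZr//.
  - by rewrite integral_indic ?setIT.
  - by apply/measurable_EFinP; exact: measurable_indic.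
apply: eq_integral => w' _; rewrite /Psi/= ge0_integralZl_EFin//.
- by move=> w _; rewrite mule_ge0 ?lee_fin.
- apply: emeasurable_funM; first by apply/measurable_EFinP; exact: measurable_indic.
  by apply: measurableT_comp mV _; exact: (rd_measurable X_diffusion).
Qed.

End next_jump_identity.

Arguments resolvent {R d Omega P W I X} X_diffusion r N f y.
Arguments jump_payoff {R d Omega P W I X} X_diffusion r x f tau w.

Section strong_markov_ingredients.
Context {R : realType} {d : measure_display} {Omega : measurableType d}.
Variable P : probability Omega R.
Hypothesis P_complete : measure_is_complete P.
Variables (W : R -> Omega -> R) (I : set R) (X : R -> R -> Omega -> R).
Hypothesis X_diffusion : regular_diffusion P W I X.
Variables r lambda : R.
Hypothesis r_gt0 : 0 < r.
Variable N : R -> Omega -> nat.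
Hypothesis N_poisson : poisson_process P lambda N.
Hypothesis N_indep : forall x, I x ->
  independent_sigma P (sigma_process `[0, +oo[ (X x)) (sigma_process `[0, +oo[ N).
Local Notation path := (total_path X_diffusion).
Local Notation T := (jump_time N).
Local Notation Q := (resolvent X_diffusion r N).
Local Notation pay := (jump_payoff X_diffusion r).

Local Open Scope ereal_scope.

(** The common filtration is the family of right limits of this one; the
identity at a fixed time is about events that belong to it before the right
limit is taken. *)
Definition completed_filtration x (t : R) : set (set Omega) :=
  <<s join_filtration (natural_filtration (X x)) (natural_filtration N) t
      `|` P.-negligible >>.

Lemma negligible_measurable (A : set Omega) : P.-negligible A -> measurable A.
Proof. exact: P_complete. Qed.

Lemma completed_filtration_measurable x t : I x -> completed_filtration x t `<=` measurable.
Proof.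
move=> Ix; apply: smallest_sub; first exact: sigma_algebra_measurable.
move=> A [|/negligible_measurable//]; move: A.
apply: smallest_sub; first exact: sigma_algebra_measurable.
move=> A [|]; first exact: (natural_filtrationX_measurable _ _ _ _ X_diffusion).
exact: (natural_filtrationN_measurable _ _ _ N_poisson).
Qed.

(** The intersections of an event of the diffusion with an event of the clock,
modulo null sets, are stable under intersection and generate the completed
filtration. *)
Lemma next_jump_integral (x t : R) (f : R -> \bar R) E : I x -> (0 <= t)%R ->
  completed_filtration x t E ->
  measurable_fun setT f -> (forall y, 0 <= f y) -> (forall y, f y <= 1) ->
  \int[P]_(w in E) pay x f (next_jump N t) w =
  \int[P]_(w in E) ((expR (- r * t))%:E * Q f (X x t w)).
Proof.
move=> Ix t0 FE mf f0 f1.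
pose G : set (set Omega) := [set A | measurable A /\ exists E1 E2 Z,
  [/\ natural_filtration (X x) t E1, natural_filtration N t E2,
      measurable Z, P Z = 0 & A `\` Z = (E1 `&` E2) `\` Z]].
have mnX := natural_filtrationX_measurable P W I X X_diffusion x t Ix.
have mnN := natural_filtrationN_measurable P lambda N N_poisson t.
have mL : measurable_fun setT (pay x f (next_jump N t)).
  apply: (measurable_jump_payoff _ _ _ _ X_diffusion) => //.
  exact: (measurable_next_jump P lambda).
have L0 w : 0 <= pay x f (next_jump N t) w by exact: jump_payoff_ge0.
have mR : measurable_fun setT (fun w => (expR (- r * t))%:E * Q f (X x t w)).
  apply: measurable_funeM; apply: measurableT_comp; last exact: (rd_measurable X_diffusion).
  exact: (measurable_resolvent _ _ _ _ X_diffusion _ lambda).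
have R0 w : 0 <= (expR (- r * t))%:E * Q f (X x t w).
  by rewrite mule_ge0 ?lee_fin ?expR_ge0// resolvent_ge0.
have negl (A Z : set Omega) (h : Omega -> \bar R) : measurable A -> measurable Z ->
    P Z = 0 -> measurable_fun setT h -> (forall w, 0 <= h w) ->
    \int[P]_(w in A) h w = \int[P]_(w in A `\` Z) h w.
  move=> mA mZ PZ mh h0; rewrite (@ge0_negligible_integral _ _ _ P A Z h)//.
  exact: measurable_funTS.
apply: (eq_integral_pi_lambda P G) => //.
- move=> A B [mA [E1 [E2 [Z [h1 h2 mZ PZ eA]]]]] [mB [F1 [F2 [Y [k1 k2 mY PY eB]]]]].
  split; first exact: measurableI.
  exists (E1 `&` F1), (E2 `&` F2), (Z `|` Y); split.
  + exact: (@measurableI _ (g_sigma_algebraType _)).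
  + exact: (@measurableI _ (g_sigma_algebraType _)).
  + exact: measurableU.
  + by apply: null_set_setU.
  + have e : (A `&` B) `\` (Z `|` Y) = ((A `\` Z) `&` (B `\` Y)).
      by rewrite !setDE setCU setIACA.
    by rewrite e eA eB !setDE setCU setIACA (setIACA E1).
- by move=> A [].
- split => //; exists setT, setT, set0; split => //.
  + exact: smallest_sigma_algebraT.
  + exact: smallest_sigma_algebraT.
  + by rewrite setIT.
- apply: (@le_lt_trans _ _ (\int[P]_w 1)); last by rewrite integral_cst_prob ltry.
  apply: ge0_le_integral => // w _.
  rewrite -[1]mule1 lee_pmul ?lee_fin ?discount_ge0//.
  by apply: discount_le1 => //; exact: jump_time_ge0.
- move=> A [mA [E1 [E2 [Z [h1 h2 mZ PZ eA]]]]].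
  have mE12 : measurable (E1 `&` E2) by apply: measurableI; [exact: mnX|exact: mnN].
  rewrite (negl A Z)// [RHS](negl A Z)// eA -!negl//.
  exact: (next_jump_integral_rect _ _ _ _ _ _ lambda).
- apply: FE; split; first exact: smallest_sigma_algebra.
  move=> A [|nA]; last first.
    apply: sub_sigma_algebra; split; first exact: negligible_measurable.
    have [B [mB PB AB]] := nA; exists set0, set0, B; split => //.
    + exact: smallest_sigma_algebra0.
    + exact: smallest_sigma_algebra0.
    + by rewrite setI0 set0D; apply/seteqP; split => // w [/AB].
  move: A; apply: smallest_sub; first exact: smallest_sigma_algebra.
  move=> A [nA|nA]; apply: sub_sigma_algebra.
    split; first exact: mnX.
    by exists A, setT, set0; split => //; [exact: smallest_sigma_algebraT|rewrite setIT].
  split; first exact: mnN.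
  by exists setT, A, set0; split => //; [exact: smallest_sigma_algebraT|rewrite setTI].
Qed.

Lemma resolvent_prob1 f y : measurable_fun setT f -> (forall y, 0 <= f y) ->
  (forall y, f y <= 1) -> Q f y <= 1.
Proof.
move=> mf f0 f1; rewrite -[leRHS](integral_cst_prob P).
have mtr : measurable_fun setT (fun w' => \int[P]_w f (path y (fine (T 1 w')) w)).
  apply: (measurableT_comp (g := fun w' => (fine (T 1 w'), y))
    (measurable_transition _ _ _ _ X_diffusion f mf f0)).
  apply: measurable_fun_pair => //; apply: measurable_fine_comp.
  exact: (measurable_jump_time _ _ _ N_poisson).
have tr0 w' : 0 <= \int[P]_w f (path y (fine (T 1 w')) w) by exact: integral_ge0.
apply: ge0_le_integral => //.
- by move=> w _; rewrite mule_ge0 ?lee_fin ?discount_ge0.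
- apply: emeasurable_funM => //; apply/measurable_EFinP; apply: measurable_discount_comp.
  exact: (measurable_jump_time _ _ _ N_poisson).
- move=> w _; rewrite -[1]mule1 lee_pmul ?lee_fin ?discount_ge0//.
    by apply: discount_le1 => //; exact: jump_time_ge0.
  rewrite -[leRHS](integral_cst_prob P); apply: ge0_le_integral => //.
  apply: measurableT_comp mf _; exact: (measurable_path _ _ _ _ X_diffusion).
Qed.

End strong_markov_ingredients.

Arguments completed_filtration {R d Omega} P X N x t _.

(** * The strong Markov property at Poisson times *)

Section increment_bound.
Context {R : realType} {d : measure_display} {Omega : measurableType d}.
Variable P : probability Omega R.
Variable lambda : R.
Hypothesis lambda_gt0 : 0 < lambda.
Variable N : R -> Omega -> nat.
Hypothesis N_poisson : poisson_process P lambda N.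
Variables G Gam : R -> Omega -> R.
Hypotheses (G0 : forall t w, 0 <= G t w) (G1 : forall t w, 0 <= t -> G t w <= 1).
Hypothesis mG : forall t, measurable_fun setT (G t).
Hypotheses (Gam0 : forall t w, 0 <= Gam t w) (Gam1 : forall t w, Gam t w <= 1).
Hypothesis mGam : forall t, 0 <= t -> measurable_fun setT (Gam t).
Hypothesis GamN : forall t s w, N s w = N t w -> Gam s w = Gam t w.
Hypothesis weighted_next_jump : forall t s : R, 0 <= t <= s ->
  \int[P]_w (G t w * Gam s w) = \int[P]_w (G t w * G s w).

Let integ D (u : Omega -> R) : measurable D -> measurable_fun setT u ->
  (forall w, 0 <= u w) -> (forall w, u w <= 2) -> P.-integrable D (EFin \o u).
Proof.
move=> mD mu u0 u2; apply: (bounded_integrable P D u 2) => // w.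
by rewrite ger0_norm.
Qed.

Let F (t : R) : R := \int[P]_w (G t w ^+ 2).

Let integ1 D (u : Omega -> R) : measurable D -> measurable_fun setT u ->
  (forall w, 0 <= u w) -> (forall w, u w <= 1) -> P.-integrable D (EFin \o u).
Proof.
by move=> mD mu u0 u1; apply: integ => // w; apply: (@le_trans _ _ 1); rewrite ?u1 ?ler1n.
Qed.

Lemma Rintegral_indic_le (D A : set Omega) : measurable D -> measurable A ->
  \int[P]_(w in D) \1_A w <= fine (P A).
Proof.
move=> mD mA; rewrite /Rintegral integral_indic//; apply: fine_le.
- by apply: fin_num_measure; exact: measurableI.
- exact: fin_num_measure.
- by apply: le_measure; rewrite ?inE//; exact: measurableI.
Qed.

Lemma measurable_jumps k (a b : R) : 0 <= a <= b ->
  measurable [set w | (k <= N b w - N a w)%N].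
Proof.
move=> /andP[a0 ab]; rewrite (_ : [set w | _] =
   \bigcup_j (if (k <= j)%N then [set w | (N b w - N a w)%N = j] else set0)).
  apply: bigcup_measurable => j _; case: ifP => // _.
  by apply: (measurable_increment _ _ _ N_poisson) => //; exact: le_trans ab.
apply/seteqP; split => w /=.
  by move=> h; exists (N b w - N a w)%N => //; rewrite h.
by move=> [j _]; case: ifP => // kj /= ->.
Qed.

(** Here [G t] stands for the conditional expectation of the reward [Gam t] at
the next jump after [t], and [weighted_next_jump] is the only trace of this.
As [Gam s] and [Gam t] agree unless the clock rings between [t] and [s],
[E(G_t G_s) = E(G_t Gam_s)] falls short of [E(G_t Gam_t) = F t] by at most
[lambda (s - t)]; expanding the square gives the bound. Its main part
[F s - F t] telescopes, which is what replaces continuity of [G]. *)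
Lemma mean_square_increment (t s : R) : 0 <= t <= s ->
  \int[P]_w ((G s w - G t w) ^+ 2) <= F s - F t + 2 * lambda * (s - t).
Proof.
move=> /andP[t0]; rewrite le_eqVlt => /predU1P[<-|ts].
  rewrite !subrr mulr0 addr0; under eq_Rintegral do rewrite subrr expr0n.
  by rewrite Rintegral_cst// mul0r.
have s0 : 0 <= s by rewrite (le_trans t0)// ltW.
have t0s : 0 <= t <= s by rewrite t0 ltW.
pose J := [set w | (1 <= N s w - N t w)%N].
have mJ : measurable J by exact: measurable_jumps.
have PJ : fine (P J) <= lambda * (s - t).
  rewrite -lee_fin fineK ?fin_num_measure//.
  by apply: (poisson_ge1 _ _ _ N_poisson lambda_gt0); rewrite t0.
have iM (u v : Omega -> R) : measurable_fun setT u -> measurable_fun setT v ->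
    (forall w, 0 <= u w) -> (forall w, u w <= 1) ->
    (forall w, 0 <= v w) -> (forall w, v w <= 1) ->
    P.-integrable setT (EFin \o (fun w => u w * v w)).
  move=> mu mv u0 u1 v0 v1; apply: integ1 => //; first exact: measurable_funM.
    by move=> w; rewrite mulr_ge0.
  by move=> w; rewrite -[leRHS]mulr1 ler_pM.
have Gt1 w := G1 t w t0; have Gs1 w := G1 s w s0.
have iJ : P.-integrable setT (EFin \o (\1_J : Omega -> R)).
  by apply: integ1 => // w; rewrite indicE; case: (_ \in _).
have h1 : F t <= \int[P]_w (G t w * G s w) + lambda * (s - t).
  have -> : F t = \int[P]_w (G t w * Gam t w).
    by rewrite weighted_next_jump ?t0 ?lexx.
  rewrite -weighted_next_jump//.
  apply: (@le_trans _ _ (\int[P]_w (G t w * Gam s w + \1_J w))).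
    apply: le_Rintegral => //.
    - by apply: iM => //; exact: mGam.
    - apply: integ => //.
      + apply: measurable_funD; last exact: measurable_indic.
        by apply: measurable_funM => //; exact: mGam.
      + by move=> w; rewrite addr_ge0// mulr_ge0.
      + move=> w; rewrite -[leRHS]/(1 + 1) lerD//.
        by rewrite -[leRHS]mulr1 ler_pM.
    - move=> w _; have [e|ne] := eqVneq (N s w) (N t w).
        by rewrite (GamN t s w e) lerDl.
      have -> : (\1_J : Omega -> R) w = 1.
        rewrite indicE mem_set// /J /= subn_gt0 ltn_neqAle eq_sym ne/=.
        exact: (pp_nondecreasing N_poisson).
      apply: (@le_trans _ _ 1); last by rewrite lerDr mulr_ge0.
      by rewrite -[leRHS]mulr1 ler_pM.
  rewrite RintegralD//; last by apply: iM => //; exact: mGam.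
  by rewrite lerD2l (le_trans _ PJ)// Rintegral_indic_le.
have -> : \int[P]_w ((G s w - G t w) ^+ 2) =
    F s + F t - (\int[P]_w (G t w * G s w) + \int[P]_w (G t w * G s w)).
  rewrite /F -!RintegralD//; try exact: iM.
  rewrite -RintegralB//.
  - by apply: eq_Rintegral => w _; rewrite /=; ring.
  - apply: integ => //.
    + by apply: measurable_funD; exact: measurable_funM.
    + by move=> w; rewrite addr_ge0// exprn_ge0.
    + by move=> w; rewrite -[leRHS]/(1 + 1) lerD// exprn_ile1.
  - apply: integ => //.
    + by apply: measurable_funD; exact: measurable_funM.
    + by move=> w; rewrite addr_ge0// mulr_ge0.
    + by move=> w; rewrite -[leRHS]/(1 + 1) lerD// -[leRHS]mulr1 ler_pM.
move: h1; lra.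
Qed.

End increment_bound.

(** In this section [q] stands for the resolvent of [f], kept abstract: its
bounds and the identities at fixed times are all that is used of it. *)
Section cells.
Context {R : realType} {d : measure_display} {Omega : measurableType d}.
Variable P : probability Omega R.
Variables (W : R -> Omega -> R) (I : set R) (X : R -> R -> Omega -> R).
Hypothesis X_diffusion : regular_diffusion P W I X.
Variables r lambda : R.
Hypotheses (r_gt0 : 0 < r) (lambda_gt0 : 0 < lambda).
Variable N : R -> Omega -> nat.
Hypothesis N_poisson : poisson_process P lambda N.
Hypothesis N_indep : forall x, I x ->
  independent_sigma P (sigma_process `[0, +oo[ (X x)) (sigma_process `[0, +oo[ N).
Local Notation path := (total_path X_diffusion).
Local Notation T := (jump_time N).
Variables (x : R) (f q : R -> R).
Hypotheses (Ix : I x) (mf : measurable_fun setT f) (mq : measurable_fun setT q).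
Hypotheses (f0 : forall y, 0 <= f y) (f1 : forall y, f y <= 1).
Hypotheses (q0 : forall y, 0 <= q y) (q1 : forall y, q y <= 1).

(** The discounted resolvent along the path, and the discounted reward at the
first jump after [t]; the former is the conditional expectation of the latter. *)
Let G (t : R) (w : Omega) : R := expR (- r * t) * q (path x t w).
Let Gam (t : R) (w : Omega) : R :=
  discount r (next_jump N t w) * f (path x (fine (next_jump N t w)) w).

Let G0 t w : 0 <= G t w. Proof. by rewrite mulr_ge0 ?expR_ge0. Qed.

Let G1 (t : R) w : 0 <= t -> G t w <= 1.
Proof.
move=> t0; rewrite -[leRHS]mulr1 ler_pM ?expR_ge0//.
by rewrite -expR0 ler_expR mulNr oppr_le0 mulr_ge0// ltW.
Qed.

Let mG t : measurable_fun setT (G t).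
Proof.
apply: measurable_funM; first exact: measurable_cst.
apply: measurableT_comp mq _.
exact: (measurable_path _ _ _ _ X_diffusion).
Qed.

Let Gam0 t w : 0 <= Gam t w. Proof. by rewrite mulr_ge0 ?discount_ge0. Qed.

Let Gam1 t w : Gam t w <= 1.
Proof.
by rewrite -[leRHS]mulr1 ler_pM ?discount_ge0// discount_le1//; exact: jump_time_ge0.
Qed.

Let mGam (t : R) : 0 <= t -> measurable_fun setT (Gam t).
Proof.
move=> t0; have mn := measurable_next_jump P lambda N N_poisson t t0.
apply: measurable_funM; first exact: measurable_discount_comp.
by apply: measurableT_comp mf _; exact: (measurable_path_at _ _ _ _ X_diffusion).
Qed.

Let integ D (u : Omega -> R) : measurable D -> measurable_fun setT u ->
  (forall w, 0 <= u w) -> (forall w, u w <= 2) -> P.-integrable D (EFin \o u).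
Proof.
move=> mD mu u0 u2; apply: (bounded_integrable P D u 2) => // w.
by rewrite ger0_norm.
Qed.

Hypothesis next_jump_Rintegral : forall (t : R) E, 0 <= t ->
  completed_filtration P X N x t E ->
  \int[P]_(w in E) Gam t w = \int[P]_(w in E) G t w.
Hypothesis weighted_next_jump : forall t s : R, 0 <= t <= s ->
  \int[P]_w (G t w * Gam s w) = \int[P]_w (G t w * G s w).

Let F (t : R) : R := \int[P]_w (G t w ^+ 2).

Let F_incr (t s : R) : 0 <= t <= s ->
  \int[P]_w ((G s w - G t w) ^+ 2) <= F s - F t + 2 * lambda * (s - t).
Proof.
have GamN t' s' w : N s' w = N t' w -> Gam s' w = Gam t' w.
  by move=> e; rewrite /Gam /next_jump e.
exact: (mean_square_increment P lambda lambda_gt0 N N_poisson G Gam G0 G1 mG Gam0 Gam1 mGam GamN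
  weighted_next_jump).
Qed.

Let F_incr_cell (a b t : R) : 0 <= a <= t -> t <= b ->
  \int[P]_w ((G b w - G t w) ^+ 2) <= F b - F a + 2 * lambda * (b - a).
Proof.
move=> /andP[a0 at_] tb; have t0 := le_trans a0 at_.
have := F_incr t b; rewrite t0 tb => /(_ isT) h1.
have := F_incr a t; rewrite a0 at_ => /(_ isT) h2.
have h3 : 0 <= \int[P]_w ((G t w - G a w) ^+ 2).
  by apply: Rintegral_ge0 => w _; exact: sqr_ge0.
move: h1 h2 h3; lra.
Qed.

Let integ1 D (u : Omega -> R) : measurable D -> measurable_fun setT u ->
  (forall w, 0 <= u w) -> (forall w, u w <= 1) -> P.-integrable D (EFin \o u).
Proof.
by move=> mD mu u0 u1; apply: integ => // w; apply: (@le_trans _ _ 1); rewrite ?u1 ?ler1n.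
Qed.

Variable n : nat.
Hypothesis n_gt0 : (0 < n)%N.

Let GT (w : Omega) : R := discount r (T n w) * q (path x (fine (T n w)) w).
Let GamT (w : Omega) : R := discount r (T n.+1 w) * f (path x (fine (T n.+1 w)) w).

Let mTn k : measurable_fun setT (T k).
Proof. exact: (measurable_jump_time _ _ _ N_poisson). Qed.

Let mGT : measurable_fun setT GT.
Proof.
apply: measurable_funM; first exact: measurable_discount_comp.
by apply: measurableT_comp mq _; exact: (measurable_path_at _ _ _ _ X_diffusion).
Qed.

Let mGamT : measurable_fun setT GamT.
Proof.
apply: measurable_funM; first exact: measurable_discount_comp.
by apply: measurableT_comp mf _; exact: (measurable_path_at _ _ _ _ X_diffusion).
Qed.

Let GT0 w : 0 <= GT w. Proof. by rewrite mulr_ge0 ?discount_ge0. Qed.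
Let GamT0 w : 0 <= GamT w. Proof. by rewrite mulr_ge0 ?discount_ge0. Qed.
Let GT1 w : GT w <= 1.
Proof.
by rewrite -[leRHS]mulr1 ler_pM ?discount_ge0// discount_le1//; exact: jump_time_ge0.
Qed.
Let GamT1 w : GamT w <= 1.
Proof.
by rewrite -[leRHS]mulr1 ler_pM ?discount_ge0// discount_le1//; exact: jump_time_ge0.
Qed.

Let cell (a b : R) := [set w | (a%:E <= T n w < b%:E)%E].

Let mcell a b : measurable (cell a b).
Proof.
rewrite (_ : cell a b = T n @^-1` `[a%:E, b%:E[).
  by rewrite -[X in measurable X]setTI; apply: mTn => //; exact: emeasurable_itv.
by apply/seteqP; split => w /=; rewrite in_itv.
Qed.

Let GT_fin w (t : R) : T n w = t%:E -> GT w = G t w.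
Proof. by move=> e; rewrite /GT e discount_fin. Qed.

(** The time [T n] is independent of the diffusion, so it can be frozen at a
point of the cell; [G] moves little in mean square between that point and [b].
The gain is the factor [P (cell a b)]. *)
Let cell_L2 (a b : R) : 0 <= a <= b ->
  \int[P]_(w in cell a b) ((G b w - GT w) ^+ 2) <=
  fine (P (cell a b)) * (F b - F a + 2 * lambda * (b - a)).
Proof.
move=> /andP[a0 ab]; set D := F b - F a + _; have b0 := le_trans a0 ab.
pose GX := sigma_process `[0, +oo[ (X x); pose GN := sigma_process `[0, +oo[ N.
pose TG := g_sigma_algebraType GX; pose TH := g_sigma_algebraType GN.
have sX : sigma_algebra setT GX by exact: smallest_sigma_algebra.
have sN : sigma_algebra setT GN by exact: smallest_sigma_algebra.
have mTH : measurable_fun [set: TH] (T n).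
  apply: measurable_ge0_ereal; first by move=> w; exact: jump_time_ge0.
  move=> t t0; rewrite measurable_g_measurableTypeE//.
  under eq_fun do rewrite (jump_time_le _ _ _ N_poisson)//.
  exact: GN_le.
pose g (p : R * R) : R := expR (- r * p.1) * q p.2.
have mg : measurable_fun setT g.
  apply: measurable_funM; last exact: measurableT_comp mq measurable_snd.
  apply: measurableT_comp; first exact: measurable_expR.
  by apply: measurable_funM; [exact: measurable_cst|exact: measurable_fst].
have mpG (h : TH * TG -> R) : measurable_fun setT h ->
    measurable_fun setT (fun p : TH * TG => g (h p, path x (h p) p.2)).
  move=> mh; apply: (measurableT_comp (g := fun p : TH * TG => (h p, path x (h p) p.2)) mg).
  apply: measurable_fun_pair => //.
  apply: (measurableT_comp (g := fun p : TH * TG => (h p, p.2))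
    (measurable_GX_path _ _ _ _ X_diffusion x Ix)).
  by apply: measurable_fun_pair => //; exact: measurable_snd.
have mft : measurable_fun setT (fun p : TH * TG => fine (T n p.1)).
  by apply: measurable_fine_comp; exact: measurableT_comp mTH measurable_fst.
pose Phi (p : TH * TG) : \bar R := ((\1_(cell a b) p.1)%:E *
  ((G b p.2 - G (fine (T n p.1)) p.2) ^+ 2)%:E)%E.
have mPhi : measurable_fun setT Phi.
  apply: emeasurable_funM; apply/measurable_EFinP.
    apply: measurableT_comp measurable_fst; apply: measurable_indic.
    rewrite (_ : cell a b = T n @^-1` `[a%:E, b%:E[).
      by rewrite -[X in measurable X]setTI; apply: mTH => //; exact: emeasurable_itv.
    by apply/seteqP; split => w /=; rewrite in_itv.
  by apply: measurable_funX; apply: measurable_funB; [exact: (mpG (fun=> b))|exact: mpG].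
have Phi0 p : (0 <= Phi p)%E by rewrite mule_ge0 ?lee_fin// sqr_ge0.
have sq1 (u v : R) : 0 <= u <= 1 -> 0 <= v <= 1 -> (u - v) ^+ 2 <= 1.
  by move=> /andP[? ?] /andP[? ?]; nra.
have ID (t : R) : 0 <= t -> P.-integrable setT (EFin \o (fun w => (G b w - G t w) ^+ 2)).
  move=> t0; apply: integ1 => //.
  - by apply: measurable_funX; exact: measurable_funB.
  - by move=> w; exact: sqr_ge0.
  - by move=> w; apply: sq1; rewrite G0 G1.
have D0 : 0 <= D.
  apply: le_trans (F_incr_cell a b a _ ab); last by rewrite a0 lexx.
  by apply: Rintegral_ge0 => w _; exact: sqr_ge0.
have mS : measurable_fun setT (fun w => (G b w - GT w) ^+ 2).
  by apply: measurable_funX; exact: measurable_funB.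
have S1 w : (G b w - GT w) ^+ 2 <= 1.
  by apply: sq1; rewrite ?G0 ?G1 ?GT0 ?GT1.
have eI : (\int[P]_(w in cell a b) ((G b w - GT w) ^+ 2))%:E =
    (\int[P]_(w in cell a b) ((G b w - GT w) ^+ 2)%:E)%E.
  rewrite /Rintegral fineK//; apply: integrable_fin_num => //.
  by apply: integ1 => // w; exact: sqr_ge0.
rewrite -lee_fin eI EFinM (_ : (fine (P (cell a b)))%:E = P (cell a b)); last first.
  by rewrite fineK// fin_num_measure.
have -> : (\int[P]_(w in cell a b) ((G b w - GT w) ^+ 2)%:E = \int[P]_w Phi (w, w))%E.
  rewrite integral_indicE; apply: eq_integral => w _; rewrite /Phi /=.
  have [/set_mem/andP[h1 h2]|h] := boolP (w \in cell a b); last first.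
    by rewrite indicE (negbTE h) !mul0e.
  have e : T n w = (fine (T n w))%:E.
    by rewrite fineK// fin_numElt (lt_le_trans _ h1) ?ltNyr// (lt_trans h2) ?ltry.
  by rewrite (GT_fin _ _ e).
rewrite (independent_integral P GX GN sX sN (GX_measurable _ _ _ _ X_diffusion x Ix)
  (GN_measurable _ _ _ N_poisson) (N_indep x Ix) Phi mPhi Phi0).
have -> : (P (cell a b) * D%:E = \int[P]_w' ((\1_(cell a b) w')%:E * D%:E))%E.
  rewrite ge0_integralZr//; last by apply/measurable_EFinP; exact: measurable_indic.
  by rewrite integral_indic ?setIT.
apply: ge0_le_integral => //.
- by move=> w _; exact: integral_ge0.
- exact: (measurable_independent_inner P GX GN sX sN (GX_measurable _ _ _ _ X_diffusion x Ix)
    (GN_measurable _ _ _ N_poisson) Phi mPhi Phi0).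
- apply: emeasurable_funM; last exact: measurable_cst.
  by apply/measurable_EFinP; exact: measurable_indic.
move=> w' _; have [/set_mem/andP[h1 h2]|h] := boolP (w' \in cell a b); last first.
  by rewrite indicE (negbTE h) mul0e integral0_eq// => w _; rewrite /Phi/= indicE (negbTE h) mul0e.
have e : T n w' = (fine (T n w'))%:E.
  by rewrite fineK// fin_numElt (lt_le_trans _ h1) ?ltNyr// (lt_trans h2) ?ltry.
set t := fine (T n w') in e *.
have [at_ tb] : a <= t /\ t <= b by move: h1 h2; rewrite e lee_fin lte_fin => -> /ltW.
have t0 := le_trans a0 at_.
rewrite /Phi/= indicE mem_set; last by rewrite /cell/= h1.
rewrite mul1e -/t; under eq_integral do rewrite mul1e.
rewrite -[leLHS]fineK; last exact: integrable_fin_num (ID t t0).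
by rewrite lee_fin; apply: F_incr_cell => //; rewrite a0.
Qed.

Let dist_le (D : set Omega) (u v h : Omega -> R) : measurable D ->
  P.-integrable D (EFin \o u) -> P.-integrable D (EFin \o v) -> P.-integrable D (EFin \o h) ->
  (forall w, D w -> `|u w - v w| <= h w) ->
  `|\int[P]_(w in D) u w - \int[P]_(w in D) v w| <= \int[P]_(w in D) h w.
Proof.
move=> mD iu iv ih uvh; rewrite -RintegralB//.
have iuv : P.-integrable D (EFin \o (fun w => u w - v w)).
  by have := integrableB mD iu iv; apply: eq_integrable.
apply: le_trans (le_normr_Rintegral mD iuv) _.
apply: le_Rintegral => //.
have := integrable_abse iuv; apply: eq_integrable => // w _ /=.
Qed.

Variable E : set Omega.
Hypothesis mE : measurable E.
Hypothesis hE : forall b : R, 0 < b ->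
  completed_filtration P X N x b (E `&` [set w | (T n w < b%:E)%E]).

Let completed_sub (a b : R) : a <= b ->
  completed_filtration P X N x a `<=` completed_filtration P X N x b.
Proof.
move=> ab; apply: smallest_sub; first exact: smallest_sigma_algebra.
have sub : `[0, a]%classic `<=` `[0, b]%classic.
  by move=> s /=; rewrite !in_itv/= => /andP[-> sa]; exact: le_trans ab.
move=> A [|nA]; last by apply: sub_sigma_algebra; right.
move=> hA; apply: sub_sigma_algebra; left; move: A hA.
apply: smallest_sub; first exact: smallest_sigma_algebra.
move=> A [hA|hA]; apply: sub_sigma_algebra; [left|right];
  exact: sigma_process_sub hA.
Qed.

Let hcell (a b : R) : 0 <= a <= b -> 0 < b ->
  completed_filtration P X N x b (E `&` cell a b).
Proof.
move=> /andP[a0 ab] b0.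
rewrite (_ : E `&` cell a b = (E `&` [set w | (T n w < b%:E)%E]) `\`
    (E `&` [set w | (T n w < a%:E)%E])); last first.
  apply/seteqP; split => w /=.
    by move=> [Ew /andP[h1 h2]]; split => // -[_]; rewrite ltNge h1.
  move=> [[Ew h2] h]; split => //; rewrite /cell/= h2 andbT leNgt.
  by apply/negP => h1; apply: h.
have sC := smallest_sigma_algebra setT (join_filtration (natural_filtration (X x)) (natural_filtration N) b `|` P.-negligible).
apply: (@measurableD _ (g_sigma_algebraType (join_filtration (natural_filtration (X x)) (natural_filtration N) b `|` P.-negligible))).
  exact: hE.
have [a0'|a0'] := eqVneq a 0.
  rewrite (_ : _ `&` _ = set0) ?a0'; first exact: measurable0.
  by apply/seteqP; split => // w /= [_]; rewrite ltNge jump_time_ge0.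
by apply: (completed_sub a) => //; apply: hE; rewrite lt_neqAle eq_sym a0'.
Qed.

(** Three comparisons on the part of [E] where [T n] falls into the cell. The
reward at [T n.+1] is the reward [Gam b] at the first jump after [b], unless
two jumps occur between [a'] and [b]. The rewards [Gam b] and [G b] have the
same integral, since the event is known at time [b]. Finally [G b] is close to
[GT] in mean square, and [|z| <= e + z ^ 2 / e]. The point [a'] is chosen so
that the increment over the interval from [a'] to [b] counts a jump at [a]
itself. *)
Let cell_estimate (a' a b h e : R) : 0 <= a' <= a -> a < b -> b - a' <= 2 * h ->
  (forall w, (a%:E <= T n w)%E -> (a'%:E < T n w)%E) -> 0 < e ->
  `|\int[P]_(w in E `&` cell a b) GamT w - \int[P]_(w in E `&` cell a b) GT w| <=
  (2 * lambda * h) ^+ 2 + (e * fine (P (cell a b)) +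
   e^-1 * (2 * lambda * h * (F b - F a + 2 * lambda * (b - a)))).
Proof.
move=> /andP[a'0 a'a] ab bh aa e0.
have a0 := le_trans a'0 a'a; have b0 := le_lt_trans a0 ab.
have a'b := le_lt_trans a'a ab.
set D := E `&` cell a b; have mD : measurable D by exact: measurableI.
have mJ k : measurable [set w | (k <= N b w - N a' w)%N].
  by apply: (measurable_jumps _ _ _ N_poisson); rewrite a'0 ltW.
have Nb w : cell a b w -> (n <= N b w)%N.
  by move=> /andP[_ h2]; rewrite -(jump_time_le _ _ _ N_poisson) ?ltW.
have Na w : cell a b w -> (N a' w < n)%N.
  by move=> /andP[h1 _]; rewrite -(jump_time_gt _ _ _ N_poisson)//; exact: aa.
have lh : lambda * (b - a') <= 2 * lambda * h by rewrite -mulrA (mulrCA 2) ler_wpM2l// ltW.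
have lh0 : 0 <= lambda * (b - a') by rewrite mulr_ge0 ?subr_ge0 ?ltW.
have PC : fine (P (cell a b)) <= 2 * lambda * h.
  apply: le_trans lh; rewrite -lee_fin fineK ?fin_num_measure//.
  apply: le_trans (poisson_ge1 _ _ _ N_poisson lambda_gt0 a' b _); last by rewrite a'0.
  apply: le_measure; rewrite ?inE; [exact: mcell|exact: (mJ 1%N)|].
  by move=> w Cw /=; rewrite subn_gt0; exact: leq_trans (Na _ Cw) (Nb _ Cw).
have PJ : fine (P [set w | (2 <= N b w - N a' w)%N]) <= (2 * lambda * h) ^+ 2.
  apply: (@le_trans _ _ ((lambda * (b - a')) ^+ 2)); last first.
    by rewrite lerXn2r ?nnegrE// (le_trans lh0).
  rewrite -lee_fin fineK ?fin_num_measure//.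
  by apply: (poisson_ge2 _ _ _ N_poisson lambda_gt0); rewrite a'0.
have iGam : P.-integrable D (EFin \o Gam b) by apply: integ1 => //; exact/mGam/ltW.
have iG : P.-integrable D (EFin \o G b) by apply: integ1 => // w; exact/G1/ltW.
have iGT : P.-integrable D (EFin \o GT) by exact: integ1.
have iGamT : P.-integrable D (EFin \o GamT) by exact: integ1.
pose J2 := [set w | (2 <= N b w - N a' w)%N].
have s1 : `|\int[P]_(w in D) GamT w - \int[P]_(w in D) Gam b w| <= (2 * lambda * h) ^+ 2.
  apply: le_trans PJ; apply: le_trans (Rintegral_indic_le P D _ mD (mJ 2%N)).
  apply: dist_le => //.
    by apply: integ1 => // w; rewrite indicE; case: (_ \in _).
  move=> w [_ Cw]; have [eN|nN] := eqVneq (N b w) n.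
    rewrite (_ : GamT w = Gam b w) ?subrr ?normr0//.
    by rewrite /GamT /Gam /next_jump eN.
  rewrite indicE mem_set; last first.
    rewrite /= leq_subRL ?(leq_trans (ltnW (Na _ Cw)) (Nb _ Cw))// addn2.
    by apply: leq_ltn_trans (Na _ Cw) _; rewrite ltn_neqAle eq_sym nN Nb.
  rewrite ler_norml; have := Gam0 b w; have := Gam1 b w; have := GamT0 w; have := GamT1 w.
  by move=> /= h1 h2 h3 h4; apply/andP; split; lra.
have s2 : \int[P]_(w in D) Gam b w = \int[P]_(w in D) G b w.
  by apply: next_jump_Rintegral; [exact: ltW|apply: hcell => //; rewrite a0 ltW].
pose S w := (G b w - GT w) ^+ 2.
have mS : measurable_fun setT S by apply: measurable_funX; exact: measurable_funB.
have S0 w : 0 <= S w by exact: sqr_ge0.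
have S1 w : S w <= 1.
  have := GT0 w; have := GT1 w; have := G0 b w; have := G1 b w (ltW b0); rewrite /S => ? ? ? ?; nra.
have iS D' : measurable D' -> P.-integrable D' (EFin \o S) by move=> mD'; exact: integ1.
have ei0 : 0 < e^-1 by rewrite invr_gt0.
have meS : measurable_fun setT (fun w => e^-1 * S w).
  by apply: (measurable_funM (f := fun=> e^-1) _ mS); exact: measurable_cst.
have s3 : `|\int[P]_(w in D) G b w - \int[P]_(w in D) GT w| <=
    e * fine (P (cell a b)) + e^-1 * \int[P]_(w in cell a b) S w.
  apply: (@le_trans _ _ (\int[P]_(w in D) (e + e^-1 * S w))).
    apply: dist_le => //.
      apply: (bounded_integrable P D _ (e + e^-1)) => //.
        apply: (measurable_funD (f := fun=> e)); first exact: measurable_cst.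
        exact: meS.
      move=> w; rewrite ger0_norm; last by apply: addr_ge0; [exact: ltW|apply: mulr_ge0 => //; exact: ltW].
      by rewrite lerD2l -[leRHS]mulr1 ler_wpM2l// ltW.
    move=> w _; rewrite /S; set z := G b w - GT w.
    have : 0 <= e^-1 * (e - `|z|) ^+ 2 by rewrite mulr_ge0 ?sqr_ge0// ltW.
    have -> : e^-1 * (e - `|z|) ^+ 2 = e + e^-1 * z ^+ 2 - 2 * `|z|.
      by rewrite -[z ^+ 2]real_normK ?num_real//; field; exact: lt0r_neq0.
    have := normr_ge0 z; lra.
  rewrite RintegralD//; last 2 first.
    by apply: (bounded_integrable P D _ e) => // w; rewrite ger0_norm// ltW.
    apply: (bounded_integrable P D _ e^-1) => // w; rewrite ger0_norm; last by apply: mulr_ge0 => //; exact: ltW.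
    by rewrite -[leRHS]mulr1 ler_wpM2l// ltW.
  rewrite Rintegral_cst// RintegralZl//; last exact: iS.
  apply: lerD; (apply: ler_wpM2l; first exact: ltW); apply: fine_le.
  - exact: fin_num_measure.
  - exact: fin_num_measure.
  - by apply: le_measure; rewrite ?inE//; exact: subIsetr.
  - exact: integrable_fin_num (iS _ mD).
  - exact: integrable_fin_num (iS _ (mcell a b)).
  - apply: ge0_subset_integral => //.
    + by apply/measurable_EFinP; exact: measurable_funTS.
    + by move=> w _; rewrite lee_fin.
    + exact: subIsetr.
have L2 := cell_L2 a b; rewrite a0 ltW// in L2; have {}L2 := L2 isT.
have Dl0 : 0 <= F b - F a + 2 * lambda * (b - a).
  apply: le_trans (F_incr_cell a b a _ (ltW ab)); last by rewrite a0 lexx.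
  by apply: Rintegral_ge0 => w _; exact: sqr_ge0.
have s4 : e^-1 * \int[P]_(w in cell a b) S w <=
    e^-1 * (2 * lambda * h * (F b - F a + 2 * lambda * (b - a))).
  apply: ler_wpM2l; first exact: ltW.
  by apply: le_trans L2 _; exact: ler_wpM2r.
apply: (le_trans (ler_distD (\int[P]_(w in D) G b w) _ _)).
rewrite -{1}s2; apply: lerD => //; apply: le_trans s3 _; exact: lerD.
Qed.

Let before (K : R) := [set w | (T n w < K%:E)%E].

Let mbefore K : measurable (before K).
Proof.
rewrite (_ : before K = T n @^-1` `]-oo, K%:E[).
  by rewrite -[X in measurable X]setTI; apply: mTn => //; exact: emeasurable_itv.
by apply/seteqP; split => w /=; rewrite in_itv.
Qed.

Let gap (D : set Omega) := `|\int[P]_(w in D) GamT w - \int[P]_(w in D) GT w|.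

(** Summation of [cell_estimate] over the first [j] cells: the mean square terms
telescope and the probabilities of the cells add up. *)
Let gap_before (h e : R) (j : nat) : 0 < h -> 0 < e ->
  gap (E `&` before (j%:R * h)) <=
  j%:R * (2 * lambda * h) ^+ 2 + (e * fine (P (before (j%:R * h))) +
   e^-1 * (2 * lambda * h * (F (j%:R * h) - F 0 + 2 * lambda * (j%:R * h)))).
Proof.
move=> h0 e0; elim: j => [|j IH].
  have -> : before (0%:R * h) = set0.
    by apply/seteqP; split => // w; rewrite /before/= mul0r ltNge jump_time_ge0.
  by rewrite /gap setI0 !Rintegral_set0 subrr normr0 measure0 !mul0r subrr !(mulr0, addr0).
set b := j.+1%:R * h; set a := j%:R * h.
have ab : a < b by rewrite ltr_pM2r// ltr_nat.
have a0 : 0 <= a by rewrite mulr_ge0// ltW.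
have ba : b - a = h by rewrite /b /a -natr1 mulrDl mul1r addrAC subrr add0r.
have splitE : E `&` before b = (E `&` before a) `|` (E `&` cell a b).
  rewrite -setIUr; congr (_ `&` _); apply/seteqP; split => w /=.
    by rewrite /before /cell /= => ->; rewrite andbT; case: ltP => ?; [left|right].
  rewrite /before /cell /=; case; last by case/andP.
  by move=> /lt_trans; apply; rewrite lte_fin.
have splitB : before b = before a `|` cell a b.
  apply/seteqP; split => w /=.
    by rewrite /before /cell /= => ->; rewrite andbT; case: ltP => ?; [left|right].
  rewrite /before /cell /=; case; last by case/andP.
  by move=> /lt_trans; apply; rewrite lte_fin.
have disj : before a `&` cell a b = set0.
  apply/seteqP; split => // w [] /=; rewrite /before /cell/= => h1 /andP[h2 _].
  by move: h1; rewrite ltNge h2.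
have mEa : measurable (E `&` before a) by exact: measurableI.
have mEc : measurable (E `&` cell a b) by exact: measurableI.
have PB : fine (P (before b)) = fine (P (before a)) + fine (P (cell a b)).
  by rewrite splitB measureU// fineD// fin_num_measure.
have disjE : [disjoint (E `&` before a) & (E `&` cell a b)].
  by rewrite disj_set2E setIACA disj setI0.
have I2 (u : Omega -> R) : measurable_fun setT u -> (forall w, 0 <= u w) -> (forall w, u w <= 1) ->
    \int[P]_(w in E `&` before b) u w =
    \int[P]_(w in E `&` before a) u w + \int[P]_(w in E `&` cell a b) u w.
  move=> mu u0 u1; rewrite splitE Rintegral_setU//.
  by apply: integ1 => //; exact: measurableU.
(* The first cell begins at 0, where there is no jump since n > 0. *)
have [a' [ha' ba' aa]] : exists a', [/\ 0 <= a' <= a, b - a' <= 2 * h &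
    forall w, (a%:E <= T n w)%E -> (a'%:E < T n w)%E].
  case: (posnP j) => [j0|j0].
    exists 0; split; first by rewrite lexx a0.
      by rewrite /b j0 mul1r subr0 ler_peMl// ?ler1n// ltW.
    by move=> w _; exact: (jump_time_gt0 _ _ _ N_poisson).
  exists (a - h); split.
  - apply/andP; split; last by rewrite gerBl ltW.
    by rewrite subr_ge0 /a ler_peMl ?(ltW h0)// ler1n.
  - have -> : b - (a - h) = (b - a) + h by ring.
    by rewrite ba -mulr2n mulr_natl.
  - by move=> w; apply: lt_le_trans; rewrite lte_fin ltrBlDr ltrDl.
have C := cell_estimate a' a b h e ha' ab ba' aa e0.
have D := lerD IH C.
rewrite /gap (I2 GamT)// (I2 GT)// opprD addrACA.
apply: (le_trans (ler_normD _ _)); apply: (le_trans D).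
rewrite -/a PB ba -natr1 !mulrDl !mulrDr mul1r.
rewrite -(_ : b - a = h)//.
rewrite le_eqVlt; apply/orP; left; apply/eqP; ring.
Qed.

(** With [m] cells the error is at most [e + C / m], where [C] depends on [K] and
[e] only. *)
Let gap0 (K : R) : 0 < K -> gap (E `&` before K) = 0.
Proof.
move=> K0; set g := gap _; have g0 : 0 <= g by exact: normr_ge0.
apply/eqP; rewrite eq_le g0 andbT leNgt; apply/negP => gp.
pose e := g / 2; have e0 : 0 < e by rewrite divr_gt0.
pose C := (2 * lambda * K) ^+ 2 + e^-1 * (2 * lambda * K * (1 + 2 * lambda * K)).
have lK0 : 0 <= 2 * lambda * K by rewrite !mulr_ge0// ltW.
have C0 : 0 <= C.
  apply: addr_ge0; first exact: sqr_ge0.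
  apply: mulr_ge0; first by rewrite invr_ge0 ltW.
  by apply: mulr_ge0 => //; exact: addr_ge0.
pose m := (Num.truncn (C / e)).+1.
have m0 : 0 < m%:R :> R by rewrite ltr0n.
have Cm : C / m%:R < e.
  by rewrite ltr_pdivrMr// mulrC -ltr_pdivrMr//; exact: truncnS_gt.
pose h := K / m%:R; have h0 : 0 < h by rewrite divr_gt0.
have mh : m%:R * h = K by rewrite mulrC divfK// gt_eqF.
have := gap_before h e m h0 e0; rewrite mh -/g.
have P1 : e * fine (P (before K)) <= e.
  rewrite -[leRHS]mulr1; apply: ler_wpM2l; first exact: ltW.
  by rewrite -lee_fin fineK ?fin_num_measure//; exact: probability_le1.
have F1 : F K - F 0 <= 1.
  have : 0 <= F 0 by apply: Rintegral_ge0 => w _; exact: sqr_ge0.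
  have : F K <= 1.
    apply: (@le_trans _ _ (\int[P]_w 1)).
      apply: le_Rintegral => //.
      - apply: integ1 => //; first exact: measurable_funX.
          by move=> w; exact: sqr_ge0.
        by move=> w; rewrite exprn_ile1// G1// ltW.
      - by apply: integ1.
      - by move=> w _; rewrite exprn_ile1// G1// ltW.
    by rewrite Rintegral_cst// mul1r -lee_fin fineK ?fin_num_measure//; exact: probability_le1.
  lra.
have h2 : m%:R * (2 * lambda * h) ^+ 2 = (2 * lambda * K) ^+ 2 / m%:R.
  by rewrite /h; field; rewrite gt_eqF.
have h3 : e^-1 * (2 * lambda * h * (F K - F 0 + 2 * lambda * K)) <=
    e^-1 * (2 * lambda * K * (1 + 2 * lambda * K)) / m%:R.
  have -> : 2 * lambda * h = 2 * lambda * K / m%:R by rewrite /h mulrA.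
  rewrite -[leRHS]mulrA; apply: ler_wpM2l; first by rewrite invr_ge0 ltW.
  rewrite [leRHS]mulrAC; apply: ler_wpM2l; last by rewrite lerD2r.
  by rewrite divr_ge0// ltW.
rewrite h2 => H; move: H h3 P1 Cm; rewrite /C mulrDl /e; lra.
Qed.

Lemma jump_identity_bounded :
  (\int[P]_(w in E) (GamT w)%:E = \int[P]_(w in E) (GT w)%:E)%E.
Proof.
have eK K : 0 < K -> (\int[P]_(w in E `&` before K) (GamT w)%:E =
    \int[P]_(w in E `&` before K) (GT w)%:E)%E.
  move=> K0; have mK : measurable (E `&` before K) by exact: measurableI.
  have := gap0 K K0; rewrite /gap => /eqP; rewrite normr_eq0 subr_eq0 => /eqP eqI.
  have := congr1 EFin eqI; rewrite /Rintegral !fineK//.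
  - by apply: integrable_fin_num => //; exact: integ1.
  - by apply: integrable_fin_num => //; exact: integ1.
have inf (u : Omega -> R) : measurable_fun setT u -> (forall w, 0 <= u w) ->
    (forall w, T n w = +oo%E -> u w = 0) ->
    (\int[P]_(w in E `&` before k.+1%:R) (u w)%:E @[k --> \oo] --> \int[P]_(w in E) (u w)%:E)%E.
  move=> mu u0 uoo.
  have -> : (\int[P]_(w in E) (u w)%:E = \int[P]_(w in \bigcup_k (E `&` before k.+1%:R)) (u w)%:E)%E.
    rewrite [LHS]integral_indicE [RHS]integral_indicE; apply: eq_integral => w _; rewrite !indicE.
    have [Tf|Tf] := eqVneq (T n w) +oo%E; first by rewrite uoo// !mule0.
    congr ((_ : bool)%:R%:E * _)%E; apply/idP/idP; rewrite !inE.
      move=> Ew; have [t eT] : exists t, T n w = t%:E.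
        by case: (T n w) (jump_time_ge0 N n w) Tf => [t| |]//; exists t.
      exists (Num.truncn t) => //; split => //; rewrite /before/= eT lte_fin.
      exact: truncnS_gt.
    by move=> [k _ []].
  apply: ge0_nondecreasing_set_cvg_integral => //.
  - move=> i j ij; apply/subsetPset; apply: setIS => w /lt_le_trans; apply.
    by rewrite lee_fin ler_nat.
  - by move=> k; exact: measurableI.
  - by move=> k; apply/measurable_EFinP; exact: measurable_funTS.
  - by move=> *; rewrite lee_fin.
have c1 := inf GamT mGamT GamT0; have c2 := inf GT mGT GT0.
have e : (fun k => \int[P]_(w in E `&` before k.+1%:R) (GamT w)%:E)%E =
    (fun k => \int[P]_(w in E `&` before k.+1%:R) (GT w)%:E)%E.
  by apply/funext => k; apply: eK; rewrite ltr0n.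
rewrite -(cvg_lim _ (c2 _))//; last by move=> w e'; rewrite /GT e' discounty mul0r.
rewrite -e; apply/esym/cvg_lim => //; apply: c1 => w e'.
have := jump_time_nondecreasing N n n.+1 w (leqnSn n); rewrite e' leye_eq => /eqP e''.
by rewrite /GamT e'' discounty mul0r.
Qed.

End cells.

Section increments.
Context {R : realType} {d : measure_display} {Omega : measurableType d}.
Variable P : probability Omega R.
Hypothesis P_complete : measure_is_complete P.
Variables (W : R -> Omega -> R) (I : set R) (X : R -> R -> Omega -> R).
Hypothesis X_diffusion : regular_diffusion P W I X.
Variables r lambda : R.
Hypotheses (r_gt0 : 0 < r) (lambda_gt0 : 0 < lambda).
Variable N : R -> Omega -> nat.
Hypothesis N_poisson : poisson_process P lambda N.
Hypothesis N_indep : forall x, I x ->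
  independent_sigma P (sigma_process `[0, +oo[ (X x)) (sigma_process `[0, +oo[ N).
Local Notation path := (total_path X_diffusion).
Local Notation T := (jump_time N).
Local Notation Q := (resolvent X_diffusion r N).
Local Notation pay := (jump_payoff X_diffusion r).
Variables (x : R) (f : R -> R).
Hypotheses (Ix : I x) (mf : measurable_fun setT f).
Hypotheses (f0 : forall y, 0 <= f y) (f1 : forall y, f y <= 1).

Let fE (y : R) := (f y)%:E.
Let mfE : measurable_fun setT fE. Proof. exact/measurable_EFinP. Qed.
Let fE0 y : (0 <= fE y)%E. Proof. by rewrite lee_fin. Qed.
Let fE1 y : (fE y <= 1)%E. Proof. by rewrite lee_fin. Qed.

Let q (y : R) : R := fine (Q fE y).

Let qE y : (q y)%:E = Q fE y.
Proof.
rewrite fineK// ge0_fin_numE; last exact: resolvent_ge0.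
by apply: le_lt_trans (resolvent_prob1 _ _ _ _ X_diffusion _ _ r_gt0 _ N_poisson fE y mfE fE0 fE1) _; rewrite ltry.
Qed.

Let q0 y : 0 <= q y.
Proof. by rewrite -lee_fin qE; exact: resolvent_ge0. Qed.

Let q1 y : q y <= 1.
Proof.
by rewrite -lee_fin qE (resolvent_prob1 _ _ _ _ X_diffusion _ _ r_gt0 _ N_poisson fE y mfE fE0 fE1).
Qed.

Let mq : measurable_fun setT q.
Proof.
apply: measurable_fine_comp.
exact: (measurable_resolvent _ _ _ _ X_diffusion _ lambda).
Qed.

(** The discounted resolvent along the path, and the discounted reward at the
first jump after [t]; the former is the conditional expectation of the latter. *)
Let G (t : R) (w : Omega) : R := expR (- r * t) * q (path x t w).
Let Gam (t : R) (w : Omega) : R :=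
  discount r (next_jump N t w) * f (path x (fine (next_jump N t w)) w).

Let G0 t w : 0 <= G t w. Proof. by rewrite mulr_ge0 ?expR_ge0. Qed.

Let G1 (t : R) w : 0 <= t -> G t w <= 1.
Proof.
move=> t0; rewrite -[leRHS]mulr1 ler_pM ?expR_ge0//.
by rewrite -expR0 ler_expR mulNr oppr_le0 mulr_ge0// ltW.
Qed.

Let mG t : measurable_fun setT (G t).
Proof.
apply: measurable_funM; first exact: measurable_cst.
apply: measurableT_comp mq _.
exact: (measurable_path _ _ _ _ X_diffusion).
Qed.

Let Gam0 t w : 0 <= Gam t w. Proof. by rewrite mulr_ge0 ?discount_ge0. Qed.

Let Gam1 t w : Gam t w <= 1.
Proof.
by rewrite -[leRHS]mulr1 ler_pM ?discount_ge0// discount_le1//; exact: jump_time_ge0.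
Qed.

Let mGam (t : R) : 0 <= t -> measurable_fun setT (Gam t).
Proof.
move=> t0; have mn := measurable_next_jump P lambda N N_poisson t t0.
apply: measurable_funM; first exact: measurable_discount_comp.
by apply: measurableT_comp mf _; exact: (measurable_path_at _ _ _ _ X_diffusion).
Qed.

Let integ D (u : Omega -> R) : measurable D -> measurable_fun setT u ->
  (forall w, 0 <= u w) -> (forall w, u w <= 2) -> P.-integrable D (EFin \o u).
Proof.
move=> mD mu u0 u2; apply: (bounded_integrable P D u 2) => // w.
by rewrite ger0_norm.
Qed.

Let next_jump_Rintegral (t : R) E : 0 <= t -> completed_filtration P X N x t E ->
  \int[P]_(w in E) Gam t w = \int[P]_(w in E) G t w.
Proof.
move=> t0 FE; congr fine.
have e := next_jump_integral P P_complete W I X X_diffusion r lambda r_gt0 N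
  N_poisson N_indep x t fE E Ix t0 FE mfE fE0 fE1.
rewrite [LHS]e.
by apply: eq_integral => w _; rewrite /G EFinM qE pathE.
Qed.

(** An indicator of the event that [X_t] lies in a Borel set is an admissible
weight by [next_jump_Rintegral] at time [s], the event being known there; the
resolvent at [X_t] is a limit of sums of such weights. *)
Let weighted_next_jump (t s : R) : 0 <= t <= s ->
  \int[P]_w (G t w * Gam s w) = \int[P]_w (G t w * G s w).
Proof.
move=> /andP[t0 ts]; have s0 := le_trans t0 ts.
suff H : (\int[P]_w (Q fE (X x t w) * (Gam s w)%:E) =
          \int[P]_w (Q fE (X x t w) * (G s w)%:E))%E.
  have {}H : \int[P]_w (q (X x t w) * Gam s w) = \int[P]_w (q (X x t w) * G s w).
    rewrite /Rintegral; congr fine.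
    under eq_integral do rewrite EFinM qE.
    by rewrite H; apply: eq_integral => w _; rewrite [RHS]EFinM qE.
  have qi (u : Omega -> R) : measurable_fun setT u -> (forall w, 0 <= u w) -> (forall w, u w <= 1) ->
      P.-integrable setT (EFin \o (fun w => q (X x t w) * u w)).
    move=> mu u0 u1; apply: integ => //.
    - apply: measurable_funM mu; apply: measurableT_comp mq _.
      exact: (rd_measurable X_diffusion).
    - by move=> w; rewrite mulr_ge0.
    - move=> w; apply: (@le_trans _ _ (1 * 1)); last by rewrite mulr1 ler1n.
      by rewrite ler_pM.
  have e (u : R) w : G t w * u = expR (- r * t) * (q (X x t w) * u).
    by rewrite /G pathE// mulrA.
  under eq_Rintegral do rewrite e.
  rewrite RintegralZl//; last by apply: qi => //; exact: mGam.
  rewrite H -RintegralZl//; last by apply: qi => // w; exact: G1.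
  by apply: eq_Rintegral => w _; rewrite e.
have mX : measurable_fun setT (X x t) by exact: (rd_measurable X_diffusion).
have GE w : (0 <= (G s w)%:E)%E by rewrite lee_fin.
have GamE w : (0 <= (Gam s w)%:E)%E by rewrite lee_fin.
have mGE : measurable_fun setT (fun w => (G s w)%:E) by apply/measurable_EFinP.
have mGamE : measurable_fun setT (fun w => (Gam s w)%:E) by apply/measurable_EFinP; exact: mGam.
have mh := measurable_resolvent _ _ _ _ X_diffusion r lambda _ N_poisson fE mfE fE0.
have h0 y : (0 <= Q fE y)%E by exact: resolvent_ge0.
move: (Q fE) mh h0.
have mM (h : R -> \bar R) (u : Omega -> \bar R) : measurable_fun setT h -> measurable_fun setT u ->
    measurable_fun setT (fun w => h (X x t w) * u w)%E.
  by move=> mh mu; apply: emeasurable_funM => //; exact: measurableT_comp mh mX.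
have M0 (h : R -> \bar R) (u : Omega -> \bar R) w : (forall y, 0 <= h y)%E -> (forall w, 0 <= u w)%E ->
    (0 <= h (X x t w) * u w)%E by move=> h0 u0; rewrite mule_ge0.
apply: (@ge0_measurable_ind _ _ _ (fun h => (\int[P]_w (h (X x t w) * (Gam s w)%:E) =
          \int[P]_w (h (X x t w) * (G s w)%:E))%E)).
- move=> B mB.
  have ind (u : Omega -> \bar R) : (\int[P]_w ((\1_B (X x t w))%:E * u w) = \int[P]_(w in X x t @^-1` B) u w)%E.
    by rewrite [RHS]integral_indicE.
  rewrite !ind.
  have FB : completed_filtration P X N x s (X x t @^-1` B).
    apply: sub_sigma_algebra; left; apply: sub_sigma_algebra; left.
    by apply: sigma_process_preimage => //; rewrite /= in_itv/= t0.
  have mXB := completed_filtration_measurable P P_complete W I X X_diffusion lambda N N_poisson x s Ix _ FB.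
  have := congr1 EFin (next_jump_Rintegral s _ s0 FB); rewrite /Rintegral !fineK//.
  + apply: integrable_fin_num => //; apply: integ => // w.
    by apply: (@le_trans _ _ 1); [exact: G1|rewrite ler1n].
  + apply: integrable_fin_num => //; apply: integ => //; first exact: mGam.
    by move=> w; apply: (@le_trans _ _ 1); [exact: Gam1|rewrite ler1n].
- move=> g h mg mh g0 h0 eg eh.
  have D (u : Omega -> \bar R) : (forall w, 0 <= u w)%E -> measurable_fun setT u ->
      (\int[P]_w ((g (X x t w) + h (X x t w)) * u w) =
       \int[P]_w (g (X x t w) * u w) + \int[P]_w (h (X x t w) * u w))%E.
    move=> u0 mu; rewrite -ge0_integralD//; last 4 first.
    - by move=> w _; exact: M0.
    - exact: mM.
    - by move=> w _; exact: M0.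
    - exact: mM.
    by apply: eq_integral => w _; rewrite ge0_muleDl.
  by rewrite (D _ GamE mGamE) (D _ GE mGE) eg eh.
- move=> c h c0 mh h0 eh.
  have D (u : Omega -> \bar R) : (forall w, 0 <= u w)%E -> measurable_fun setT u ->
      (\int[P]_w ((c%:E * h (X x t w)) * u w) = c%:E * \int[P]_w (h (X x t w) * u w))%E.
    move=> u0 mu; rewrite -ge0_integralZl_EFin//; try by [exact: mM|move=> w _; exact: M0].
    by apply: eq_integral => w _; rewrite muleA.
  by rewrite (D _ GamE mGamE) (D _ GE mGE) eh.
- move=> h_ mh h0 nd eh.
  have D (u : Omega -> \bar R) : (forall w, 0 <= u w < +oo)%E -> measurable_fun setT u ->
      (\int[P]_w (limn (fun n => h_ n (X x t w)) * u w) =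
       limn (fun n => \int[P]_w (h_ n (X x t w) * u w)))%E.
    move=> u0 mu; have u0' w : (0 <= u w)%E by case/andP: (u0 w).
    rewrite -monotone_convergence//.
    + apply: eq_integral => w _; apply/esym/limeMr.
      * by rewrite ge0_fin_numE//; case/andP: (u0 w).
      * by apply: ereal_nondecreasing_is_cvgn; exact: nd.
    + by move=> n; exact: mM.
    + by move=> n w _; exact: M0.
    + by move=> w _ m n mn; rewrite lee_wpmul2r//; exact: nd.
  have GamF w : (0 <= (Gam s w)%:E < +oo)%E by rewrite GamE ltry.
  have GF w : (0 <= (G s w)%:E < +oo)%E by rewrite GE ltry.
  rewrite (D _ GamF mGamE) (D _ GF mGE).
  by congr (limn _); apply/funext => n; exact: eh.
Qed.

(** The resolvent of a function with values in the unit interval also takes its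
values there, so the identity for abstract [q] applies to it. *)
Lemma jump_identity_unit n E : (0 < n)%N -> measurable E ->
  (forall b : R, 0 < b ->
    completed_filtration P X N x b (E `&` [set w | (T n w < b%:E)%E])) ->
  (\int[P]_(w in E) pay x fE (T n.+1) w =
   \int[P]_(w in E) pay x (Q fE) (T n) w)%E.
Proof.
move=> n0 mE hE.
have := jump_identity_bounded P W I X X_diffusion r lambda r_gt0 lambda_gt0 N
  N_poisson N_indep x f q Ix mf mq f0 f1 q0 q1 next_jump_Rintegral weighted_next_jump
  n n0 E mE hE.
move=> e; rewrite [LHS]e; apply: eq_integral => w _.
by rewrite EFinM qE.
Qed.

End increments.

Section jump_identity.
Context {R : realType} {d : measure_display} {Omega : measurableType d}.
Variable P : probability Omega R.
Hypothesis P_complete : measure_is_complete P.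
Variables (W : R -> Omega -> R) (I : set R) (X : R -> R -> Omega -> R).
Hypothesis X_diffusion : regular_diffusion P W I X.
Variables r lambda : R.
Hypotheses (r_gt0 : 0 < r) (lambda_gt0 : 0 < lambda).
Variable N : R -> Omega -> nat.
Hypothesis N_poisson : poisson_process P lambda N.
Hypothesis N_indep : forall x, I x ->
  independent_sigma P (sigma_process `[0, +oo[ (X x)) (sigma_process `[0, +oo[ N).
Local Notation path := (total_path X_diffusion).
Local Notation retract := (retract X_diffusion).
Local Notation T := (jump_time N).
Local Notation Q := (resolvent X_diffusion r N).
Local Notation pay := (jump_payoff X_diffusion r).
Local Open Scope ereal_scope.

Implicit Types (f g : R -> \bar R) (tau : Omega -> \bar R).

Lemma jump_payoffD x f g tau w : (forall y, 0 <= f y) -> (forall y, 0 <= g y) ->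
  pay x (fun y => f y + g y) tau w = pay x f tau w + pay x g tau w.
Proof. by move=> f0 g0; rewrite /jump_payoff ge0_muleDr. Qed.

Lemma jump_payoffZ x c f tau w :
  pay x (fun y => c * f y) tau w = c * pay x f tau w.
Proof. by rewrite /jump_payoff muleCA. Qed.

Lemma le_jump_payoff x f g tau w : f (path x (fine (tau w)) w) <= g (path x (fine (tau w)) w) ->
  pay x f tau w <= pay x g tau w.
Proof. by move=> fg; rewrite lee_wpmul2l// lee_fin discount_ge0. Qed.

Lemma jump_payoff_lim x (f_ : nat -> R -> \bar R) tau w :
  (forall y, nondecreasing_seq (fun n => f_ n y)) ->
  pay x (fun y => limn (fun n => f_ n y)) tau w =
  limn (fun n => pay x (f_ n) tau w).
Proof.
move=> nd; rewrite /jump_payoff limeMl//.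
by apply: ereal_nondecreasing_is_cvgn; exact: nd.
Qed.

Lemma integral_jump_payoffD E x f g tau : measurable E -> measurable_fun setT tau ->
  measurable_fun setT f -> measurable_fun setT g ->
  (forall y, 0 <= f y) -> (forall y, 0 <= g y) ->
  \int[P]_(w in E) pay x (fun y => f y + g y) tau w =
  \int[P]_(w in E) pay x f tau w + \int[P]_(w in E) pay x g tau w.
Proof.
move=> mE mtau mf mg f0 g0; rewrite -(@ge0_integralD _ _ _ P E mE (pay x f tau) (pay x g tau)).
- by apply: eq_integral => w _; exact: jump_payoffD.
- by move=> w _; exact: jump_payoff_ge0.
- by apply: measurable_funTS; exact: (measurable_jump_payoff _ _ _ _ X_diffusion).
- by move=> w _; exact: jump_payoff_ge0.
- by apply: measurable_funTS; exact: (measurable_jump_payoff _ _ _ _ X_diffusion).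
Qed.

Lemma integral_jump_payoffZ E x (c : R) f tau : (0 <= c)%R -> measurable E ->
  measurable_fun setT tau -> measurable_fun setT f -> (forall y, 0 <= f y) ->
  \int[P]_(w in E) pay x (fun y => c%:E * f y) tau w =
  c%:E * \int[P]_(w in E) pay x f tau w.
Proof.
move=> c0 mE mtau mf f0; rewrite -(@ge0_integralZl_EFin _ _ _ P E mE (pay x f tau)).
- by apply: eq_integral => w _; exact: jump_payoffZ.
- by move=> w _; exact: jump_payoff_ge0.
- by apply: measurable_funTS; exact: (measurable_jump_payoff _ _ _ _ X_diffusion).
- exact: c0.
Qed.

Lemma integral_jump_payoff_lim E x (f_ : nat -> R -> \bar R) tau : measurable E ->
  measurable_fun setT tau -> (forall n, measurable_fun setT (f_ n)) ->
  (forall n y, 0 <= f_ n y) -> (forall y, nondecreasing_seq (fun n => f_ n y)) ->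
  \int[P]_(w in E) pay x (fun y => limn (fun n => f_ n y)) tau w =
  limn (fun n => \int[P]_(w in E) pay x (f_ n) tau w).
Proof.
move=> mE mtau mf f0 nd.
under eq_integral do rewrite jump_payoff_lim//.
apply: monotone_convergence => //.
- by move=> n; apply: measurable_funTS; exact: (measurable_jump_payoff _ _ _ _ X_diffusion).
- by move=> n w _; exact: jump_payoff_ge0.
- by move=> w _ m n mn; apply: le_jump_payoff; exact: nd.
Qed.

Lemma path_retract y t : path (retract y) t = path y t.
Proof. by rewrite /total_path retract_id//; exact: retract_in. Qed.

(** The identity for the next jump, at time [0]. *)
Lemma resolventE f y : measurable_fun setT f -> (forall y, 0 <= f y) ->
  Q f y = \int[P]_w pay y f (T 1) w.
Proof.
move=> mf f0; have Ir := retract_in _ _ _ _ X_diffusion y.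
have := next_jump_integral_rect _ _ _ _ X_diffusion r lambda N N_poisson N_indep
  (retract y) 0%R f setT setT Ir (lexx 0%R) (smallest_sigma_algebraT _) (smallest_sigma_algebraT _) mf f0.
rewrite setIT => H.
transitivity (\int[P]_w ((expR (- r * 0))%:E * Q f (X (retract y) 0%R w))).
  under eq_integral do rewrite mulr0 expR0 mul1e (rd_start X_diffusion)//.
  rewrite integral_cst_prob /resolvent; apply: eq_integral => w' _.
  by congr (_ * _); apply: eq_integral => w _; rewrite path_retract.
rewrite -H; apply: eq_integral => w _.
by rewrite /jump_payoff /next_jump (pp_start N_poisson) path_retract.
Qed.

Lemma resolventD f g y : measurable_fun setT f -> measurable_fun setT g ->
  (forall y, 0 <= f y) -> (forall y, 0 <= g y) ->
  Q (fun y => f y + g y) y = Q f y + Q g y.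
Proof.
move=> mf mg f0 g0; rewrite !resolventE//; first last.
- by move=> z; rewrite adde_ge0.
- exact: emeasurable_funD.
exact: integral_jump_payoffD (measurableT) (measurable_jump_time _ _ _ N_poisson 1) mf mg f0 g0.
Qed.

Lemma resolventZ (c : R) f y : (0 <= c)%R -> measurable_fun setT f -> (forall y, 0 <= f y) ->
  Q (fun y => c%:E * f y) y = c%:E * Q f y.
Proof.
move=> c0 mf f0; rewrite !resolventE//; first last.
- by move=> z; rewrite mule_ge0.
- exact: measurable_funeM.
exact: integral_jump_payoffZ c0 measurableT (measurable_jump_time _ _ _ N_poisson 1) mf f0.
Qed.

Lemma resolvent_lim (f_ : nat -> R -> \bar R) y : (forall n, measurable_fun setT (f_ n)) ->
  (forall n y, 0 <= f_ n y) -> (forall y, nondecreasing_seq (fun n => f_ n y)) ->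
  Q (fun y => limn (fun n => f_ n y)) y = limn (fun n => Q (f_ n) y).
Proof.
move=> mf f0 nd; rewrite resolventE//; last first.
  by move=> z; apply: limn_ge0 => // n; exact: nd.
  exact: measurable_limn.
under [in RHS]eq_fun do rewrite resolventE//.
apply: integral_jump_payoff_lim => //; exact: (measurable_jump_time _ _ _ N_poisson).
Qed.

Lemma le_resolvent f g y : measurable_fun setT f -> measurable_fun setT g ->
  (forall y, 0 <= f y) -> (forall y, f y <= g y) -> Q f y <= Q g y.
Proof.
move=> mf mg f0 fg; have g0 z : 0 <= g z by exact: le_trans (fg z).
have mT := measurable_jump_time _ _ _ N_poisson 1.
rewrite !resolventE//; apply: ge0_le_integral => //.
- by move=> w _; exact: jump_payoff_ge0.
- exact: (measurable_jump_payoff _ _ _ _ X_diffusion).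
- exact: (measurable_jump_payoff _ _ _ _ X_diffusion).
- by move=> w _; exact: le_jump_payoff.
Qed.

(** The strong Markov property at the [n]-th jump. The condition on [E] says that
[E] belongs to the past of [T n] in the filtration before right limits, so that
its part in a cell is known at the right end of the cell. It holds for the event
that a stopping time has not been reached at [T n]. *)
Lemma jump_identity x f n E : I x -> (0 < n)%N -> measurable E ->
  (forall b : R, (0 < b)%R ->
    completed_filtration P X N x b (E `&` [set w | T n w < b%:E])) ->
  measurable_fun setT f -> (forall y, 0 <= f y) ->
  \int[P]_(w in E) pay x f (T n.+1) w =
  \int[P]_(w in E) pay x (Q f) (T n) w.
Proof.
move=> Ix n0 mE hE; move: f.
have mT1 := measurable_jump_time _ _ _ N_poisson n.+1; have mT := measurable_jump_time _ _ _ N_poisson n.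
have mR f : measurable_fun setT f -> (forall y, 0 <= f y) -> measurable_fun setT (Q f).
  by move=> mf f0; exact: (measurable_resolvent _ _ _ _ X_diffusion _ lambda).
have mjE f tau : measurable_fun setT f -> measurable_fun setT tau ->
    measurable_fun E (pay x f tau).
  by move=> mf mtau; apply: measurable_funTS; exact: (measurable_jump_payoff _ _ _ _ X_diffusion).
apply: (@ge0_measurable_ind _ _ _ (fun f => \int[P]_(w in E) pay x f (T n.+1) w =
  \int[P]_(w in E) pay x (Q f) (T n) w)).
- move=> B mB.
  apply: (jump_identity_unit P P_complete _ _ _ X_diffusion r lambda r_gt0 lambda_gt0 N
    N_poisson N_indep x (\1_B) Ix) => //.
- move=> f g mf mg f0 g0 ef eg.
  rewrite (integral_jump_payoffD E x f g _ mE mT1 mf mg f0 g0) ef eg.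
  rewrite -(integral_jump_payoffD E x _ _ _ mE mT (mR f mf f0) (mR g mg g0)).
  + by congr (integral P E _); apply/funext => w; rewrite /jump_payoff resolventD.
  + by move=> y; exact: resolvent_ge0.
  + by move=> y; exact: resolvent_ge0.
- move=> c f c0 mf f0 ef.
  rewrite (integral_jump_payoffZ E x c f _ c0 mE mT1 mf f0) ef.
  rewrite -(integral_jump_payoffZ E x c _ _ c0 mE mT (mR f mf f0)).
  + by congr (integral P E _); apply/funext => w; rewrite /jump_payoff resolventZ.
  + by move=> y; exact: resolvent_ge0.
- move=> f_ mf f0 nd ef.
  rewrite integral_jump_payoff_lim//.
  have -> : Q (fun y => limn (fun n => f_ n y)) = fun y => limn (fun n => Q (f_ n) y).
    by apply/funext => y; rewrite resolvent_lim.
  rewrite (integral_jump_payoff_lim E x _ _ mE mT (fun k => mR _ (mf k) (f0 k))).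
  + by congr (limn _); apply/funext => k; exact: ef.
  + by move=> k y; exact: resolvent_ge0.
  + by move=> y i j ij; apply: le_resolvent => // z; exact: nd.
Qed.

Lemma stopping_time_measurable x tau : I x ->
  stopping_time (common_filtration P (X x) N) tau -> measurable_fun setT tau.
Proof.
move=> Ix [tau0 stau]; apply: measurable_ge0_ereal => // t t0.
have := stau t t0 (t + 1)%R; rewrite /= in_itv/= ltrDl ltr01 => /(_ isT).
exact: (completed_filtration_measurable P P_complete _ _ _ X_diffusion lambda N N_poisson x _ Ix).
Qed.

(** The event is witnessed by a rational [q < b] with [T n <= q < tau]. That [q]
is strictly below [b] absorbs the right limit in the common filtration. *)
Lemma jump_before_stopping x tau n (b : R) : I x ->
  stopping_time (common_filtration P (X x) N) tau -> (0 < b)%R ->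
  completed_filtration P X N x b ([set w | T n w < tau w] `&` [set w | T n w < b%:E]).
Proof.
move=> Ix [tau0 stau] b0.
pose TF := g_sigma_algebraType (join_filtration (natural_filtration (X x)) (natural_filtration N) b
      `|` P.-negligible).
pose F (q : rat) : set TF := if (0 <= (ratr q : R) < b)%R then
   [set w | T n w <= (ratr q)%:E] `&` ~` [set w | tau w <= (ratr q)%:E] else set0.
rewrite (_ : _ `&` _ = \bigcup_q F q).
  apply: (@bigcupT_measurable_rat _ TF) => q; rewrite /F; case: ifPn => // /andP[q0 qb].
  apply: measurableI.
    apply: sub_sigma_algebra; left; apply: sub_sigma_algebra; right.
    under eq_fun do rewrite (jump_time_le _ _ _ N_poisson)//.
    by apply: natural_filtrationN_le; rewrite q0 ltW.
  apply: measurableC; have := stau _ q0 b; rewrite /= in_itv/= qb => /(_ isT).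
  exact.
apply/seteqP; split => w /=.
  move=> [h1 h2].
  have [t eT] : exists t, T n w = t%:E.
    by case: (T n w) (jump_time_ge0 N n w) h2 => [t| |]//; exists t.
  have t0 : (0 <= t)%R by rewrite -lee_fin -eT jump_time_ge0.
  rewrite eT in h1 h2.
  have [s [ts sb stau']] : exists s : R, [/\ (t < s)%R, (s <= b)%R & s%:E <= tau w].
    case: (tau w) h1 => [s| |]// h1.
    - by exists (Num.min s b); rewrite lt_min !ge_min !lee_fin !ge_min !lexx orbT -!lte_fin h1 h2.
    - by exists b; rewrite lexx leey -lte_fin.
  have [q] := rat_in_itvoo ts; rewrite in_itv/= => /andP[tq qs].
  exists q => //; rewrite /F (le_trans t0 (ltW tq)) (lt_le_trans qs sb)/=.
  split => /=; first by rewrite eT lee_fin ltW.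
  by apply/negP; rewrite -ltNge; apply: lt_le_trans stau'; rewrite lte_fin.
move=> [q _]; rewrite /F; case: ifPn => // /andP[q0 qb] [/= h1 /negP]; rewrite -ltNge => h2.
by split; apply: (le_lt_trans h1) => //; rewrite lte_fin.
Qed.

End jump_identity.

(** * The value function *)

(** The integrand equals [exp (2 (alpha + r) t)] times the square of the
discounted function; were the limit [L] positive, it would eventually stay
above [(L / 2) ^ 2]. *)
Lemma square_integrable_limit0 {R : realType} (r alpha : R) (g : R -> R) :
  - r < alpha -> measurable_fun setT g -> (forall t, 0 <= g t) ->
  cvg (expR (- r * t) * g t @[t --> +oo]) ->
  (\int[lebesgue_measure]_(t in `[0%R, +oo[) (expR (2 * alpha * t) * g t ^+ 2)%:E < +oo)%E ->
  forall e, 0 < e -> exists2 K, 0 <= K & forall t, K < t -> expR (- r * t) * g t <= e.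
Proof.
move=> ra mg g0 /cvg_ex[L cL] foo e e0.
have near_dist (e' : R) : 0 < e' -> exists2 K, 0 <= K &
    forall t, K < t -> `|L - expR (- r * t) * g t| < e'.
  move=> e'0; have /cvgrPdist_lt/(_ e' e'0)[M [_ HM]] := cL.
  exists (Num.max 0 M); first by rewrite le_max lexx.
  by move=> t; rewrite gt_max => /andP[_ Mt]; exact: HM.
have [L0|L0] := leP L 0.
  have [K K0 HK] := near_dist e e0; exists K => // t Kt.
  by have := HK t Kt; rewrite ltr_norml => /andP[h _]; move: h L0; lra.
have L2 : 0 < L / 2 by rewrite divr_gt0.
have [K K0 HK] := near_dist _ L2.
pose c := (L / 2) ^+ 2; have c0 : 0 < c by rewrite exprn_gt0.
set J := (\int[lebesgue_measure]_(t in `[0%R, +oo[) _)%E in foo.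
have mh : measurable_fun setT (fun t => (expR (2 * alpha * t) * g t ^+ 2)%:E).
  apply/measurable_EFinP; apply: measurable_funM; last exact: measurable_funX.
  by apply: measurableT_comp; [exact: measurable_expR|exact: measurable_funM].
have lower n : ((c * n%:R)%:E <= J)%E.
  have h1 : ((c * n%:R)%:E <= \int[lebesgue_measure]_(t in `]K, (K + n%:R)%R]) (cst c%:E t))%E.
    rewrite integral_cst//= lebesgue_measure_itv/= lte_fin ltrDl.
    case: ifPn => [n0|]; first by rewrite -EFinD addrAC subrr add0r -EFinM.
    by rewrite -leNgt => n0; rewrite mule0 lee_fin mulr_ge0_le0// ltW.
  apply: (le_trans h1).
  have h2 : (\int[lebesgue_measure]_(t in `]K, (K + n%:R)%R]) (cst c%:E t) <=
      \int[lebesgue_measure]_(t in `]K, (K + n%:R)%R]) (expR (2 * alpha * t) * g t ^+ 2)%:E)%E.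
    apply: ge0_le_integral => //.
    - by move=> t _; rewrite lee_fin ltW.
    - exact: measurable_funTS.
    - move=> t /=; rewrite in_itv/= => /andP[Kt _]; rewrite lee_fin.
      have h : L / 2 <= expR (- r * t) * g t.
        by have := HK t Kt; rewrite ltr_norml => /andP[_ h]; move: h; lra.
      have -> : expR (2 * alpha * t) * g t ^+ 2 =
          expR (2 * (alpha + r) * t) * (expR (- r * t) * g t) ^+ 2.
        have -> : 2 * alpha * t = 2 * (alpha + r) * t + (- r * t + - r * t) by ring.
        by rewrite !expRD exprMn (expr2 (expR (- r * t))) !mulrA.
      rewrite -[leLHS]mul1r; apply: ler_pM => //; first exact: sqr_ge0.
        rewrite -expR0 ler_expR mulr_ge0 ?(le_trans K0 (ltW Kt))// mulr_ge0//.
        by move: ra; lra.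
      apply: lerXn2r => //; rewrite nnegrE; first exact: ltW.
      by rewrite mulr_ge0// expR_ge0.
  apply: (le_trans h2).
  apply: ge0_subset_integral => //.
  - exact: measurable_funTS.
  - by move=> t _; rewrite lee_fin mulr_ge0 ?expR_ge0// sqr_ge0.
  - by move=> t /=; rewrite !in_itv/= andbT => /andP[Kt _]; exact: le_trans K0 (ltW Kt).
have J0 : (0 <= J)%E by apply: le_trans (lower 0%N); rewrite mulr0.
have Jf : J \is a fin_num by rewrite ge0_fin_numE.
have := lower (Num.truncn (fine J / c)).+1.
rewrite -(fineK Jf) lee_fin leNgt => /negP[].
by rewrite mulrC -ltr_pdivrMr//; exact: truncnS_gt.
Qed.

Section value_function.
Context {R : realType} {d : measure_display} {Omega : measurableType d}.
Variable P : probability Omega R.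
Variables (W : R -> Omega -> R) (I : set R) (X : R -> R -> Omega -> R).
Hypothesis X_diffusion : regular_diffusion P W I X.
Variables r lambda : R.
Variable N : R -> Omega -> nat.
Hypothesis N_poisson : poisson_process P lambda N.
Hypothesis N_indep : forall x, I x ->
  independent_sigma P (sigma_process `[0, +oo[ (X x)) (sigma_process `[0, +oo[ N).
Variables l u : R -> R.
Hypotheses (l_meas : measurable_fun I l) (u_meas : measurable_fun I u).
Hypotheses (l_ge0 : forall x, I x -> 0 <= l x) (u_ge0 : forall x, I x -> 0 <= u x).
Hypothesis lu_H2 : forall x, I x -> exists alpha : R, [/\ - r < alpha,
  H2 P (common_filtration P (X x) N) alpha (fun t w => l (X x t w)) &
  H2 P (common_filtration P (X x) N) alpha (fun t w => u (X x t w))].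
Hypothesis LU_sup : forall x, I x ->
  (\int[P]_w ereal_sup
     [set (Num.max (expR (- r * t) * l (X x t w))
                   (expR (- r * t) * u (X x t w)))%:E | t in `[0%R, +oo[] < +oo)%E.
Hypothesis L_lim : forall x, I x -> {ae P, forall w,
  cvg (expR (- r * t) * l (X x t w) @[t --> +oo])}.
Hypothesis U_lim : forall x, I x -> {ae P, forall w,
  cvg (expR (- r * t) * u (X x t w) @[t --> +oo])}.
Local Notation path := (total_path X_diffusion).
Local Notation retract := (retract X_diffusion).
Local Notation T := (jump_time N).
Local Notation Q := (resolvent X_diffusion r N).
Local Notation pay := (jump_payoff X_diffusion r).

Definition lower_payoff (y : R) : R := l (retract y).
Definition upper_payoff (y : R) : R := u (retract y).
Local Notation l' := lower_payoff.
Local Notation u' := upper_payoff.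

Lemma lower_payoff_ge0 y : 0 <= l' y.
Proof. by apply: l_ge0; exact: retract_in. Qed.

Lemma upper_payoff_ge0 y : 0 <= u' y.
Proof. by apply: u_ge0; exact: retract_in. Qed.

Lemma measurable_lower_payoff : measurable_fun setT l'.
Proof. exact: (measurable_comp_retract _ _ _ _ X_diffusion). Qed.

Lemma measurable_upper_payoff : measurable_fun setT u'.
Proof. exact: (measurable_comp_retract _ _ _ _ X_diffusion). Qed.

Definition max_payoff (y : R) : \bar R := (Num.max (l' y) (u' y))%:E.

Lemma measurable_max_payoff : measurable_fun setT max_payoff.
Proof.
apply/measurable_EFinP; apply: measurable_maxr.
  exact: measurable_lower_payoff.
exact: measurable_upper_payoff.
Qed.

Local Open Scope ereal_scope.

Lemma max_payoff_ge0 y : 0 <= max_payoff y.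
Proof. by rewrite lee_fin le_max lower_payoff_ge0. Qed.

Let sup_payoff x w := ereal_sup
  [set (Num.max (expR (- r * t) * l (X x t w))
                (expR (- r * t) * u (X x t w)))%R%:E | t in `[0%R, +oo[%classic].

Let jump_payoff_le_sup x tau w : I x -> 0 <= tau w ->
  pay x max_payoff tau w <= sup_payoff x w.
Proof.
move=> Ix; rewrite /jump_payoff /max_payoff.
have mem t : (0 <= t)%R -> (expR (- r * t))%:E * (Num.max (l' (path x t w)) (u' (path x t w)))%:E
    <= sup_payoff x w.
  move=> t0; apply: ereal_sup_ubound; exists t; first by rewrite /= in_itv/= t0.
  rewrite -EFinM maxr_pMr ?expR_ge0// /lower_payoff /upper_payoff retract_id; last exact: path_in.
  by rewrite pathE.
case: (tau w) => [t| |]//; first by rewrite lee_fin discount_fin; exact: mem.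
move=> _; rewrite discounty mul0e; apply: le_trans (mem 0%R (lexx 0%R)).
by rewrite mule_ge0 ?lee_fin ?expR_ge0// le_max lower_payoff_ge0.
Qed.

Lemma integral_max_payoff_fin x tau : I x -> (forall w, 0 <= tau w) ->
  \int[P]_w pay x max_payoff tau w < +oo.
Proof.
move=> Ix tau0; apply: le_lt_trans (LU_sup x Ix); apply: le_integral_lower.
  by move=> w; apply: jump_payoff_ge0 => y; exact: max_payoff_ge0.
by move=> w; exact: jump_payoff_le_sup.
Qed.

(** The time integral is finite on almost every path, its expectation being
finite. *)
Lemma payoff_vanishes x (h : R -> R) (alpha : R) : I x -> (- r < alpha)%R ->
  measurable_fun I h -> (forall y, I y -> (0 <= h y)%R) ->
  \int[P]_w \int[lebesgue_measure]_(t in `[0%R, +oo[)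
    (expR (2 * alpha * t) * h (X x t w) ^+ 2)%R%:E < +oo ->
  {ae P, forall w, cvg ((expR (- r * t) * h (X x t w))%R @[t --> +oo%R])} ->
  {ae P, forall w e, (0 < e)%R -> exists2 K : R, (0 <= K)%R &
    forall t, (K < t)%R -> (expR (- r * t) * h (X x t w) <= e)%R}.
Proof.
move=> Ix ra mh h0 foo hlim.
pose g t w := h (retract (path x t w)).
have gE t w : (0 <= t)%R -> g t w = h (X x t w).
  by move=> t0; rewrite /g retract_id; [rewrite pathE|exact: path_in].
have mg : measurable_fun setT (fun p : R * Omega => g p.1 p.2).
  apply: (measurableT_comp (measurable_comp_retract _ _ _ _ X_diffusion h mh)).
  apply: (@measurable_path_joint _ _ _ _ _ _ _ X_diffusion _ Omega id) => t t0.
  by apply: (rd_measurable X_diffusion) => //; exact: retract_in.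
have g0 t w : (0 <= g t w)%R by apply: h0; exact: retract_in.
pose Phi (p : Omega * R) : \bar R := (\1_(`[0%R, +oo[ : set R) p.2)%:E *
  (expR (2 * alpha * p.2) * g p.2 p.1 ^+ 2)%:E.
have mPhi : measurable_fun setT Phi.
  apply: emeasurable_funM; apply/measurable_EFinP.
    by apply: measurableT_comp measurable_snd; exact: measurable_indic.
  apply: measurable_funM.
    apply: (measurableT_comp (f := expR)); first exact: measurable_expR.
    by apply: measurable_funM; [exact: measurable_cst|exact: measurable_snd].
  apply: measurable_funX.
  apply: (measurableT_comp (g := fun p : Omega * R => (p.2, p.1)) mg).
  by apply: measurable_fun_pair; [exact: measurable_snd|exact: measurable_fst].
have Phi0 p : 0 <= Phi p.
  by rewrite mule_ge0 ?lee_fin// mulr_ge0 ?expR_ge0// sqr_ge0.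
pose J w := \int[lebesgue_measure]_t Phi (w, t).
have JE w : \int[lebesgue_measure]_(t in `[0%R, +oo[)
    (expR (2 * alpha * t) * g t w ^+ 2)%:E = J w.
  by rewrite [LHS]integral_indicE.
have JE' w : \int[lebesgue_measure]_(t in `[0%R, +oo[)
    (expR (2 * alpha * t) * h (X x t w) ^+ 2)%:E = J w.
  rewrite -JE; apply: eq_integral => t; rewrite inE/= in_itv/= andbT => t0.
  by rewrite gE.
have mJ : measurable_fun setT J.
  exact: (measurable_fun_fubini_tonelli_F (m2 := lebesgue_measure) Phi mPhi Phi0).
have J0 w : 0 <= J w by exact: integral_ge0.
have iJ : P.-integrable setT J.
  apply/integrableP; split => //.
  under eq_integral do rewrite gee0_abs//.
  by under eq_integral do rewrite -JE'.
have := integrable_ae measurableT iJ.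
move=> Jae; apply: filterS2 Jae hlim => w /(_ Logic.I) Jfin cw e e0.
have cg : cvg ((expR (- r * t) * g t w)%R @[t --> +oo%R]).
  move/cvg_ex : cw => [L cL]; apply/cvg_ex; exists L.
  apply: cvg_trans cL; apply: near_eq_cvg.
  near=> t; rewrite gE//; near: t; exact: nbhs_pinfty_ge.
have Jlt : \int[lebesgue_measure]_(t in `[0%R, +oo[)
    (expR (2 * alpha * t) * g t w ^+ 2)%:E < +oo.
  by rewrite JE -ge0_fin_numE.
have [K K0 HK] := square_integrable_limit0 r alpha (fun t => g t w) ra
  (measurable_fun_pair1 w mg) (g0^~ w) cg Jlt e e0.
exists K => // t Kt; rewrite -gE; first exact: HK.
exact: le_trans (ltW Kt).
Unshelve. all: by end_near. Qed.

(** Dominated convergence. The dominating function is the supremum over the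
countably many jump times, which is measurable, and whose integral is bounded by
the one of the supremum over all times. *)
Lemma max_payoff_vanishes x : I x ->
  \int[P]_w pay x max_payoff (T n) w @[n --> \oo] --> 0.
Proof.
move=> Ix; have [alpha [ra [_ lfin] [_ ufin]]] := lu_H2 x Ix.
have lae := payoff_vanishes x l alpha Ix ra l_meas l_ge0 lfin (L_lim x Ix).
have uae := payoff_vanishes x u alpha Ix ra u_meas u_ge0 ufin (U_lim x Ix).
have mjp n : measurable_fun setT (pay x max_payoff (T n)).
  apply: (measurable_jump_payoff _ _ _ _ X_diffusion); first exact: measurable_max_payoff.
  exact: (measurable_jump_time _ _ _ N_poisson).
have jp0 n w : 0 <= pay x max_payoff (T n) w.
  by apply: jump_payoff_ge0 => y; exact: max_payoff_ge0.
pose g w := esups (fun n => pay x max_payoff (T n) w) 0%N.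
have mg : measurable_fun setT g by exact: measurable_fun_esups.
have jpg n w : pay x max_payoff (T n) w <= g w.
  by apply: ereal_sup_ubound; exists n.
have g0 w : 0 <= g w := le_trans (jp0 0%N w) (jpg 0%N w).
have gs w : g w <= sup_payoff x w.
  apply: ge_ereal_sup => _ [n _ <-]; apply: jump_payoff_le_sup => //.
  exact: jump_time_ge0.
have ig : P.-integrable setT g.
  apply/integrableP; split => //.
  under eq_integral do rewrite gee0_abs//.
  by apply: le_lt_trans (LU_sup x Ix); exact: le_integral_lower.
have [| | |_ _] := @dominated_convergence _ _ _ P setT measurableT
  (fun n => pay x max_payoff (T n)) (cst 0) g mjp (measurable_cst _).
- apply: filterS2 lae uae => w lw uw _.
  pose j n : R := (discount r (T n w) * Num.max (l' (path x (fine (T n w)) w))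
    (u' (path x (fine (T n w)) w)))%R.
  have j0 n : (0 <= j n)%R by rewrite mulr_ge0 ?discount_ge0// le_max lower_payoff_ge0.
  rewrite (_ : (fun n => _) = fun n => (j n)%:E); last by apply/funext => n; rewrite /j EFinM.
  apply: cvg_EFin; first exact: nearW.
  apply/cvgr0Pnorm_le => e e0.
  have [K1 K10 H1] := lw e e0; have [K2 K20 H2] := uw e e0.
  pose K := Num.max K1 K2; have K0 : (0 <= K)%R by rewrite le_max K10.
  exists (N K w).+1 => // n /= Nn; rewrite ger0_norm// /j.
  have : K%:E < T n w by rewrite (jump_time_gt _ _ _ N_poisson).
  case: (T n w) => [t| |]//; last by rewrite discounty mul0r ltW.
  rewrite lte_fin /K gt_max => /andP[h1 h2]; rewrite discount_fin.
  have t0 : (0 <= t)%R by exact: le_trans (ltW h1).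
  rewrite maxr_pMr ?expR_ge0// ge_max /lower_payoff /upper_payoff retract_id; last exact: path_in.
  by rewrite pathE// H1// H2.
- exact: ig.
- by apply: aeW => w n _; rewrite gee0_abs.
- by rewrite integral0.
Qed.

(** The payoff collected at the next Poisson time by players who value
continuation by [V]. *)
Definition stop_or_continue (V : R -> \bar R) (y : R) : \bar R :=
  maxe (l' y)%:E (mine (V y) (u' y)%:E).
Local Notation Psi := stop_or_continue.

Lemma stop_or_continue_ge0 V y : 0 <= Psi V y.
Proof. by rewrite le_max lee_fin lower_payoff_ge0. Qed.

Lemma stop_or_continue_le V y : Psi V y <= max_payoff y.
Proof.
rewrite /Psi /max_payoff EFin_max ge_max le_max lexx/=.
by rewrite le_max (_ : mine (V y) (u' y)%:E <= (u' y)%:E) ?orbT// ge_min lexx orbT.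
Qed.

Lemma le_stop_or_continue V V' y : V y <= V' y -> Psi V y <= Psi V' y.
Proof.
move=> VV'; rewrite /Psi ge_max le_max lexx/= le_max; apply/orP; right.
by rewrite le_min !ge_min VV' lexx orbT.
Qed.

Lemma measurable_stop_or_continue V : measurable_fun setT V -> measurable_fun setT (Psi V).
Proof.
move=> mV; apply: measurable_maxe.
  by apply/measurable_EFinP; exact: measurable_lower_payoff.
apply: measurable_mine => //.
by apply/measurable_EFinP; exact: measurable_upper_payoff.
Qed.

(** Started from [0], the iteration of the dynamic programming operator
increases, because this operator is monotone. *)
Fixpoint value_iter (n : nat) : R -> \bar R :=
  if n is m.+1 then Q (Psi (value_iter m)) else fun=> 0.

Lemma value_iter_ge0 n y : 0 <= value_iter n y.
Proof. by case: n => [//|n]; apply: resolvent_ge0 => z; exact: stop_or_continue_ge0. Qed.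

Lemma measurable_value_iter n : measurable_fun setT (value_iter n).
Proof.
elim: n => [|n IH] /=; first exact: measurable_cst.
apply: (measurable_resolvent _ _ _ _ X_diffusion _ lambda) => //.
  exact: measurable_stop_or_continue.
by move=> y; exact: stop_or_continue_ge0.
Qed.

Let mPsi n : measurable_fun setT (Psi (value_iter n)).
Proof. by apply: measurable_stop_or_continue; exact: measurable_value_iter. Qed.

Lemma value_iter_nd y : nondecreasing_seq (fun n => value_iter n y).
Proof.
apply/nondecreasing_seqP => n; elim: n y => [|n IH] y.
  exact: (value_iter_ge0 1).
apply: (le_resolvent _ _ _ _ X_diffusion r lambda N N_poisson N_indep (Psi (value_iter n))
  (Psi (value_iter n.+1))) => //.
  by move=> z; exact: stop_or_continue_ge0.
by move=> z; apply: le_stop_or_continue; exact: IH.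
Qed.

Definition valueE (y : R) : \bar R := limn (fun n => value_iter n y).

Lemma measurable_valueE : measurable_fun setT valueE.
Proof. by apply: measurable_limn; [exact: measurable_value_iter|exact: value_iter_nd]. Qed.

Lemma valueE_ge0 y : 0 <= valueE y.
Proof. by apply: limn_ge0; [move=> n; exact: value_iter_ge0|exact: value_iter_nd]. Qed.

Let Psi_nd y : nondecreasing_seq (fun n => Psi (value_iter n) y).
Proof. by move=> m n mn; apply: le_stop_or_continue; exact: value_iter_nd. Qed.

(** Both sides are suprema; a level strictly below the left-hand side and at
least [l] is exceeded by the supremum of the iterates, hence by one of them. *)
Lemma stop_or_continue_lim y : Psi valueE y = limn (fun n => Psi (value_iter n) y).
Proof.
have sup_lim (v : nat -> \bar R) : nondecreasing_seq v -> limn v = ereal_sup (range v).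
  by move=> nd; apply/cvg_lim => //; exact: ereal_nondecreasing_cvgn.
rewrite (sup_lim _ (Psi_nd y)); apply/eqP; rewrite eq_le; apply/andP; split; last first.
  apply: ge_ereal_sup => _ [n _ <-]; apply: le_stop_or_continue.
  rewrite /valueE (sup_lim _ (value_iter_nd y)).
  by apply: ereal_sup_ubound; exists n.
rewrite leNgt; apply/negP; set c := ereal_sup _ => cPsi.
have lc : (l' y)%:E <= c.
  apply: le_trans (ereal_sup_ubound (ex_intro2 _ _ 0%N Logic.I erefl)).
  by rewrite /Psi le_max lexx.
move: cPsi; rewrite /Psi lt_max ltNge lc/= lt_min => /andP[cV cu].
move: cV; rewrite /valueE (sup_lim _ (value_iter_nd y)) => /ereal_sup_gt[_ [n _ <-] cn].
suff : c < Psi (value_iter n) y.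
  by rewrite ltNge => /negP; apply; apply: ereal_sup_ubound; exists n.
by rewrite /Psi lt_max lt_min cn cu orbT.
Qed.

Lemma valueE_fix y : valueE y = Q (Psi valueE) y.
Proof.
have -> : Psi valueE = fun y => limn (fun n => Psi (value_iter n) y).
  by apply/funext => z; exact: stop_or_continue_lim.
rewrite (resolvent_lim _ _ _ _ X_diffusion r lambda N N_poisson N_indep
  (fun n => Psi (value_iter n)) y mPsi (fun n z => stop_or_continue_ge0 _ z) Psi_nd).
rewrite -[RHS]/(limn (fun n => value_iter n.+1 y)).
apply/esym/cvg_lim => //.
by rewrite (cvg_shiftS (fun n => value_iter n y)); apply: ereal_nondecreasing_is_cvgn; exact: value_iter_nd.
Qed.

Lemma valueE_lty y : valueE y < +oo.
Proof.
rewrite valueE_fix.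
apply: (@le_lt_trans _ _ (Q max_payoff y)).
  apply: (le_resolvent _ _ _ _ X_diffusion r lambda N N_poisson N_indep).
  - by apply: measurable_stop_or_continue; exact: measurable_valueE.
  - exact: measurable_max_payoff.
  - by move=> z; exact: stop_or_continue_ge0.
  - by move=> z; exact: stop_or_continue_le.
rewrite (resolventE _ _ _ _ X_diffusion r lambda N N_poisson N_indep max_payoff y
  measurable_max_payoff max_payoff_ge0).
under eq_integral do rewrite /jump_payoff -path_retract.
apply: (integral_max_payoff_fin (retract y) (T 1)); first exact: retract_in.
by move=> w; exact: jump_time_ge0.
Qed.

Definition value (y : R) : R := fine (valueE y).

Lemma valueK y : (value y)%:E = valueE y.
Proof. by rewrite fineK// ge0_fin_numE ?valueE_lty ?valueE_ge0. Qed.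

End value_function.

Arguments lower_payoff {R d Omega P W I X} X_diffusion l y.
Arguments upper_payoff {R d Omega P W I X} X_diffusion u y.
Arguments max_payoff {R d Omega P W I X} X_diffusion l u y.
Arguments stop_or_continue {R d Omega P W I X} X_diffusion l u V y.
Arguments valueE {R d Omega P W I X} X_diffusion r N l u y.
Arguments value {R d Omega P W I X} X_diffusion r N l u y.

(** * Comparison with stopped payoffs *)

Section stopped_value.
Context {R : realType} {d : measure_display} {Omega : measurableType d}.
Variable P : probability Omega R.
Hypothesis P_complete : measure_is_complete P.
Variables (W : R -> Omega -> R) (I : set R) (X : R -> R -> Omega -> R).
Hypothesis X_diffusion : regular_diffusion P W I X.
Variables r lambda : R.
Hypotheses (r_gt0 : 0 < r) (lambda_gt0 : 0 < lambda).
Variable N : R -> Omega -> nat.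
Hypothesis N_poisson : poisson_process P lambda N.
Hypothesis N_indep : forall x, I x ->
  independent_sigma P (sigma_process `[0, +oo[ (X x)) (sigma_process `[0, +oo[ N).
Variables l u : R -> R.
Hypotheses (l_meas : measurable_fun I l) (u_meas : measurable_fun I u).
Hypotheses (l_ge0 : forall x, I x -> 0 <= l x) (u_ge0 : forall x, I x -> 0 <= u x).
Hypothesis lu_H2 : forall x, I x -> exists alpha : R, [/\ - r < alpha,
  H2 P (common_filtration P (X x) N) alpha (fun t w => l (X x t w)) &
  H2 P (common_filtration P (X x) N) alpha (fun t w => u (X x t w))].
Hypothesis LU_sup : forall x, I x ->
  (\int[P]_w ereal_sup
     [set (Num.max (expR (- r * t) * l (X x t w))
                   (expR (- r * t) * u (X x t w)))%:E | t in `[0%R, +oo[] < +oo)%E.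
Hypothesis L_lim : forall x, I x -> {ae P, forall w,
  cvg (expR (- r * t) * l (X x t w) @[t --> +oo])}.
Hypothesis U_lim : forall x, I x -> {ae P, forall w,
  cvg (expR (- r * t) * u (X x t w) @[t --> +oo])}.
Local Notation path := (total_path X_diffusion).
Local Notation T := (jump_time N).
Local Notation Q := (resolvent X_diffusion r N).
Local Notation pay := (jump_payoff X_diffusion r).

Local Notation max_payoff := (max_payoff X_diffusion l u).
Local Notation Psi := (stop_or_continue X_diffusion l u).
Local Notation V := (valueE X_diffusion r N l u).
Local Open Scope ereal_scope.

Variables (x : R) (S : Omega -> \bar R).
Hypothesis Ix : I x.
Hypothesis S_stopping : stopping_time (common_filtration P (X x) N) S.
Hypothesis S_jump : forall w, S w = +oo \/ exists2 n, (1 <= n)%N & S w = T n w.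

Let before n := [set w | T n w < S w].
Let stopped := pay x (Psi V) S.

Let mS : measurable_fun setT S.
Proof. exact: (stopping_time_measurable P P_complete _ _ _ X_diffusion lambda N N_poisson x S Ix). Qed.

Let mT n : measurable_fun setT (T n).
Proof. exact: (measurable_jump_time _ _ _ N_poisson). Qed.

Let mV : measurable_fun setT V.
Proof. exact: (measurable_valueE _ _ _ _ X_diffusion r lambda). Qed.

Let V0 y : 0 <= V y.
Proof. exact: (valueE_ge0 _ _ _ _ X_diffusion r lambda). Qed.

Let mPsi : measurable_fun setT (Psi V).
Proof. exact: (measurable_stop_or_continue _ _ _ _ X_diffusion). Qed.

Let Psi0 y : 0 <= Psi V y.
Proof. exact: stop_or_continue_ge0. Qed.

Let mjp f tau : measurable_fun setT f -> measurable_fun setT tau ->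
  measurable_fun setT (pay x f tau).
Proof. by move=> *; exact: (measurable_jump_payoff _ _ _ _ X_diffusion). Qed.

Let jp0 f tau w : (forall y, 0 <= f y) -> 0 <= pay x f tau w.
Proof. by move=> f0; exact: jump_payoff_ge0. Qed.

Let mbefore n : measurable (before n).
Proof.
rewrite (_ : before n = [set: Omega] `&` [set w | T n w < S w]); last by rewrite setTI.
exact: measurable_lte.
Qed.

Let before0 : before 0 = setT.
Proof.
apply/seteqP; split => // w _; rewrite /before/= (jump_time0 _ _ _ N_poisson).
by case: (S_jump w) => [->//|[n n0 ->]]; exact: (jump_time_gt0 _ _ _ N_poisson).
Qed.

Let before_sub n : before n.+1 `<=` before n.
Proof.
move=> w; apply: le_lt_trans; apply: jump_time_nondecreasing; exact: leqnSn.
Qed.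

Let before_next n w : before n w -> ~ before n.+1 w -> S w = T n.+1 w.
Proof.
move=> h1 /negP; rewrite -leNgt => h2; apply/eqP; rewrite eq_le h2/=.
move: h1; rewrite /before/=; case: (S_jump w) => [->|[m m0 ->]]; first by rewrite leey.
move=> h; apply: jump_time_nondecreasing; rewrite ltnNge; apply/negP => mn.
by move: h; rewrite ltNge jump_time_nondecreasing.
Qed.

(** [a n] is the value carried to the [n]-th jump by the paths that have not
stopped, and [c n] is what the other paths have collected. *)
Let a n := \int[P]_(w in before n) pay x V (T n) w.
Let c n := \int[P]_(w in ~` before n) stopped w.

Let a0 : a 0%N = V x.
Proof.
rewrite /a before0 -[RHS](integral_cst_prob P); apply: eq_integral => w _.
rewrite /jump_payoff (jump_time0 _ _ _ N_poisson) discount_fin mulr0 expR0 mul1e.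
by rewrite pathE// (rd_start X_diffusion).
Qed.

(** For [n > 0] this is the strong Markov property at the [n]-th jump, applied to
the fixed point equation; at time [0] it is that equation. *)
Let a_step n : a n = \int[P]_(w in before n) pay x (Psi V) (T n.+1) w.
Proof.
have fixV : V = Q (Psi V).
  by apply/funext => y; exact: (valueE_fix _ _ _ _ X_diffusion r lambda).
case: n => [|n].
  rewrite a0 before0 {1}fixV.
  exact: (resolventE _ _ _ _ X_diffusion r lambda N N_poisson N_indep _ x mPsi Psi0).
rewrite [LHS](_ : _ = \int[P]_(w in before n.+1) pay x (Q (Psi V)) (T n.+1) w).
  rewrite (jump_identity P P_complete _ _ _ X_diffusion r lambda r_gt0 lambda_gt0 N N_poisson N_indep
    x (Psi V) n.+1 (before n.+1) Ix _ (mbefore _) _ mPsi Psi0)//.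
  by move=> b b0; exact: (jump_before_stopping P I X lambda N N_poisson x S n.+1 b Ix S_stopping b0).
by rewrite /a {1}fixV.
Qed.

Let a_split n : a n = \int[P]_(w in before n.+1) pay x (Psi V) (T n.+1) w +
  \int[P]_(w in before n `\` before n.+1) stopped w.
Proof.
rewrite a_step; have e : before n = before n.+1 `|` (before n `\` before n.+1).
  by rewrite setDUK.
have mD : measurable (before n `\` before n.+1) by exact: measurableD.
rewrite [in LHS]e ge0_integral_setU//; first last.
- by rewrite disj_set2E setDIK.
- by move=> w _; exact: jp0.
- by apply: measurable_funTS; exact: mjp.
congr (_ + _); apply: eq_integral => w; rewrite inE => -[h1 h2].
by rewrite /stopped /jump_payoff (before_next n w h1 h2).
Qed.

Let c_step n : c n.+1 = c n + \int[P]_(w in before n `\` before n.+1) stopped w.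
Proof.
have mD : measurable (before n `\` before n.+1) by exact: measurableD.
have e : ~` before n.+1 = ~` before n `|` (before n `\` before n.+1).
  apply/seteqP; split => w /=.
    by move=> h; have [hn|hn] := pselect (before n w); [right|left].
  by move=> [h /before_sub//|[]].
rewrite /c e ge0_integral_setU//.
- exact: measurableC.
- by apply: measurable_funTS; exact: mjp.
- by move=> w _; exact: jp0.
- by rewrite disj_set2E; apply/eqP/seteqP; split => // w [h []].
Qed.

Let c0 : c 0%N = 0.
Proof. by rewrite /c before0 setCT integral_set0. Qed.

Let integral_stopped : c n @[n --> \oo] --> \int[P]_w stopped w.
Proof.
have -> : \int[P]_w stopped w = \int[P]_(w in \bigcup_n (~` before n)) stopped w.
  rewrite [RHS]integral_indicE; apply: eq_integral => w _.
  have [h|h] := boolP (w \in \bigcup_n (~` before n)); first by rewrite indicE h mul1e.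
  rewrite indicE (negbTE h) mul0e /stopped /jump_payoff.
  case: (S_jump w) => [->|[n n0 eS]]; first by rewrite discounty mul0e.
  by move/negP: h; case; rewrite inE; exists n => //; rewrite /before/= eS ltxx.
apply: ge0_nondecreasing_set_cvg_integral.
- move=> i j ij; apply/subsetPset => w h hj; apply: h.
  by apply: le_lt_trans hj; exact: jump_time_nondecreasing.
- by move=> n; exact: measurableC.
- by move=> n; apply: measurable_funTS; exact: mjp.
- by move=> *; exact: jp0.
Qed.

Lemma stopped_le_value :
  (forall w n, (0 < n)%N -> T n w < S w ->
     V (path x (fine (T n w)) w) <= Psi V (path x (fine (T n w)) w)) ->
  \int[P]_w stopped w <= V x.
Proof.
move=> H; have bound n : a n + c n <= V x.
  elim: n => [|n IH]; first by rewrite a0 c0 adde0.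
  apply: le_trans IH; rewrite c_step (a_split n) -[leRHS]addeA [X in _ <= _ + X]addeC.
  apply: leeD => //; rewrite /a; apply: ge0_le_integral => //.
  - by move=> w _; exact: jp0.
  - by apply: measurable_funTS; exact: mjp.
  - by apply: measurable_funTS; exact: mjp.
  - by move=> w bw; apply: le_jump_payoff; exact: H.
rewrite -(cvg_lim _ integral_stopped)//; apply: lime_le.
  by apply/cvg_ex; eexists; exact: integral_stopped.
apply: nearW => n; apply: le_trans (bound n); apply: leeDr.
by apply: integral_ge0 => w _; exact: jp0.
Qed.

(** The remainder [a n] is bounded by the discounted maximum of the payoffs at
the next jump, which vanishes in expectation. *)
Lemma value_le_stopped :
  (forall w n, (0 < n)%N -> T n w < S w ->
     Psi V (path x (fine (T n w)) w) <= V (path x (fine (T n w)) w)) ->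
  V x <= \int[P]_w stopped w.
Proof.
move=> H; have bound n : V x <= a n + c n.
  elim: n => [|n IH]; first by rewrite a0 c0 adde0.
  apply: (le_trans IH); rewrite c_step (a_split n) -[leLHS]addeA [X in _ + X <= _]addeC.
  apply: leeD => //; rewrite /a; apply: ge0_le_integral => //.
  - by move=> w _; exact: jp0.
  - by apply: measurable_funTS; exact: mjp.
  - by apply: measurable_funTS; exact: mjp.
  - by move=> w bw; apply: le_jump_payoff; exact: H.
pose b n := \int[P]_w pay x max_payoff (T n) w.
have mmax : measurable_fun setT max_payoff by exact: (measurable_max_payoff _ _ _ _ X_diffusion).
have max0 y : 0 <= max_payoff y by exact: max_payoff_ge0.
have bb : b n.+1 @[n --> \oo] --> 0.
  have := max_payoff_vanishes P _ _ _ X_diffusion r lambda N N_poisson l u l_meas u_meas l_ge0 u_ge0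
    lu_H2 LU_sup L_lim U_lim x Ix.
  by rewrite -cvg_shiftS.
have cS n : c n <= \int[P]_w stopped w.
  apply: ge0_subset_integral => //; first exact: measurableC.
    exact: mjp.
  by move=> w _; exact: jp0.
have ab n : a n <= b n.+1.
  rewrite a_step; apply: (@le_trans _ _ (\int[P]_(w in before n) pay x max_payoff (T n.+1) w)).
    apply: ge0_le_integral => //.
    - by move=> w _; exact: jp0.
    - by apply: measurable_funTS; exact: mjp.
    - by apply: measurable_funTS; exact: mjp.
    - by move=> w bw; apply: le_jump_payoff; exact: stop_or_continue_le.
  apply: ge0_subset_integral => //; first exact: mjp.
  by move=> w _; exact: jp0.
have st0 : 0 <= \int[P]_w stopped w by apply: integral_ge0 => w _; exact: jp0.
have lim : b n.+1 + \int[P]_w stopped w @[n --> \oo] --> 0 + \int[P]_w stopped w.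
  by apply: cvgeD => //; exact: cvg_cst.
rewrite -[leRHS]add0e -(cvg_lim _ lim)//; apply: lime_ge.
  by apply/cvg_ex; eexists; exact: lim.
by apply: nearW => n; apply: (le_trans (bound n)); exact: leeD.
Qed.

End stopped_value.

(** * Poisson hitting times *)

Section hitting_times.
Context {R : realType} {d : measure_display} {Omega : measurableType d}.
Variable P : probability Omega R.
Variables (W : R -> Omega -> R) (I : set R) (X : R -> R -> Omega -> R).
Hypothesis X_diffusion : regular_diffusion P W I X.
Variable lambda : R.
Variable N : R -> Omega -> nat.
Hypothesis N_poisson : poisson_process P lambda N.
Local Notation T := (jump_time N).

Local Open Scope ereal_scope.
Variable x : R.
Hypothesis Ix : I x.

Lemma hitting_le D n w : (1 <= n)%N -> T n w < +oo -> D (X x (fine (T n w)) w) ->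
  poisson_hitting (X x) N D w <= T n w.
Proof. by move=> n1 Tn Dn; apply: ereal_inf_lbound; exists n. Qed.

Lemma hitting_attained D w : poisson_hitting (X x) N D w = +oo \/
  exists n, [/\ (1 <= n)%N, T n w < +oo, D (X x (fine (T n w)) w) &
    poisson_hitting (X x) N D w = T n w].
Proof.
pose Q n := [/\ (1 <= n)%N, T n w < +oo & D (X x (fine (T n w)) w)].
have [exQ|nQ] := pselect (exists n, `[< Q n >]); last first.
  left; rewrite -[RHS]ereal_inf0 /poisson_hitting; congr ereal_inf.
  by apply/seteqP; split => // _ [n Qn <-]; apply: nQ; exists n; exact/asboolP.
right; case: (ex_minnP exQ) => n /asboolP[n1 Tn Dn] nmin; exists n; split => //.
apply/eqP; rewrite eq_le hitting_le//=; apply: le_ereal_inf_tmp => _ [m Qm <-].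
by apply: jump_time_nondecreasing; apply: nmin; exact/asboolP.
Qed.

(** On the event [T n <= t] the jump time is its minimum with [t], which is
measurable for the sigma-algebra at [s], and so are the values of the path up to
[t]. *)
Let path_before_measurable (t s : R) n D : (0 <= t)%R -> (t <= s)%R -> measurable D ->
  completed_filtration P X N x s
    [set w | T n w <= t%:E /\ D (X x (fine (T n w)) w)].
Proof.
move=> t0 ts mD.
pose G := join_filtration (natural_filtration (X x)) (natural_filtration N) s `|` P.-negligible.
pose TF := g_sigma_algebraType G.
have hN m (c : R) : (0 <= c <= t)%R -> measurable ([set w | (m <= N c w)%N] : set TF).
  move=> /andP[c0 ct]; apply: sub_sigma_algebra; left; apply: sub_sigma_algebra; right.
  by apply: natural_filtrationN_le; rewrite c0 (le_trans ct).
have mtau : measurable_fun [set: TF] (fun w => mine (T n w) t%:E).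
  apply: measurable_ge0_ereal; first by move=> w; rewrite le_min jump_time_ge0 lee_fin.
  move=> c c0; have [tc|ct] := leP t c.
    rewrite (_ : [set w | _] = setT); first exact: measurableT.
    by apply/seteqP; split => // w _ /=; rewrite ge_min lee_fin tc orbT.
  rewrite (_ : [set w | _] = [set w | (n <= N c w)%N]); first by apply: hN; rewrite c0 ltW.
  apply/seteqP; split => w /=; rewrite ge_min lee_fin (leNgt t c) ct orbF (jump_time_le _ _ _ N_poisson)//.
have mX : measurable_fun setT (fun p : R * TF => X x (Num.min (Num.max 0 p.1)%R t) p.2).
  apply: (@measurable_fun_caratheodory _ TF _ (fun c w => X x (Num.min c t) w)).
    move=> c c0 _ B mB; rewrite setTI; apply: sub_sigma_algebra; left; apply: sub_sigma_algebra; left.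
    apply: sigma_process_preimage => //.
    by rewrite /= in_itv/= le_min c0 t0/= ge_min ts orbT.
  move=> w q c q0 c0 qc.
  apply: (X_seq_continuous _ _ _ _ X_diffusion x w Ix (fun m => Num.min (q m) t) (Num.min c t)).
  - by move=> m; rewrite le_min q0 t0.
  - by rewrite le_min c0 t0.
  - have cm : {for c, continuous (fun z : R => Num.min z t)%R}.
      by apply: (@continuous_min _ _ id (fun=> t)); [exact: cvg_id|exact: cvg_cst].
    exact: (cvg_comp _ _ qc cm).
have mXT : measurable_fun [set: TF] (fun w => X x (Num.min (Num.max 0 (fine (mine (T n w) t%:E)))%R t) w).
  apply: (measurableT_comp (g := fun w : TF => (fine (mine (T n w) t%:E), w)) mX).
  by apply: measurable_fun_pair => //; exact: measurable_fine_comp.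
have := mXT measurableT D mD; rewrite setTI => mXD.
have := measurableI _ _ (hN n t _) mXD; rewrite t0 lexx => /(_ isT).
rewrite (_ : _ `&` _ = [set w | T n w <= t%:E /\ D (X x (fine (T n w)) w)])//.
apply/seteqP; split => w /=; rewrite (jump_time_le _ _ _ N_poisson)// => -[h1 h2]; split => //.
all: move: h2; have h : T n w <= t%:E by rewrite (jump_time_le _ _ _ N_poisson).
all: rewrite (min_idPl h) max_r ?fine_ge0 ?jump_time_ge0// (_ : Num.min _ _ = fine (T n w))//.
all: apply/min_idPl; rewrite -lee_fin fineK//.
all: by rewrite ge0_fin_numE ?jump_time_ge0// (le_lt_trans h) ?ltry.
Qed.

Lemma hitting_poisson_stopping D : measurable D ->
  poisson_stopping P (X x) N (poisson_hitting (X x) N D).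
Proof.
move=> mD; split; last first.
  move=> w; have [->|[n [n1 _ _ ->]]] := hitting_attained D w; first by left.
  by right; exists n.
split=> [w|t t0 s].
  by apply: le_ereal_inf_tmp => _ [n _ <-]; exact: jump_time_ge0.
rewrite /= in_itv/= andbT => ts.
pose G := join_filtration (natural_filtration (X x)) (natural_filtration N) s `|` P.-negligible.
rewrite (_ : [set w | _] = \bigcup_n (if (1 <= n)%N then
    [set w | T n w <= t%:E /\ D (X x (fine (T n w)) w)] else set0)).
  apply: (@bigcupT_measurable _ (g_sigma_algebraType G)) => n; case: ifP => // _.
  by apply: path_before_measurable => //; exact: ltW.
apply/seteqP; split => w /=.
  have [->//|[n [n1 Tn Dn ->]]] := hitting_attained D w.
  by move=> h; exists n => //; rewrite n1.
move=> [n _]; case: ifP => // n1 [h1 h2]; apply: (le_trans _ h1).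
by apply: hitting_le => //; exact: le_lt_trans h1 (ltry t).
Qed.

Lemma min_poisson_stopping (tau sigma : Omega -> \bar R) :
  poisson_stopping P (X x) N tau -> poisson_stopping P (X x) N sigma ->
  poisson_stopping P (X x) N (fun w => mine (tau w) (sigma w)).
Proof.
move=> [[tau0 stau] vtau] [[sigma0 ssigma] vsigma]; split; last first.
  by move=> w; rewrite /mine; case: ifP.
split=> [w|t t0 s hs]; first by rewrite le_min tau0 sigma0.
pose G := join_filtration (natural_filtration (X x)) (natural_filtration N) s `|` P.-negligible.
rewrite (_ : [set w | _] = [set w | tau w <= t%:E] `|` [set w | sigma w <= t%:E]).
  apply: (@measurableU _ (g_sigma_algebraType G)); [exact: stau|exact: ssigma].
by apply/seteqP; split => w /=; rewrite ge_min => /orP.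
Qed.

End hitting_times.

(** * The Dynkin game *)

Section game.
Context {R : realType} {d : measure_display} {Omega : measurableType d}.
Variable P : probability Omega R.
Hypothesis P_complete : measure_is_complete P.
Variables (W : R -> Omega -> R) (I : set R) (X : R -> R -> Omega -> R).
Hypothesis X_diffusion : regular_diffusion P W I X.
Variables r lambda : R.
Hypotheses (r_gt0 : 0 < r) (lambda_gt0 : 0 < lambda).
Variable N : R -> Omega -> nat.
Hypothesis N_poisson : poisson_process P lambda N.
Hypothesis N_indep : forall x, I x ->
  independent_sigma P (sigma_process `[0, +oo[ (X x)) (sigma_process `[0, +oo[ N).
Variables l u : R -> R.
Hypotheses (l_meas : measurable_fun I l) (u_meas : measurable_fun I u).
Hypotheses (l_ge0 : forall x, I x -> 0 <= l x) (u_ge0 : forall x, I x -> 0 <= u x).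
Hypothesis lu_H2 : forall x, I x -> exists alpha : R, [/\ - r < alpha,
  H2 P (common_filtration P (X x) N) alpha (fun t w => l (X x t w)) &
  H2 P (common_filtration P (X x) N) alpha (fun t w => u (X x t w))].
Hypothesis LU_sup : forall x, I x ->
  (\int[P]_w ereal_sup
     [set (Num.max (expR (- r * t) * l (X x t w))
                   (expR (- r * t) * u (X x t w)))%:E | t in `[0%R, +oo[] < +oo)%E.
Hypothesis L_lim : forall x, I x -> {ae P, forall w,
  cvg (expR (- r * t) * l (X x t w) @[t --> +oo])}.
Hypothesis U_lim : forall x, I x -> {ae P, forall w,
  cvg (expR (- r * t) * u (X x t w) @[t --> +oo])}.
Variable M : R -> Omega -> R.
Hypothesis M_eq0 : forall x, I x -> {ae P, forall w, M x w = 0}.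
Local Notation path := (total_path X_diffusion).
Local Notation T := (jump_time N).
Local Notation pay := (jump_payoff X_diffusion r).

Local Notation l' := (lower_payoff X_diffusion l).
Local Notation u' := (upper_payoff X_diffusion u).
Local Notation Psi := (stop_or_continue X_diffusion l u).
Local Notation V := (valueE X_diffusion r N l u).
Local Notation v := (value X_diffusion r N l u).
Local Notation RC x := (poisson_stopping P (X x) N).

Let A := [set x | I x /\ (v x < l x \/ (l x <= v x /\ u x < l x))].
Let B := [set x | I x /\ u x < v x].
Let etaA x := poisson_hitting (X x) N A.
Let etaB x := poisson_hitting (X x) N B.

Let mv : measurable_fun setT v.
Proof.
apply: measurable_fine_comp.
exact: (measurable_valueE _ _ _ _ X_diffusion r lambda).
Qed.

Let ml : measurable_fun setT l'.
Proof. exact: (measurable_lower_payoff _ _ _ _ X_diffusion). Qed.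

Let mu : measurable_fun setT u'.
Proof. exact: (measurable_upper_payoff _ _ _ _ X_diffusion). Qed.

Let lE y : I y -> l' y = l y.
Proof. by move=> Iy; rewrite /lower_payoff retract_id. Qed.

Let uE y : I y -> u' y = u y.
Proof. by move=> Iy; rewrite /upper_payoff retract_id. Qed.

Let measurable_lt (f g : R -> R) : measurable_fun setT f -> measurable_fun setT g ->
  measurable [set y | f y < g y].
Proof.
move=> mf mg; rewrite (_ : [set y | _] = [set: R] `&` [set y | ((f y)%:E < (g y)%:E)%E]).
  by apply: measurable_lte => //; exact/measurable_EFinP.
by rewrite setTI; apply/seteqP; split => y /=; rewrite lte_fin.
Qed.

Let mI : measurable I. Proof. exact: (measurable_interval _ _ _ _ X_diffusion). Qed.

Let mA : measurable A.
Proof.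
rewrite (_ : A = I `&` ([set y | v y < l' y] `|` ((~` [set y | v y < l' y]) `&` [set y | u' y < l' y]))).
  apply: measurableI => //; apply: measurableU; first exact: measurable_lt.
  by apply: measurableI; [apply: measurableC; exact: measurable_lt|exact: measurable_lt].
apply/seteqP; split => y /= [Iy h]; split=> //; move: h; rewrite lE// uE// leNgt.
  by move=> [h|[/negP h1 h2]]; [left|right].
by move=> [h|[/negP h1 h2]]; [left|right].
Qed.

Let mB : measurable B.
Proof.
rewrite (_ : B = I `&` [set y | u' y < v y]).
  by apply: measurableI => //; exact: measurable_lt.
by apply/seteqP; split => y /= [Iy h]; split=> //; move: h; rewrite uE.
Qed.

Let psi y := Num.max (l' y) (Num.min (v y) (u' y)).

Let PsiE y : Psi V y = (psi y)%:E.
Proof.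
rewrite /stop_or_continue -(valueK _ _ _ _ X_diffusion r lambda N N_poisson N_indep
  l u l_meas u_meas l_ge0 LU_sup) /psi EFin_max EFin_min//.
Qed.

Let psi0 y : 0 <= psi y.
Proof. by rewrite le_max lower_payoff_ge0. Qed.

Lemma etaA_RC x : I x -> RC x (etaA x).
Proof. by move=> Ix; exact: (hitting_poisson_stopping P _ _ _ X_diffusion lambda). Qed.

Lemma etaB_RC x : I x -> RC x (etaB x).
Proof. by move=> Ix; exact: (hitting_poisson_stopping P _ _ _ X_diffusion lambda). Qed.

(** Almost surely the payoff of the game, in a form that is visibly
measurable. *)
Let payoff0 x := payoff r l' u' (X x) (cst 0).

Let payoff0_ge0 x tau sigma w : 0 <= payoff0 x tau sigma w.
Proof.
rewrite /payoff0 /payoff; case: ifP => _.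
  by rewrite mulr_ge0 ?discount_ge0// lower_payoff_ge0.
by case: ifP => _ //; rewrite mulr_ge0 ?discount_ge0// upper_payoff_ge0.
Qed.

Let RC_ge0 x tau w : RC x tau -> (0 <= tau w)%E.
Proof. by move=> [[]]. Qed.

Let RC_measurable x tau : I x -> RC x tau -> measurable_fun setT tau.
Proof.
by move=> Ix [st _]; exact: (stopping_time_measurable P P_complete _ _ _ X_diffusion lambda N N_poisson x).
Qed.

Let X_tau x tau w : I x -> RC x tau -> X x (fine (tau w)) w = path x (fine (tau w)) w.
Proof. by move=> Ix rc; rewrite pathE// fine_ge0// (RC_ge0 x). Qed.

Let measurable_payoff0 x tau sigma : I x -> RC x tau -> RC x sigma ->
  measurable_fun setT (payoff0 x tau sigma).
Proof.
move=> Ix rct rcs; have mt := RC_measurable x tau Ix rct; have ms := RC_measurable x sigma Ix rcs.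
have mpay (h : R -> R) t : RC x t -> measurable_fun setT h ->
    measurable_fun setT (fun w => discount r (t w) * h (X x (fine (t w)) w)).
  move=> rc mh; have mt' := RC_measurable x t Ix rc.
  apply: measurable_funM; first exact: measurable_discount_comp.
  apply: (eq_measurable_fun (fun w => h (path x (fine (t w)) w))).
    by move=> w _; rewrite X_tau.
  by apply: measurableT_comp mh _; exact: (measurable_path_at _ _ _ _ X_diffusion).
apply: measurable_fun_ifT.
- apply: measurable_or; apply: measurable_and.
  + exact: measurable_fun_lee.
  + by apply: measurable_fun_lte => //; exact: measurable_cst.
  + exact: measurable_fun_lte.
  + by apply: measurable_fun_eqe => //; exact: measurable_cst.
- exact: mpay.
- by apply: measurable_fun_ifT; [exact: measurable_fun_lte|exact: mpay|exact: measurable_cst].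
Qed.

Let expected_payoffE x tau sigma : I x -> RC x tau -> RC x sigma ->
  (expected_payoff P r l u X M x tau sigma = \int[P]_w (payoff0 x tau sigma w)%:E)%E.
Proof.
move=> Ix rct rcs; rewrite /expected_payoff unlock.
have e : ae_eq P setT (fun w => (payoff0 x tau sigma w)%:E)
    (fun w => (payoff r l u (X x) (M x) tau sigma w)%:E).
  apply: filterS (M_eq0 x Ix) => w Mw _; congr EFin.
  rewrite /payoff0 /payoff Mw !X_tau//; case: ifP => _.
    by rewrite lE//; exact: path_in.
  by case: ifP => // _; rewrite uE//; exact: path_in.
have m0 : measurable_fun setT (fun w => (payoff0 x tau sigma w)%:E).
  by apply/measurable_EFinP; exact: measurable_payoff0.
apply/esym/ae_eq_integral => //.
exact: (ae_measurable_fun P_complete e m0).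
Qed.

Let stopped x (S : Omega -> \bar R) w := pay x (Psi V) S w.

Let stoppedE x S w : stopped x S w = (discount r (S w) * psi (path x (fine (S w)) w))%:E.
Proof. by rewrite /stopped /jump_payoff PsiE. Qed.

Let measurable_stopped x S : measurable_fun setT S -> measurable_fun setT (stopped x S).
Proof.
move=> mS; apply: (measurable_jump_payoff _ _ _ _ X_diffusion) => //.
apply: (measurable_stop_or_continue _ _ _ _ X_diffusion) => //.
exact: (measurable_valueE _ _ _ _ X_diffusion r lambda).
Qed.

Let stopped_ge0 x S w : (0 <= stopped x S w)%E.
Proof. by rewrite stoppedE lee_fin mulr_ge0// discount_ge0. Qed.

Let not_hit D x n (w : Omega) : I x -> (1 <= n)%N -> (T n w < poisson_hitting (X x) N D w)%E ->
  ~ D (path x (fine (T n w)) w).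
Proof.
move=> Ix n1 Tn Dn; have Tfin : (T n w < +oo)%E by rewrite (lt_le_trans Tn)// leey.
move: Tn; rewrite ltNge => /negP; apply; apply: hitting_le => //.
by rewrite -(pathE _ _ _ _ X_diffusion)// fine_ge0// jump_time_ge0.
Qed.

Let hit D x (w : Omega) : I x -> (poisson_hitting (X x) N D w < +oo)%E ->
  D (path x (fine (poisson_hitting (X x) N D w)) w).
Proof.
move=> Ix; have [->//|[n [n1 Tn Dn ->] _]] := hitting_attained X N x D w.
by rewrite pathE// fine_ge0// jump_time_ge0.
Qed.

(** At the hitting time of [B] one has [u < v], so that [u] is at most [psi];
before it [v <= u], so that [v <= psi] and [stopped_le_value] applies. *)
Let payoff_le_value x tau : I x -> RC x tau ->
  (expected_payoff P r l u X M x tau (etaB x) <= (v x)%:E)%E.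
Proof.
move=> Ix rct; have rcB := etaB_RC x Ix.
rewrite expected_payoffE//.
pose S w := mine (tau w) (etaB x w).
have rcS : RC x S by exact: min_poisson_stopping.
have mS := RC_measurable x S Ix rcS.
rewrite (valueK _ _ _ _ X_diffusion r lambda N N_poisson N_indep
  l u l_meas u_meas l_ge0 LU_sup)//.
apply: (@le_trans _ _ (\int[P]_w stopped x S w)%E).
  apply: ge0_le_integral => //.
  - by move=> w _; rewrite lee_fin.
  - by apply/measurable_EFinP; exact: measurable_payoff0.
  - exact: measurable_stopped.
  move=> w _; rewrite stoppedE lee_fin /payoff0 /payoff /S.
  have [ts|st] := leP (tau w) (etaB x w); last first.
    rewrite (lt_gtF st)/= (X_tau x (etaB x))//.
    apply: ler_wpM2l; first exact: discount_ge0.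
    have Bs : B (path x (fine (etaB x w)) w) by apply: hit => //; apply: lt_le_trans st _; exact: leey.
    move: Bs => [Iy]; rewrite -uE// => uv.
    by rewrite /psi le_max le_min lexx (ltW uv) orbT.
  rewrite (X_tau x tau)//; case: ifP => _.
    by apply: ler_wpM2l; [exact: discount_ge0|rewrite /psi le_max lexx].
  by rewrite mulr_ge0// discount_ge0.
apply: (stopped_le_value P P_complete _ _ _ X_diffusion r lambda r_gt0 lambda_gt0 N N_poisson N_indep
  l u l_meas u_meas l_ge0 x S Ix) => //; [by case: rcS|by case: rcS|].
move=> w n n0 TS; rewrite PsiE -(valueK _ _ _ _ X_diffusion r lambda N N_poisson N_indep
  l u l_meas u_meas l_ge0 LU_sup) lee_fin.
have nB : ~ B (path x (fine (T n w)) w).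
  by apply: not_hit => //; apply: lt_le_trans TS _; rewrite ge_min lexx orbT.
have Iy := path_in _ _ _ _ X_diffusion x (fine (T n w)) w.
rewrite /psi le_max le_min lexx/=; apply/orP; right.
by rewrite leNgt; apply/negP => h; apply: nB; split => //; rewrite -uE.
Qed.

(** At the hitting time of [A] either [v < l] or [u < l], so that [psi = l];
before it [l] is at most [v] and [u], so that [psi] is at most [v] and, where the
opponent stops, at most [u]. *)
Let value_le_payoff x sigma : I x -> RC x sigma ->
  ((v x)%:E <= expected_payoff P r l u X M x (etaA x) sigma)%E.
Proof.
move=> Ix rcs; have rcA := etaA_RC x Ix.
rewrite expected_payoffE//.
pose S w := mine (etaA x w) (sigma w).
have rcS : RC x S by exact: min_poisson_stopping.
have mS := RC_measurable x S Ix rcS.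
have notA y : I y -> ~ A y -> l' y <= v y /\ l' y <= u' y.
  move=> Iy nA; have lv : l' y <= v y.
    by rewrite leNgt; apply/negP => h; apply: nA; split => //; left; rewrite -lE.
  split => //; rewrite leNgt; apply/negP => h; apply: nA; split => //.
  by right; rewrite -lE// -uE.
rewrite (valueK _ _ _ _ X_diffusion r lambda N N_poisson N_indep
  l u l_meas u_meas l_ge0 LU_sup)//.
apply: (@le_trans _ _ (\int[P]_w stopped x S w)%E); last first.
  apply: ge0_le_integral => //.
  - exact: measurable_stopped.
  - by apply/measurable_EFinP; exact: measurable_payoff0.
  move=> w _; rewrite stoppedE lee_fin /payoff0 /payoff /S.
  have [ts|st] := leP (etaA x w) (sigma w); last first.
    rewrite (lt_gtF st)/= (X_tau x sigma)//.
    apply: ler_wpM2l; first exact: discount_ge0.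
    have sfin : (sigma w < +oo)%E by apply: lt_le_trans st _; exact: leey.
    have nA : ~ A (path x (fine (sigma w)) w).
      move: sfin st; have [_ vs] := rcs; case: (vs w) => [->//|[n n1 ->] _ st].
      exact: not_hit.
    have [lv lu] := notA _ (path_in _ _ _ _ X_diffusion _ _ _) nA.
    by rewrite /psi ge_max lu ge_min lexx orbT.
  have [eoo|efin] := eqVneq (etaA x w) +oo%E.
    rewrite eoo discounty mul0r; have -> : sigma w = +oo%E.
      by apply/eqP; rewrite -leye_eq -eoo.
    by rewrite !ltxx andbF/=.
  have efin' : (etaA x w < +oo)%E by rewrite ltey.
  rewrite (X_tau x (etaA x))//.
  have -> : ((sigma w < +oo) || (etaA x w < sigma w) && (sigma w == +oo))%E.
    by have [->|ns] := eqVneq (sigma w) +oo%E; [rewrite efin' orbT|rewrite ltey ns].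
  apply: ler_wpM2l; first exact: discount_ge0.
  have [Iy hA] := hit A x w Ix efin'.
  rewrite /psi ge_max lexx/=; move: hA; rewrite -lE// -uE//.
  by move=> [h|[_ h]]; rewrite ge_min; apply/orP; [left|right]; exact: ltW.
apply: (value_le_stopped P P_complete _ _ _ X_diffusion r lambda r_gt0 lambda_gt0 N N_poisson N_indep
  l u l_meas u_meas l_ge0 u_ge0 lu_H2 LU_sup L_lim U_lim x S Ix) => //; [by case: rcS|by case: rcS|].
move=> w n n0 TS; rewrite PsiE -(valueK _ _ _ _ X_diffusion r lambda N N_poisson N_indep
  l u l_meas u_meas l_ge0 LU_sup) lee_fin.
have nA : ~ A (path x (fine (T n w)) w).
  by apply: not_hit => //; apply: lt_le_trans TS _; rewrite ge_min lexx.
have [lv _] := notA _ (path_in _ _ _ _ X_diffusion _ _ _) nA.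
by rewrite /psi ge_max lv ge_min lexx.
Qed.

Lemma saddle_point_value x : I x ->
  game_value P r l u X N M x (v x) /\ saddle_point P r l u X N M x (etaA x) (etaB x).
Proof.
move=> Ix; have rcA := etaA_RC x Ix; have rcB := etaB_RC x Ix.
have J : expected_payoff P r l u X M x (etaA x) (etaB x) = (v x)%:E.
  by apply/eqP; rewrite eq_le payoff_le_value// value_le_payoff.
split; last first.
  by split => // [tau rct|sigma rcs]; rewrite J; [exact: payoff_le_value|exact: value_le_payoff].
split; apply/eqP; rewrite eq_le; apply/andP; split.
- apply: (@le_trans _ _ (ereal_sup [set expected_payoff P r l u X M x tau (etaB x) | tau in RC x])).
    by apply: ereal_inf_lbound; exists (etaB x).
  by apply: ge_ereal_sup => _ [tau rct <-]; exact: payoff_le_value.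
- apply: le_ereal_inf_tmp => _ [sigma rcs <-].
  apply: (le_trans (value_le_payoff x sigma Ix rcs)).
  by apply: ereal_sup_ubound; exists (etaA x).
- apply: ge_ereal_sup => _ [tau rct <-].
  apply: (le_trans _ (payoff_le_value x tau Ix rct)).
  by apply: ereal_inf_lbound; exists (etaB x).
- apply: (@le_trans _ _ (ereal_inf [set expected_payoff P r l u X M x (etaA x) sigma | sigma in RC x])).
    by apply: le_ereal_inf_tmp => _ [sigma rcs <-]; exact: value_le_payoff.
  by apply: ereal_sup_ubound; exists (etaA x).
Qed.

Lemma value_dynamic_programming x : I x ->
  ((v x)%:E = 'E_P[(fun w => discount r (T 1 w) *
     Num.max (l (X x (fine (T 1 w)) w))
       (Num.min (v (X x (fine (T 1 w)) w)) (u (X x (fine (T 1 w)) w))))%R])%E.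
Proof.
move=> Ix; rewrite unlock (valueK _ _ _ _ X_diffusion r lambda N N_poisson N_indep
  l u l_meas u_meas l_ge0 LU_sup).
have mV : measurable_fun setT V by exact: (measurable_valueE _ _ _ _ X_diffusion r lambda).
rewrite (valueE_fix _ _ _ _ X_diffusion r lambda N N_poisson N_indep l u l_meas u_meas l_ge0).
rewrite (resolventE _ _ _ _ X_diffusion r lambda N N_poisson N_indep).
- apply: eq_integral => w _; rewrite -[LHS]/(stopped x (T 1) w) stoppedE /psi.
  have Iy := path_in _ _ _ _ X_diffusion x (fine (T 1 w)) w.
  by rewrite lE// uE// pathE// fine_ge0// jump_time_ge0.
- exact: (measurable_stop_or_continue _ _ _ _ X_diffusion).
- by move=> y; exact: stop_or_continue_ge0.
Qed.

(** The terminal payoff is null almost surely from every starting point, so the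
inner expectation is zero at every sample point, the path being in [I]. *)
Lemma terminal_cond_expectation x gamma (D : R -> set Omega) : I x -> RC x gamma ->
  is_cond_expectation P (stopped_sigma (common_filtration P (X x) N) gamma)
    (fun w => M x w * \1_(D x) w)
    (fun w => (discount r (gamma w))%:E *
       'E_P[(fun w' => M (X x (fine (gamma w)) w) w' * \1_(D (X x (fine (gamma w)) w)) w')%R])%E.
Proof.
move=> Ix rc.
have ae0 y : I y -> {ae P, forall w, ((M y w * \1_(D y) w)%:E = 0)%E}.
  by move=> Iy; apply: filterS (M_eq0 y Iy) => w ->; rewrite mul0r.
have Z0 : (fun w => (discount r (gamma w))%:E *
    'E_P[(fun w' => M (X x (fine (gamma w)) w) w' * \1_(D (X x (fine (gamma w)) w)) w')%R])%E = cst 0%E.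
  apply/funext => w; rewrite unlock (ae0_integral P P_complete) ?mule0//; apply: ae0.
  by rewrite X_tau//; exact: path_in.
have m0 := ae0_measurable P P_complete _ (ae0 x Ix).
rewrite Z0; split.
- apply/integrableP; split => //.
  rewrite (ae0_integral P P_complete) ?ltry//; apply: filterS (M_eq0 x Ix) => w /= ->.
  by rewrite mul0r normr0.
- exact: integrable0.
- exact: measurable_cst.
- move=> E _; rewrite integral0 integral_indicE (ae0_integral P P_complete)//.
  by apply: filterS (ae0 x Ix) => w ->; rewrite mule0.
Qed.

End game.

Theorem theorem5p8 (R : realType) (d : measure_display)
    (Omega : measurableType d) (P : probability Omega R)
    (P_complete : measure_is_complete P)
    (W : R -> Omega -> R) (I : set R) (X : R -> R -> Omega -> R)
    (X_diffusion : regular_diffusion P W I X)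
    (r lambda : R) (r_gt0 : 0 < r) (lambda_gt0 : 0 < lambda)
    (N : R -> Omega -> nat) (N_poisson : poisson_process P lambda N)
    (N_indep : forall x, I x ->
       independent_sigma P (sigma_process `[0, +oo[ (X x))
                           (sigma_process `[0, +oo[ N))
    (l u : R -> R)
    (l_meas : measurable_fun I l) (u_meas : measurable_fun I u)
    (l_ge0 : forall x, I x -> 0 <= l x) (u_ge0 : forall x, I x -> 0 <= u x)
    (M : R -> Omega -> R)
    (M_eq0 : forall x, I x -> {ae P, forall w, M x w = 0})
    (lu_H2 : forall x, I x -> exists alpha : R, [/\ - r < alpha,
       H2 P (common_filtration P (X x) N) alpha (fun t w => l (X x t w)) &
       H2 P (common_filtration P (X x) N) alpha (fun t w => u (X x t w))])
    (LU_sup : forall x, I x ->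
       (\int[P]_w ereal_sup
          [set (Num.max (expR (- r * t) * l (X x t w))
                        (expR (- r * t) * u (X x t w)))%:E | t in `[0%R, +oo[]
        < +oo)%E)
    (L_lim : forall x, I x -> {ae P, forall w,
       cvg (expR (- r * t) * l (X x t w) @[t --> +oo])})
    (U_lim : forall x, I x -> {ae P, forall w,
       cvg (expR (- r * t) * u (X x t w) @[t --> +oo])}) :
  exists v : R -> R,
    let A := [set x | I x /\ (v x < l x \/ (l x <= v x /\ u x < l x))] in
    let B := [set x | I x /\ u x < v x] in
    let etaA x := poisson_hitting (X x) N A in
    let etaB x := poisson_hitting (X x) N B in
    let T1 := jump_time N 1 in
    let MAB x w :=
      M x w * \1_([set w' | Order.min (etaA x w') (etaB x w') = +oo%E]) w in
    [/\ forall x, I x ->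
          game_value P r l u X N M x (v x) /\
          saddle_point P r l u X N M x (etaA x) (etaB x),
        forall x gamma, I x -> poisson_stopping P (X x) N gamma ->
          is_cond_expectation P
            (stopped_sigma (common_filtration P (X x) N) gamma)
            (MAB x)
            (fun w => (discount r (gamma w))%:E *
                      'E_P[MAB (X x (fine (gamma w)) w)])%E &
        forall x, I x ->
          (v x)%:E =
          ('E_P[(fun w => discount r (T1 w) *
             Num.max (l (X x (fine (T1 w)) w))
               (Num.min (v (X x (fine (T1 w)) w))
                        (u (X x (fine (T1 w)) w))))%R])%E].
Proof.
exists (value X_diffusion r N l u) => A B etaA etaB T1 MAB; split.
- by move=> x Ix; exact: (saddle_point_value P P_complete W I X X_diffusion r lambda).
- move=> x gamma Ix rc.
  exact: (terminal_cond_expectation P P_complete W I X X_diffusion r N M M_eq0 x gamma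
    (fun y => [set w' | Order.min (etaA y w') (etaB y w') = +oo%E]) Ix rc).
- by move=> x Ix; exact: (value_dynamic_programming P W I X X_diffusion r lambda).
Qed.
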